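(* Let $(E,\phi)$ be a uniformizable Anderson $A$-module over $L$, $\mathfrak p\neq0$ a prime ideal of $A$ with uniformizer $\pi\in A$, and let $h_1,\dots,h_r\in\mathfrak{sf}(E)$ be an $A_{(\mathfrak p)}$-basis of $A_{(\mathfrak p)}\otimes_A\mathfrak{sf}(E)$, viewed as elements of $\hat H_\mathfrak p$ via the inclusion $\mathfrak{sf}(E)\hookrightarrow\hat H_\mathfrak p$. Let $t\in A\setminus\mathbb F_q$ be such that $\partial_\pi^{(1)}(t)\in A_{(\mathfrak p)}^\times$. Then: \begin{enumerate} \item The hyperderivation $(\partial_t^{(n)})_{n\ge0}$ on $\mathbb F_q[t]$ extends uniquely to a hyperderivation on $A_{(\mathfrak p)}$. \item For all $h\in\hat H_\mathfrak p$ and $n\ge0$, one has $\partial_t^{(n)}(h)(\mathfrak p)\in\mathbb F_\mathfrak p\otimes E[\mathfrak p^{n+1}]$ and \[\partial_t^{(n)}(h)(\mathfrak p)\equiv\Big(\partial_\pi^{(1)}(t)^{-n}\cdot\partial_\pi^{(n)}(h)\Big)(\mathfrak p)\mod \mathbb F_\mathfrak p\otimes E[\mathfrak p^n].\] \item For all $n\ge0$, the elements $(\mathrm{tr}\otimes\mathrm{id})\big(\partial_t^{(n)}(h_i)(\mathfrak p)\big)$, $i=1,\dots,r$, form an $(A/\mathfrak p^{n+1})$-basis of $E[\mathfrak p^{n+1}]$, where $\mathrm{tr}:\mathbb F_\mathfrak p\to\mathbb F_q$ is the trace. \end{enumerate}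
   Context: $\mathbb F_q$ finite field, $C$ smooth projective geometrically irreducible curve over $\mathbb F_q$, $\infty\in C$ closed point, $A=H^0(C\setminus\{\infty\},\mathcal O_C)$, $K=\mathrm{Frac}(A)$, $\mathbb C_\infty$ the completion at a place above $\infty$ of an algebraic closure of $K$. Unlabeled tensors over $\mathbb F_q$. $K\subseteq L\subseteq\mathbb C_\infty$, $\ell:K\to L$ inclusion. Anderson $A$-module $(E,\phi)$ over $L$: $E\cong\mathbb G_{a,L}^d$ as $\mathbb F_q$-vector space schemes, $\phi:A\to\mathrm{End}_{\mathbb F_q\text{-v.s.}}(E)$ ring homomorphism with $d\phi_a-\ell(a)$ nilpotent on $\mathrm{Lie}\,E$; uniformizable means the exponential $\exp_E$ (the unique $\mathbb F_q$-linear $\mathrm{Lie}\,E\to E(\mathbb C_\infty)$ with $\phi_a\exp_E=\exp_E d\phi_a$, $d\exp_E=\mathrm{id}$) is surjective. $E[\mathfrak a]=\bigcap_{a\in\mathfrak a}\ker(\phi_a|_{E(\mathbb C_\infty)})$. $A_{(\mathfrak p)}$ is the local ring of $A$ at $\mathfrak p$, $A_\mathfrak p$ the completion, $\mathbb F_\mathfrak p=A/\mathfrak p$, and $A_\mathfrak p\cong\mathbb F_\mathfrak p[[\pi]]$ via the unique section $\mathbb F_\mathfrak p\hookrightarrow A_\mathfrak p$. A hyperderivation on an $\mathbb F_q$-algebra $R$ is a family of $\mathbb F_q$-linear maps $\partial^{(n)}:R\to R$ with $\partial^{(0)}=\mathrm{id}$ and $\partial^{(n)}(fg)=\sum_{i+j=n}\partial^{(i)}(f)\partial^{(j)}(g)$.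 For $u\in\{t,\pi\}$, $\partial_u^{(n)}$ on $\mathbb F_q[u]$ is given by $\partial_u^{(n)}(u^i)=\binom{i}{n}u^{i-n}$; $\partial_\pi^{(n)}$ extends uniquely to $A_{(\mathfrak p)}$ and continuously to $A_\mathfrak p$, where $\partial_\pi^{(n)}(\sum_j c_j\pi^j)=\sum_{j\ge n}\binom{j}{n}c_j\pi^{j-n}$ ($c_j\in\mathbb F_\mathfrak p$). With a max norm on $E(\mathbb C_\infty)\cong\mathbb C_\infty^d$, let $E(\mathbb T)=\{\sum_{a\in B(A)}a\otimes e_a:\|e_a\|\to0\}$ ($B(A)$ an $\mathbb F_q$-basis of $A$) and $E((A\otimes\mathbb C_\infty)_\mathfrak p)=\varprojlim_n(A/\mathfrak p^{n+1})\otimes E(\mathbb C_\infty)$, each with $\phi_a$ acting on the second tensor factor and multiplication $a\cdot$ on the first; $\mathfrak{sf}(E)=\{h\in E(\mathbb T):\phi_a(h)=a\cdot h\ \forall a\}$, $\hat H_\mathfrak p=\{h\in E((A\otimes\mathbb C_\infty)_\mathfrak p):\phi_a(h)=a\cdot h\ \forall a\}$, and $E(\mathbb T)\hookrightarrow E((A\otimes\mathbb C_\infty)_\mathfrak p)$ is the natural continuous injection. Hyperderivations on $A_{(\mathfrak p)}$ act on $E((A\otimes\mathbb C_\infty)_\mathfrak p)$ by acting on the first tensor factor (coordinatewise, $\mathbb C_\infty$-linearly) and extending $\mathfrak p$-adically continuously. For $h\in E((A\otimes\mathbb C_\infty)_\mathfrak p)$, its evaluation $h(\mathfrak p)$ is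 its image in $E((A\otimes\mathbb C_\infty)_\mathfrak p)/\mathfrak pE((A\otimes\mathbb C_\infty)_\mathfrak p)\cong\mathbb F_\mathfrak p\otimes E(\mathbb C_\infty)$. *)

(* Defs.v *)
From HB Require Import structures.
From Stdlib Require List.
From mathcomp Require Import all_boot all_order all_algebra all_field.
From mathcomp Require Import boolp classical_sets functions reals.
From mathcomp Require Import topology normedtype.

Set Implicit Arguments.
Unset Strict Implicit.
Unset Printing Implicit Defensive.

Import Order.TTheory GRing.Theory Num.Theory.
Import numFieldNormedType.Exports.

Local Open Scope classical_set_scope.
Local Open Scope ring_scope.

(* A smooth projective geometrically irreducible curve over a finite field k
   is given by its function field K (finitely generated of transcendence
   degree 1 over k, with k algebraically closed in K); its closed points are
   the nontrivial valuation rings of K containing k. *)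
Section Curve.
Variables (k : finFieldType) (K : fieldType) (kK : k -> K).

Definition in_simple_ext (x z : K) : Prop :=
  exists f g : {poly k}, (map_poly kK g).[x] != 0 /\
    z = (map_poly kK f).[x] / (map_poly kK g).[x].

Definition is_function_field : Prop :=
  (exists x : K, ~ algebraicOver kK x /\
     exists (n : nat) (w : 'I_n -> K), forall y : K,
       exists c : 'I_n -> K, (forall i, in_simple_ext x (c i)) /\
         y = \sum_(i < n) c i * w i)
  /\ (forall y : K, algebraicOver kK y -> exists c : k, kK c = y).

Definition is_closed_point (O : set K) : Prop :=
  [/\ forall c : k, O (kK c),
      forall x y, O x -> O y -> O (x - y),
      forall x y, O x -> O y -> O (x * y),
      exists x, ~ O x
    & forall x, x != 0 -> O x \/ O x^-1].

(* The inclusion iA : A -> K identifies A with H^0(C \ {oo}, O_C). *)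
Definition is_regular_ring (Ooo : set K) (A : idomainType) (iA : A -> K) :
    Prop :=
  injective iA /\
  forall f : K, (exists a : A, iA a = f) <->
    (forall O : set K, is_closed_point O -> O <> Ooo -> O f).

End Curve.

Section Cinfty.
Variables (R : realType) (C : fieldType) (abs : C -> R).

Definition is_ultrametric_abs : Prop :=
  [/\ forall x, 0 <= abs x,
      forall x, abs x = 0 <-> x = 0,
      forall x y, abs (x * y) = abs x * abs y
    & forall x y, abs (x + y) <= Num.max (abs x) (abs y)].

Definition abs_complete : Prop :=
  forall u : nat -> C,
    (forall e : R, 0 < e -> exists N : nat, forall m n : nat,
       (N <= m)%N -> (N <= n)%N -> abs (u m - u n) < e) ->
    exists l : C, (fun n => abs (u n - l)) @ \oo --> (0 : R).

(* Kbar is an algebraic closure of K, and C is its completion for an absolute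
   value whose restriction to K belongs to the place Ooo. *)
Definition is_Cinfty (K : fieldType) (Ooo : set K) (Kbar : closedFieldType)
    (iK : K -> Kbar) (jC : Kbar -> C) : Prop :=
  [/\ forall x : Kbar, algebraicOver iK x,
      is_ultrametric_abs,
      forall x : K, abs (jC (iK x)) <= 1 <-> Ooo x,
      forall (z : C) (e : R), 0 < e -> exists y : Kbar, abs (z - jC y) < e
    & abs_complete].

Definition maxnorm d (v : 'cV[C]_d) : R :=
  \big[Num.max/0]_(i < d) abs (v i 0).

Definition vcvg d (u : nat -> 'cV[C]_d) (l : 'cV[C]_d) : Prop :=
  (fun n => maxnorm (u n - l)) @ \oo --> (0 : R).

End Cinfty.

(* Tensor products.  For M and V modules over B (with actions actM, actV),
   N a submodule of M and P a submodule of V, the elements of (M/N) (x)_B P are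
   represented by formal sums [:: (m_1, v_1); ...] with v_i in P, standing for
   \sum_i m_i (x) v_i; two of them are equal in the tensor product iff every
   B-balanced biadditive map on (M/N) x P takes the same value on them. *)
Section Tensor.
Variables (B : Type) (M V : zmodType).
Variables (actM : B -> M -> M) (actV : B -> V -> V) (N : set M) (P : set V).

Definition balanced (W : zmodType) (f : M -> V -> W) : Prop :=
  [/\ forall x y v, P v -> f (x + y) v = f x v + f y v,
      forall x v w, P v -> P w -> f x (v + w) = f x v + f x w,
      forall b x v, P v -> f (actM b x) v = f x (actV b v)
    & forall x v, N x -> P v -> f x v = 0].

Definition tensor_eq (s s' : seq (M * V)) : Prop :=
  forall (W : zmodType) (f : M -> V -> W), balanced f ->
    \sum_(u <- s) f u.1 u.2 = \sum_(u <- s') f u.1 u.2.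

End Tensor.

Definition tensor_map (M M' V V' : Type) (f : M -> M') (g : V -> V') :
  seq (M * V) -> seq (M' * V') := map (fun u => (f u.1, g u.2)).

Section Ideals.
Variable A : idomainType.

Definition ideal_mul (I J : set A) : set A :=
  [set x | exists s : seq (A * A),
     (forall u, u \in s -> I u.1 /\ J u.2) /\ x = \sum_(u <- s) u.1 * u.2].

Fixpoint ideal_pow (I : set A) (n : nat) : set A :=
  if n is m.+1 then ideal_mul I (ideal_pow I m) else setT.

Variable p : prime_idealr A.

Definition prime_pow (n : nat) : set A := ideal_pow [set` p] n.

(* j : A -> Ap is the localization of A at p. *)
Definition is_local_ring (Ap : idomainType) (j : A -> Ap) : Prop :=
  [/\ injective j,
      forall s, s \notin p -> j s \is a GRing.unit
    & forall y : Ap, exists a s, s \notin p /\ y = j a / j s].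

(* p^n A_(p) *)
Definition local_pow (Ap : idomainType) (j : A -> Ap) (n : nat) : set Ap :=
  [set y | exists a s, [/\ prime_pow n a, s \notin p & y = j a / j s]].

End Ideals.

Section Hyperderivations.
Variables (k : finFieldType) (R : comNzRingType) (kR : k -> R).

Definition is_hyperderivation (D : nat -> R -> R) : Prop :=
  [/\ forall n x y, D n (x + y) = D n x + D n y,
      forall n c x, D n (kR c * x) = kR c * D n x,
      forall x, D 0%N x = x
    & forall n x y, D n (x * y) = \sum_(i < n.+1) D i x * D (n - i)%N y].

(* D extends the hyperderivation d_u on k[u]; f^`N(n) is the polynomial
   obtained from f by 'X^i |-> 'C(i, n) 'X^(i - n). *)
Definition extends_hyper (u : R) (D : nat -> R -> R) : Prop :=
  forall (n : nat) (f : {poly k}),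
    D n (map_poly kR f).[u] = (map_poly kR f^`N(n)).[u].

Definition hyper_ext (u : R) (D : nat -> R -> R) : Prop :=
  is_hyperderivation D /\ extends_hyper u D.

End Hyperderivations.

Definition field_trace (k : fieldType) (F : fieldExtType k) (x : F) : k :=
  \tr (passmx.mxof (vbasis {:F}) (vbasis {:F}) (amull x)).

(* Endomorphisms of the F_q-vector space scheme G_a^d are the d x d matrices
   over the twisted polynomial ring C{tau}, tau c = c^q tau.  A twisted
   polynomial \sum_l c_l tau^l is stored as \sum_l c_l 'X^l : {poly C}, so that
   its product is tau_mul and not the product of {poly C}. *)
Section TwistedPolynomials.
Variables (q : nat) (C : fieldType) (d : nat).

Definition tau_mul (f g : {poly C}) : {poly C} :=
  \sum_(l < size f) f`_l *: (map_poly (fun c => c ^+ (q ^ l)) g * 'X^l).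

Definition tau_mulmx (P Q : 'M[{poly C}]_d) : 'M[{poly C}]_d :=
  \matrix_(i, m) \sum_(n < d) tau_mul (P i n) (Q n m).

Definition tau_app (P : 'M[{poly C}]_d) (x : 'cV[C]_d) : 'cV[C]_d :=
  \col_i \sum_(m < d) \sum_(l < size (P i m)) (P i m)`_l * x m 0 ^+ (q ^ l).

Definition Lie (P : 'M[{poly C}]_d) : 'M[C]_d :=
  map_mx (fun f : {poly C} => f`_0) P.

End TwistedPolynomials.

(* An Anderson module is given in a coordinate system E = G_a^d. *)
Section AndersonModules.
Variables (q : nat) (A : idomainType) (C : fieldType) (d : nat).
Variables (phi : A -> 'M[{poly C}]_d).

Definition is_Anderson_module (ell : A -> C) (L : {pred C}) : Prop :=
  [/\ forall a i m, phi a i m \is a polyOver L,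
      phi 1 = 1%:M,
      forall a b, phi (a + b) = phi a + phi b,
      forall a b, phi (a * b) = tau_mulmx q (phi a) (phi b)
    & forall a, exists n : nat, (Lie (phi a) - (ell a)%:M) ^+ n = 0].

Definition act (a : A) (x : 'cV[C]_d) : 'cV[C]_d := tau_app q (phi a) x.

Definition torsion (I : set A) : set 'cV[C]_d :=
  [set x | forall a, I a -> act a x = 0].

Variables (R : realType) (abs : C -> R).

Definition is_exponential (E : 'cV[C]_d -> 'cV[C]_d) : Prop :=
  (exists e : nat -> 'M[C]_d, e 0%N = 1%:M /\
     forall x, vcvg abs
       (fun n => \sum_(l < n) e l *m map_mx (fun c => c ^+ (q ^ l)) x) (E x))
  /\ (forall a x, act a (E x) = E (Lie (phi a) *m x)).

Definition uniformizable : Prop :=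
  exists E, is_exponential E /\ forall y, exists x, E x = y.

End AndersonModules.

(* b is a k-basis of A, the coordinates of x being the coefficients of bc x. *)
Definition is_kbasis (k : fieldType) (A : idomainType) (kA : k -> A)
    (b : nat -> A) (bc : A -> {poly k}) : Prop :=
  (forall x, x = \sum_(i < size (bc x)) kA (bc x)`_i * b i) /\
  (forall f : {poly k}, bc (\sum_(i < size f) kA f`_i * b i) = f).

(* An element \sum_i b_i (x) e_i of E(T) is stored as the sequence e.  Since
   a . (\sum_i b_i (x) e_i) = \sum_m b_m (x) (\sum_i (bc (a b_i))_m e_i),
   sf(E) consists of the null sequences such that this inner sum is phi_a(e_m)
   for all a and m. *)
Section SpecialFunctions.
Variables (q : nat) (k : fieldType) (A : idomainType) (C : fieldType) (d : nat).
Variables (kC : k -> C) (b : nat -> A) (bc : A -> {poly k}).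
Variables (phi : A -> 'M[{poly C}]_d) (R : realType) (abs : C -> R).

Definition in_ET (e : nat -> 'cV[C]_d) : Prop :=
  (fun i => maxnorm abs (e i)) @ \oo --> (0 : R).

Definition sf : set (nat -> 'cV[C]_d) :=
  [set e | in_ET e /\
     forall (a : A) (m : nat),
       vcvg abs (fun n => \sum_(i < n) kC (bc (a * b i))`_m *: e i)
         (act q phi a (e m))].

(* h is an A_(p)-basis of A_(p) (x)_A sf(E).  On sf(E), multiplication by a
   coincides with applying phi_a to the coefficients. *)
Definition is_local_basis (Ap : idomainType) (j : A -> Ap) (r : nat)
    (h : 'I_r -> nat -> 'cV[C]_d) : Prop :=
  (forall i, sf (h i)) /\
  forall s : seq (Ap * (nat -> 'cV[C]_d)), List.Forall (fun u => sf u.2) s ->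
    exists! y : {ffun 'I_r -> Ap},
      tensor_eq (fun a x => j a * x) (fun a e i => act q phi a (e i))
        [set 0] sf s [seq (y i, h i) | i <- enum 'I_r].

End SpecialFunctions.

Section Completion.
Variables (q : nat) (k : finFieldType) (A Ap : idomainType).
Variables (p : prime_idealr A) (j : A -> Ap) (kAp : k -> Ap).
Variables (C : fieldType) (d : nat) (kC : k -> C).
Variables (phi : A -> 'M[{poly C}]_d).
Local Notation V := 'cV[C]_d.

(* Equality in (A/p^n) (x) E(C_oo), where A/p^n = A_(p)/p^n A_(p). *)
Definition level_eq (n : nat) : seq (Ap * V) -> seq (Ap * V) -> Prop :=
  tensor_eq (fun c x => kAp c * x) (fun c v => kC c *: v)
    (local_pow p j n) setT.

(* The elements of \varprojlim_n (A/p^(n+1)) (x) E(C_oo). *)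
Definition in_Ep (h : nat -> seq (Ap * V)) : Prop :=
  forall n, level_eq n.+1 (h n.+1) (h n).

Definition phi_Ep (a : A) (h : nat -> seq (Ap * V)) : nat -> seq (Ap * V) :=
  fun n => tensor_map id (act q phi a) (h n).

Definition scale_Ep (y : Ap) (h : nat -> seq (Ap * V)) : nat -> seq (Ap * V) :=
  fun n => tensor_map ( *%R y) id (h n).

(* D^(i) maps p^(n+i+1) A_(p) into p^(n+1) A_(p): the component of D^(i)(h) in
   (A/p^(n+1)) (x) E(C_oo) is computed from that of h modulo p^(n+i+1). *)
Definition hyper_Ep (D : nat -> Ap -> Ap) (i : nat) (h : nat -> seq (Ap * V)) :
    nat -> seq (Ap * V) :=
  fun n => tensor_map (D i) id (h (n + i)%N).

Definition Hhat : set (nat -> seq (Ap * V)) :=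
  [set h | in_Ep h /\
     forall a n, level_eq n.+1 (phi_Ep a h n) (scale_Ep (j a) h n)].

(* h is the image of e under E(T) -> \varprojlim_n (A/p^(n+1)) (x) E(C_oo):
   \sum_i b_i (x) e_i converges to h n in (A/p^(n+1)) (x) E(C_oo), where a
   tensor is small if it is a sum of terms x (x) v with v small. *)
Definition ET_image (b : nat -> A) (R : realType) (abs : C -> R)
    (e : nat -> V) (h : nat -> seq (Ap * V)) : Prop :=
  forall (n : nat) (eps : R), 0 < eps ->
    exists N0 : nat, forall N : nat, (N0 <= N)%N ->
      exists s : seq (Ap * V),
        List.Forall (fun u => maxnorm abs u.2 < eps) s /\
        level_eq n.+1 (h n) ([seq (j (b i), e i) | i <- iota 0 N] ++ s).

(* res : A_(p) -> F_p is the reduction map with F_p = A/p. *)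
Definition is_residue_field (Fp : fieldExtType k) (res : Ap -> Fp) : Prop :=
  [/\ forall c, res (kAp c) = c%:A,
      forall z, exists a, res (j a) = z
    & forall y, res y = 0 <-> local_pow p j 1 y].

Variables (Fp : fieldExtType k) (res : Ap -> Fp).

(* h(p), in F_p (x) E(C_oo) *)
Definition eval_Ep (h : nat -> seq (Ap * V)) : seq (Fp * V) :=
  tensor_map res id (h 0%N).

(* s lies in the subspace F_p (x) X of F_p (x) E(C_oo). *)
Definition in_FpX (X : set V) (s : seq (Fp * V)) : Prop :=
  exists s' : seq (Fp * V), List.Forall (fun u => X u.2) s' /\
    tensor_eq (fun c (x : Fp) => c *: x) (fun c v => kC c *: v)
      [set 0] setT s s'.

Definition tensor_sub (s s' : seq (Fp * V)) : seq (Fp * V) :=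
  s ++ tensor_map -%R id s'.

(* tr (x) id : F_p (x) E(C_oo) -> E(C_oo) *)
Definition tr_id (s : seq (Fp * V)) : V :=
  \sum_(u <- s) kC (field_trace u.1) *: u.2.

(* y is an (A/I)-basis of E[I]. *)
Definition is_torsion_basis (I : set A) (r : nat) (y : 'I_r -> V) : Prop :=
  [/\ forall i, torsion q phi I (y i),
      forall x, torsion q phi I x ->
        exists a : 'I_r -> A, x = \sum_(i < r) act q phi (a i) (y i)
    & forall a : 'I_r -> A,
        \sum_(i < r) act q phi (a i) (y i) = 0 -> forall i, I (a i)].

End Completion.

(* Main.v *)
(* For an A-module W let W' denote its k-dual.  A special function \sum_i b_i (x) e_i is the same
   thing as a continuous A-linear map F : A' -> E, F(mu) = \sum_i mu(b_i) e_i, where A' carries the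
   topology of pointwise convergence.

   If T is the Taylor expansion of t along d_pi, then d_pi^(n) = \sum_a [X^n](T^a) d_t^(a).  This
   triangular system constructs d_t and gives the congruence in (2).  Uniqueness holds because a
   k-derivation of A_(p) killing pi is zero: f = f^Q + pi g with Q = #F_p, and Krull's intersection
   theorem applies.  The torsion statement in (2) follows from d^(n)(p^(n+1)) c p by testing on
   functionals.

   For (3), tau_n = tr o (evaluation at p) o d_t^(n) generates the A-module (A/p^(n+1))', and the
   n-th element attached to a special function F is F(tau_n).  If F(tau_n) = 0 then F vanishes on
   (A/p^(n+1))', and F is locally divisible by pi^(n+1) because A' is divisible; this gives
   independence.  For surjectivity let y be in E[p^m].  Uniformizability gives a null sequence of
   successive pi-division points of y, that is, a k[pi]-linear continuous map k[pi]' -> E.  Compose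
   it with A' -> k[pi]' and apply an element \sum a (x) b of A (x)_{k[pi]} A which is annihilated by
   the diagonal ideal and has nonzero image D = \sum ab in A.  The result is A-linear, and in
   A_p = F_p[[pi]] only the trivial Galois component of the trace survives, so its value at the
   generator of (A/p^m)' is D y.  The factor D is removed by the divisibility argument. *)
Require Import Defs.
From HB Require Import structures.
From mathcomp Require Import all_boot all_order all_algebra all_field.
From mathcomp Require Import ring zify.
From mathcomp Require Import boolp classical_sets functions reals.
From mathcomp Require Import topology normedtype sequences.

Set Implicit Arguments.
Unset Strict Implicit.
Unset Printing Implicit Defensive.

Import Order.TTheory GRing.Theory Num.Theory.
Import numFieldNormedType.Exports.

Local Open Scope classical_set_scope.
Local Open Scope ring_scope.

(** * Finite fields and the trace *)

(** The uniformizer pi generates p only locally, since it may vanish at other points of the curve.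
    Hence many statements hold up to a factor s outside p, which is invertible modulo every p^n. The
    image D may itself vanish at p, to some order e; so y in E[p^(n+1)] is divided by D beforehand,
    the special function is built at level n + e, and pi^e is divided out at the end. The division
    towers are null because |ell(pi)| > 1: pi is not constant, so it has a pole, and the only place
    available is infinity. This rests on the existence of a valuation ring omitting a given
    transcendental element. The finiteness properties of [A] (Krull intersection, dimension of A/gA,
    rank over k[pi]) are all drawn from one counting bound for relations over k[z]. Coefficients of
    expansions in Fp[[pi]] are read off as residues of d_pi^(n). The element with nonzero image D
    exists because each element of [A] satisfies a separable relation over k[pi], which is forced by
    the derivation d_pi^(1) with value 1 at pi. *)

Section Frobenius.
Variables (k : finFieldType) (R : comNzRingType) (f : {rmorphism k -> R}).

Lemma card_pchar_nat s : [pchar R].-nat (#|k| ^ s)%N.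
Proof.
have [p p_pr pk] := finPcharP k.
rewrite pnatX; apply/orP; left.
rewrite (card_pprimeChar pk) pnatX; apply/orP; left.
by rewrite pnatE // (rmorph_pchar f).
Qed.

Lemma frobD s : {morph (fun x : R => x ^+ (#|k| ^ s)) : x y / x + y}.
Proof. by move=> x y; rewrite exprDn_pchar // card_pchar_nat. Qed.

Lemma frob0 s : (0 : R) ^+ (#|k| ^ s) = 0.
Proof. by rewrite expr0n; case: eqP => // /eqP; rewrite expn_eq0 -leqn0 leqNgt (ltnW (finNzRing_gt1 _)). Qed.

Lemma frobN s : {morph (fun x : R => x ^+ (#|k| ^ s)) : x / - x}.
Proof.
by move=> x; apply/eqP; rewrite -addr_eq0 -frobD addNr frob0.
Qed.

Lemma frob_sum s (I : Type) (r : seq I) (P : pred I) (F : I -> R) :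
  (\sum_(i <- r | P i) F i) ^+ (#|k| ^ s)
  = \sum_(i <- r | P i) F i ^+ (#|k| ^ s).
Proof. exact: (big_morph _ (frobD s) (frob0 s)). Qed.

Lemma frob_const s c : f c ^+ (#|k| ^ s) = f c.
Proof.
rewrite -rmorphXn /=; congr (f _).
by elim: s => [|s IHs]; rewrite ?expr1 // expnSr exprM IHs expf_card.
Qed.

End Frobenius.

Section Trace.
Variables (k : finFieldType) (F : fieldExtType k).
Local Notation q := #|k|.
Local Notation f := (\dim {:F}).
Local Notation e := (vbasis {:F}).
Local Notation incl := (GRing.in_alg F).

Let e_basis : basis_of {:F} e. Proof. exact: vbasisP. Qed.

Lemma frobZ s (c : k) (x : F) : (c *: x) ^+ (q ^ s) = c *: x ^+ (q ^ s).
Proof.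
by rewrite exprZn; congr (_ *: _); exact: (frob_const idfun).
Qed.

Lemma frob_dim (x : F) : x ^+ (q ^ f) = x.
Proof. by apply/eqP; rewrite -(Fermat's_little_theorem {:F}%AS x) memvf. Qed.

Lemma card_ext_uniq : exists s : seq F, uniq s /\ size s = (q ^ f)%N.
Proof.
exists [seq passmx.vecof e v | v <- enum 'rV[k]_f]; split.
  by rewrite (map_inj_uniq (can_inj (passmx.vecofK e_basis))) enum_uniq.
by rewrite size_map -cardT card_mx mul1n.
Qed.

(** The polynomial [P] has degree below q^f and vanishes at the q^f elements of [F]. This is the
    linear independence of the powers of Frobenius, from which the properties of the trace
    follow. *)
Lemma linearized_poly_eq0 (v : 'I_f -> F) :
  (forall x, \sum_(s < f) v s * x ^+ (q ^ s) = 0) -> forall s, v s = 0.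
Proof.
move=> v0; pose P := \sum_(s < f) v s *: 'X^(q ^ s).
have q_gt1 : (1 < q)%N := finNzRing_gt1 _.
have szP : (size P <= q ^ f)%N.
  apply: (leq_trans (size_sum _ _ _)); apply/bigmax_leqP => s _.
  apply: (leq_trans (size_scale_leq _ _)); rewrite size_polyXn.
  by rewrite ltn_exp2l.
have P0 : P = 0.
  have [rs [urs szrs]] := card_ext_uniq.
  apply/eqP; apply: contraTT szP => nzP; rewrite -ltnNge -szrs.
  apply: max_poly_roots => //; apply/allP => x _.
  rewrite rootE /P horner_sum -[X in _ == X](v0 x); apply/eqP.
  by apply: eq_bigr => s _; rewrite hornerZ hornerXn.
move=> s; have := congr1 (fun Q : {poly F} => Q`_(q ^ s)) P0.
rewrite /P coef_sum coef0 (bigD1 s) //= coefZ coefXn eqxx mulr1 big1 ?addr0 //.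
move=> u us; rewrite coefZ coefXn eqn_exp2l //.
by rewrite (inj_eq val_inj) eq_sym (negbTE us) mulr0.
Qed.

(** Otherwise e_s - e_0 would be a linear relation between powers of Frobenius. *)
Lemma frob_neq s : (0 < s < f)%N -> exists x : F, x ^+ (q ^ s) != x.
Proof.
move=> /andP[s_gt0 s_lt]; apply: contrapT => H.
have f_gt0 : (0 < f)%N by apply: leq_trans s_lt.
pose v (u : 'I_f) : F := (val u == s)%:R - (val u == 0%N)%:R.
have /(_ (Ordinal s_lt)) : forall u, v u = 0.
  apply: linearized_poly_eq0 => x.
  have E u0 (Hu0 : (u0 < f)%N) : \sum_(u < f) (val u == u0)%:R * x ^+ (q ^ u) = x ^+ (q ^ u0).
    rewrite (bigD1 (Ordinal Hu0)) //= eqxx mul1r big1 ?addr0 // => u.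
    by rewrite -(inj_eq val_inj) /= => /negbTE ->; rewrite mul0r.
  under eq_bigr => u _ do rewrite mulrBl.
  rewrite sumrB !E // expn0 expr1; apply/eqP; rewrite subr_eq0.
  by apply: contrapT => /negP xs; apply: H; exists x.
rewrite /v /= eqxx; case: eqP => [E|_]; first by rewrite E in s_gt0.
by rewrite subr0 => /eqP; rewrite oner_eq0.
Qed.

(* The Moore matrix (e_l^(q^s)) diagonalizes multiplication by [x]. *)
Lemma field_trace_frob (x : F) :
  (field_trace x)%:A = \sum_(s < f) x ^+ (q ^ s).
Proof.
pose M := passmx.mxof e e (amull x).
pose W : 'M[F]_f := \matrix_(l, s) e`_l ^+ (q ^ s).
pose D : 'M[F]_f := diag_mx (\row_s x ^+ (q ^ s)).
have MW : map_mx incl M *m W = W *m D.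
  apply/matrixP => l s; rewrite mul_mx_diag !mxE.
  have xe : x * e`_l = \sum_m M l m *: e`_m.
    have -> : x * e`_l = amull x (passmx.vecof e (delta_mx 0 l)).
      by rewrite passmx.vecof_delta lfunE.
    rewrite (@passmx.hom_vecof _ _ _ e e) // -rowE /passmx.vecof.
    by apply: eq_bigr => m _; rewrite !mxE.
  rewrite -[e`_l ^+ _ * _]mulrC -exprMn xe (frob_sum incl).
  apply: eq_bigr => m _; rewrite !mxE frobZ.
  by rewrite [X in X * _]/= mulr_algl.
(* A row killed by the transpose of [W] is a linearized polynomial vanishing on a basis, hence on
   all of [F]. *)
have WU : W \in unitmx.
  rewrite -unitmx_tr -row_free_unit; apply/inj_row_free => v vW.
  apply/rowP => s; rewrite mxE; move: s.
  apply: (linearized_poly_eq0 (v := fun s => v 0 s)) => y.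
  rewrite (coord_basis e_basis (memvf y)).
  under eq_bigr => s _.
    rewrite (frob_sum incl) mulr_sumr; under eq_bigr => l _ do rewrite frobZ -scalerAr.
    over.
  rewrite exchange_big big1 //= => l _; rewrite -scaler_sumr.
  have := congr1 (fun A : 'M_(1, f) => A 0 l) vW; rewrite !mxE => vWl.
  rewrite (_ : \sum_(s < f) _ = 0) ?scaler0 // -[RHS]vWl.
  by apply: eq_bigr => s _; rewrite !mxE.
have -> : (field_trace x)%:A = \tr (map_mx incl M) by rewrite (trace_map_mx incl).
have -> : map_mx incl M = W *m (D *m invmx W).
  by rewrite mulmxA -MW mulmxK.
rewrite mxtrace_mulC -mulmxA mulVmx // mulmx1 mxtrace_diag.
by apply: eq_bigr => s _; rewrite mxE.
Qed.

Lemma field_traceD : {morph @field_trace k F : x y / x + y}.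
Proof.
move=> x y; apply: (fmorph_inj incl) => /=; rewrite scalerDl !field_trace_frob.
by rewrite -big_split; apply: eq_bigr => s _; apply: (frobD incl).
Qed.

Lemma field_traceZ c x : field_trace (c *: x : F) = c * field_trace x.
Proof.
apply: (fmorph_inj incl) => /=; rewrite -scalerA !field_trace_frob scaler_sumr.
by apply: eq_bigr => s _; rewrite frobZ.
Qed.

Lemma field_trace_neq0 : exists x : F, field_trace x != 0.
Proof.
apply: contrapT => H; have f_gt0 : (0 < f)%N by rewrite adim_gt0.
have /(_ (Ordinal f_gt0))/eqP : forall s : 'I_f, (fun _ => 1) s = 0 :> F.
  apply: linearized_poly_eq0 => x; under eq_bigr do rewrite mul1r.
  rewrite -field_trace_frob; have -> : field_trace x = 0.
    by apply/eqP; apply: contrapT => /negP ?; apply: H; exists x.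
  by rewrite scale0r.
by rewrite oner_eq0.
Qed.

(** Nondegeneracy of the trace form: a nonzero y in the kernel of the Gram matrix [T] would make the
    trace vanish on y F = F. *)
Lemma field_trace_repr (nu : F -> k) : (forall x y, nu (x + y) = nu x + nu y) ->
  (forall c x, nu (c *: x) = c * nu x) ->
  exists c, forall x, nu x = field_trace (c * x).
Proof.
move=> nuD nuZ.
have sumE (g : F -> k) (gD : {morph g : x y / x + y}) (gZ : forall c x, g (c *: x) = c * g x) x :
    g x = \sum_l coord e l x * g e`_l.
  rewrite {1}(coord_basis e_basis (memvf x)).
  have g0 : g 0 = 0 by rewrite -(scale0r 0) gZ mul0r.
  by rewrite (big_morph g gD g0); apply: eq_bigr => l _; rewrite gZ.
pose T : 'M[k]_f := \matrix_(l, m) field_trace (e`_l * e`_m).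
have TU : T \in unitmx.
  rewrite -row_free_unit; apply/inj_row_free => v vT.
  pose y := passmx.vecof e v.
  have y0 (l : 'I_f) : field_trace (y * e`_l) = 0.
    have := congr1 (fun A : 'M_(1, f) => A 0 l) vT; rewrite !mxE => <-.
    rewrite /y /passmx.vecof mulr_suml (big_morph _ field_traceD (id1 := 0)).
      by apply: eq_bigr => m _; rewrite mxE -scalerAl field_traceZ.
    by rewrite -(scale0r 0) field_traceZ mul0r.
  apply/eqP; rewrite -(passmx.vecof_eq0 e_basis); apply/eqP.
  apply: contrapT => /eqP nzy; have [x /negP[]] := field_trace_neq0.
  rewrite -[x](mulVKf nzy) (sumE (fun z => field_trace (y * z))).
  - by rewrite big1 // => l _; rewrite y0 mulr0.
  - by move=> a b; rewrite mulrDr field_traceD.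
  - by move=> c a; rewrite -scalerAr field_traceZ.
pose w := (\row_l nu e`_l) *m invmx T.
exists (passmx.vecof e w) => x; rewrite (sumE nu) //.
rewrite [RHS](sumE (fun z => field_trace (passmx.vecof e w * z))).
- apply: eq_bigr => l _; congr (_ * _).
  have /(congr1 (fun A : 'M_(1, f) => A 0 l)) : w *m T = \row_l nu e`_l by rewrite mulmxKV.
  rewrite mxE [in RHS]mxE => <-.
  rewrite /passmx.vecof mulr_suml (big_morph _ field_traceD (id1 := 0)).
    by apply: eq_bigr => m _; rewrite [T _ _]mxE -scalerAl field_traceZ.
  by rewrite -(scale0r 0) field_traceZ mul0r.
- by move=> a b; rewrite mulrDr field_traceD.
- by move=> c a; rewrite -scalerAr field_traceZ.
Qed.

End Trace.

(** * A place with a prescribed pole *)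

Section Place.
Variables (k : finFieldType) (K : fieldType) (kK : {rmorphism k -> K}).

Section Subring.
Variable S : set K.
Hypothesis kS : forall c, S (kK c).
Hypothesis SB : forall x y, S x -> S y -> S (x - y).
Hypothesis SM : forall x y, S x -> S y -> S (x * y).

Lemma subring0 : S 0. Proof. by have := kS 0; rewrite rmorph0. Qed.
Lemma subring1 : S 1. Proof. by have := kS 1; rewrite rmorph1. Qed.
Lemma subringN x : S x -> S (- x).
Proof. by move=> Sx; rewrite -sub0r; apply: SB => //; exact: subring0. Qed.
Lemma subringD x y : S x -> S y -> S (x + y).
Proof. by move=> Sx Sy; rewrite -[y]opprK; apply: SB => //; exact: subringN. Qed.
Lemma subring_sum (I : Type) (r : seq I) (P : pred I) (F : I -> K) :
  (forall i, P i -> S (F i)) -> S (\sum_(i <- r | P i) F i).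
Proof.
by move=> SF; elim/big_ind: _ => //; [exact: subring0 | exact: subringD].
Qed.

Definition coefs_in (P : {poly K}) := forall i, S P`_i.

Lemma coefs_inB P Q : coefs_in P -> coefs_in Q -> coefs_in (P - Q).
Proof. by move=> SP SQ i; rewrite coefB; apply: SB. Qed.
Lemma coefs_inM P Q : coefs_in P -> coefs_in Q -> coefs_in (P * Q).
Proof. by move=> SP SQ i; rewrite coefM; apply: subring_sum => l _; apply: SM. Qed.
Lemma coefs_inC c : S c -> coefs_in c%:P.
Proof. by move=> Sc i; rewrite coefC; case: ifP => // _; exact: subring0. Qed.
Lemma coefs_inXn n : coefs_in 'X^n.
Proof. by move=> i; rewrite coefXn; case: eqP => _; [exact: subring1 | exact: subring0]. Qed.
End Subring.

Variable theta : K.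
Hypothesis theta_tr : ~ algebraicOver kK theta.

Let theta_neq0 : theta != 0.
Proof.
apply/eqP => theta0; apply: theta_tr; exists 'X; first by rewrite polyX_eq0.
by rewrite map_polyX theta0 rootE hornerX.
Qed.

Let y := theta^-1.
Let yt : y * theta = 1. Proof. by rewrite mulVf. Qed.

Definition no_pole_ring (S : set K) : Prop :=
  [/\ forall c, S (kK c), S y, forall a b, S a -> S b -> S (a - b),
      forall a b, S a -> S b -> S (a * b) & ~ S theta].

Lemma no_pole_base : no_pole_ring [set z | exists P, z = (map_poly kK P).[y]].
Proof.
split.
- by move=> c; exists c%:P; rewrite map_polyC hornerC.
- by exists 'X; rewrite map_polyX hornerX.
- by move=> _ _ [P ->] [Q ->]; exists (P - Q); rewrite rmorphB hornerD hornerN.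
- by move=> _ _ [P ->] [Q ->]; exists (P * Q); rewrite rmorphM hornerM.
move=> [P thetaP]; apply: theta_tr.
(* The equation theta = P(1/theta) multiplied by theta^(size P): a monic equation for theta over
   k. *)
pose Q := 'X^((size P).+1) - \sum_(i < size P) P`_i *: 'X^(size P - i).
exists Q.
  apply/eqP => /(congr1 (fun Q : {poly k} => Q`_(size P).+1)).
  rewrite /Q coefB coefXn eqxx coef_sum coef0 big1 ?subr0 => [/eqP|i _].
    by rewrite oner_eq0.
  rewrite coefZ coefXn eqn_leq [X in X && _]leqNgt ltnS leq_subr.
  by rewrite /= mulr0.
rewrite rootE /Q rmorphB rmorph_sum /= map_polyXn hornerD hornerN hornerXn.
rewrite horner_sum subr_eq0; apply/eqP.
rewrite exprS {1}thetaP horner_coef size_map_poly mulr_suml.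
apply: eq_bigr => i _; rewrite coef_map map_polyZ hornerZ map_polyXn hornerXn.
rewrite -mulrA; congr (_ * _).
have iP : (i <= size P)%N := ltnW (ltn_ord i).
have -> : theta ^+ size P = theta ^+ i * theta ^+ (size P - i) by rewrite -exprD subnKC.
by rewrite mulrA -exprMn yt expr1n mul1r.
Qed.

Lemma maximal_no_pole_ring : exists O, no_pole_ring O /\
  forall S, no_pole_ring S -> O `<=` S -> S `<=` O.
Proof.
have [|O [PO Omax]] := @Zorn_bigcup K [set S | S = set0 \/ no_pole_ring S].
  move=> F FP Ftot; have [[X0 FX0 nX0]|FE] := pselect (exists2 X, F X & no_pole_ring X).
    right; have good X : F X -> forall a, X a -> no_pole_ring X.
      by move=> FX a Xa; case: (FP _ FX) => // X_0; rewrite X_0 in Xa.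
    have two a b : (\bigcup_(X in F) X) a -> (\bigcup_(X in F) X) b ->
        exists X, [/\ F X, X a & X b].
      move=> [X FX Xa] [Y FY Yb]; have [XY|YX] := Ftot _ _ FX FY.
      - by exists Y; split => //; apply: XY.
      - by exists X; split => //; apply: YX.
    case: (nX0) => [kX yX _ _ _]; split.
    - by move=> c; exists X0.
    - by exists X0.
    - move=> a b Ua Ub; have [X [FX Xa Xb]] := two _ _ Ua Ub.
      by exists X => //; have [_ _ + _ _] := good _ FX _ Xa; apply.
    - move=> a b Ua Ub; have [X [FX Xa Xb]] := two _ _ Ua Ub.
      by exists X => //; have [_ _ _ + _] := good _ FX _ Xa; apply.
    - by move=> [X FX Xt]; have [_ _ _ _] := good _ FX _ Xt; apply.
  left; rewrite predeqE => a; split=> // -[X FX Xa].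
  by case: (FP _ FX) => [X0|nX]; [rewrite X0 in Xa | apply: FE; exists X].
have nO : no_pole_ring O.
  case: PO => // O0; have := Omax _ _ (or_intror no_pole_base); case.
  split; first by rewrite O0.
  by rewrite O0 => /(_ 1) /=; apply; exists 1; rewrite rmorph1 hornerC.
exists O; split=> // S nS OS a Sa; apply: contrapT => nOa.
by apply: (Omax S); [split=> // SO; apply/nOa/SO | right].
Qed.

(** Chevalley's argument: a ring maximal among those containing k and y = 1/theta but not theta is a
    valuation ring. If neither x nor 1/x lies in it, theta is a polynomial in x and also one in 1/x;
    since the elements of 1 + yO are units, the longer of two shortest expressions can still be
    shortened. *)
Lemma exists_place_pole : exists O, is_closed_point kK O /\ ~ O theta.
Proof.
have [O [[kO yO OB OM nOt] Omax]] := maximal_no_pole_ring.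
have O0 := subring0 kO; have O1 := subring1 kO.
have OD := subringD kO OB.
have ny_unit b : O b -> 1 + y * b != 0.
  move=> Ob; apply/eqP => H; apply: nOt.
  have -> : theta = - b; last exact: subringN.
  apply/eqP; rewrite -addr_eq0.
  have -> : theta + b = theta * (1 + y * b) by rewrite mulrDr mulr1 mulrA divff // mul1r.
  by rewrite H mulr0.
(* Inverting the elements 1 + yc does not let theta in, because theta (1 + yc) = theta + c;
   maximality then puts the inverses in [O]. *)
have Oinv b : O b -> O (1 + y * b)^-1.
  move=> Ob; pose S := [set z | exists b, O b /\ O (z * (1 + y * b))].
  have OU c : O c -> O (1 + y * c) by move=> Oc; apply: OD => //; exact: OM.
  apply: (Omax S); last by exists b; rewrite mulVf // ny_unit.
    split.
    - by move=> c; exists 0; rewrite mulr0 addr0 mulr1.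
    - by exists 0; rewrite mulr0 addr0 mulr1.
    - move=> z z' [c [Oc Oz]] [c' [Oc' Oz']]; exists (c + c' + y * (c * c')).
      split; first by apply: (OD); [exact: OD | apply: (OM) => //; exact: OM].
      have -> : (z - z') * (1 + y * (c + c' + y * (c * c'))) = (z * (1 + y * c)) * (1 + y * c') -
         (z' * (1 + y * c')) * (1 + y * c) by move: (y) => y'; ring.
      by apply: OB; apply: OM => //; apply: OU.
    - move=> z z' [c [Oc Oz]] [c' [Oc' Oz']]; exists (c + c' + y * (c * c')).
      split; first by apply: (OD); [exact: OD | apply: (OM) => //; exact: OM].
      have -> : (z * z') * (1 + y * (c + c' + y * (c * c'))) = (z * (1 + y * c)) *
         (z' * (1 + y * c')) by move: (y) => y'; ring.
      exact: OM.
    - move=> [c [Oc]]; rewrite mulrDr mulr1 mulrA divff // mul1r => Otc.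
      by apply: nOt; rewrite -[theta](addrK c); exact: OB.
  by move=> z Oz; exists 0; rewrite mulr0 addr0 mulr1.
have ext x : ~ O x -> exists P, coefs_in O P /\ P.[x] = theta.
  move=> nOx; apply: contrapT => nP; apply: nOx.
  pose S := [set z | exists P, coefs_in O P /\ P.[x] = z].
  apply: (Omax S).
  - split.
    + by move=> c; exists (kK c)%:P; rewrite hornerC; split=> //; exact: coefs_inC.
    + by exists y%:P; rewrite hornerC; split=> //; exact: coefs_inC.
    + move=> _ _ [P [OP <-]] [Q [OQ <-]]; exists (P - Q); rewrite hornerD hornerN.
      by split=> //; exact: coefs_inB.
    + move=> _ _ [P [OP <-]] [Q [OQ <-]]; exists (P * Q); rewrite hornerM.
      by split=> //; exact: coefs_inM.
    + by move=> [P ?]; apply: nP; exists P.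
  - by move=> z Oz; exists z%:P; rewrite hornerC; split=> //; exact: coefs_inC.
  - by exists 'X; rewrite hornerX; split=> //; apply: (@coefs_inXn O kO 1).
have minext x : ~ O x -> exists P, [/\ coefs_in O P, P.[x] = theta &
    forall Q, coefs_in O Q -> Q.[x] = theta -> (size P <= size Q)%N].
  move=> /ext [P [OP Px]].
  have exn : exists n, `[< exists P, [/\ coefs_in O P, P.[x] = theta & size P = n] >].
    by exists (size P); apply/asboolP; exists P.
  case: (ex_minnP exn) => n /asboolP[P' [OP' Px' szP']] minn.
  exists P'; split=> // Q OQ Qx; rewrite szP'; apply: minn.
  by apply/asboolP; exists Q.
(* Multiplying Q(1/x) = theta by y x^m, with m = deg Q, expresses (1 - y Q_0) x^m as a polynomial in
   x of smaller degree. So x^m = R(x) with deg R < m <= deg P, and this removes the leading term of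
   [P]. *)
have main x P Q : coefs_in O P -> P.[x] = theta ->
    (forall P', coefs_in O P' -> P'.[x] = theta -> (size P <= size P')%N) ->
    coefs_in O Q -> Q.[x^-1] = theta -> x != 0 -> (size Q <= size P)%N -> False.
  move=> OP Px minP OQ Qx x0 szQP.
  have szQ : (1 < size Q)%N.
    rewrite ltnNge; apply/negP => /size1_polyC Qc; apply: nOt.
    by rewrite -Qx Qc hornerC.
  pose m := (size Q).-1; have szQE : size Q = m.+1 by rewrite prednK // ltnW.
  pose u := (1 + y * - Q`_0)^-1.
  have ONQ : O (- Q`_0) by apply: subringN => //; exact: OQ.
  have u0 : 1 + y * - Q`_0 != 0 by exact: ny_unit.
  have Ou : O u by exact: Oinv.
  pose R := (u * y)%:P * \sum_(i < m) Q`_i.+1 *: 'X^(m - i.+1).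
  have OR : coefs_in O R.
    apply: coefs_inM => //; first by apply: coefs_inC => //; exact: OM.
    move=> i; rewrite coef_sum; apply: subring_sum => // l _.
    by rewrite coefZ; apply: OM => //; exact: coefs_inXn.
  have szR : (size R <= m)%N.
    rewrite /R mul_polyC; apply: (leq_trans (size_scale_leq _ _)).
    apply: (leq_trans (size_sum _ _ _)); apply/bigmax_leqP => i _.
    apply: (leq_trans (size_scale_leq _ _)); rewrite size_polyXn.
    by rewrite subnS prednK ?leq_subr // subn_gt0.
  have Rx : R.[x] = x ^+ m.
    apply: (mulfI u0); rewrite hornerM hornerC !mulrA divff // mul1r.
    have : theta * x ^+ m = Q`_0 * x ^+ m + \sum_(i < m) Q`_i.+1 * x ^+ (m - i.+1).
      rewrite -Qx horner_coef szQE big_ord_recl /= expr0 mulr1 mulrDl; congr (_ + _).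
      rewrite mulr_suml; apply: eq_bigr => i _; rewrite /bump /= add1n -mulrA; congr (_ * _).
      have -> : x ^+ m = x ^+ i.+1 * x ^+ (m - i.+1) by rewrite -exprD subnKC.
      by rewrite mulrA -exprMn mulVf // expr1n mul1r.
    move=> /(congr1 (fun z => y * z)); rewrite mulrA yt mul1r.
    rewrite horner_sum; under [X in _ -> _ * X = _]eq_bigr => i _ do rewrite hornerZ hornerXn.
    move=> E; rewrite mulrDl mul1r [X in _ = X + _]E; move: (y) (x ^+ m) (\sum_(i < m) _) => y' z w.
    by ring.
  pose P' := P - lead_coef P *: 'X^((size P).-1 - m) * ('X^m - R).
  have mP : (m <= (size P).-1)%N by rewrite -ltnS -szQE prednK // (leq_trans _ szQP) // ltnW.
  have szP0 : (0 < size P)%N by rewrite (leq_trans _ szQP) // ltnW.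
  have szXR : size ('X^m - R) = m.+1.
    by rewrite size_polyDl size_polyXn // size_polyN ltnS.
  have OP' : coefs_in O P'.
    apply: coefs_inB => //; apply: coefs_inM => //.
      by move=> i; rewrite coefZ; apply: OM; [exact: OP | exact: coefs_inXn].
    by apply: coefs_inB => //; exact: coefs_inXn.
  have P'x : P'.[x] = theta.
    rewrite /P' hornerD hornerN hornerM [('X^m - R).[x]]hornerD hornerN hornerXn.
    by rewrite Rx subrr mulr0 subr0.
  have := minP _ OP' P'x; apply/negP.
  rewrite -ltnNge.
  have -> : size P = (size P).-1.+1 by rewrite prednK.
  rewrite ltnS; apply/leq_sizeP => i Hi.
  rewrite /P' coefB -scalerAl coefZ coefXnM.
  have [iE|iN] := eqVneq i (size P).-1.
    have -> : (i < (size P).-1 - m)%N = false by apply/negbTE; rewrite -leqNgt iE leq_subr.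
    rewrite iE subKn // coefB coefXn eqxx (_ : R`_m = 0) ?subr0 ?mulr1 ?subrr //.
    by apply/leq_sizeP: szR.
  have iP : (size P <= i)%N by rewrite -(prednK szP0) ltn_neqAle eq_sym iN.
  rewrite nth_default // sub0r; case: ifP => _; first by rewrite mulr0 oppr0.
  rewrite [X in _ * X]nth_default ?mulr0 ?oppr0 // szXR.
  by rewrite ltn_subRL subnK // prednK.
exists O; split=> //; split=> //; first by exists theta.
move=> x x0; apply: contrapT => /not_orP[nOx nOVx].
have [P [OP Px minP]] := minext _ nOx.
have [Q [OQ Qx minQ]] := minext _ nOVx.
have [QP|/ltnW PQ] := leqP (size Q) (size P).
- exact: (main x P Q).
- by apply: (main x^-1 Q P) => //; rewrite ?invrK ?invr_eq0.
Qed.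
End Place.

(** * Function fields are finite over rational subfields *)

Lemma linear_dependence (F : fieldType) (I J : finType) (M : I -> J -> F) :
  (#|J| < #|I|)%N ->
  exists c : I -> F, (exists i, c i != 0) /\ forall j, \sum_i c i * M i j = 0.
Proof.
move=> JI; pose A : 'M[F]_(#|I|, #|J|) := \matrix_(u, v) M (enum_val u) (enum_val v).
have /rowV0Pn[v vA nzv] : kermx A != 0.
  rewrite kermx_eq0 /row_free; apply: contraTneq JI => <-.
  by rewrite -leqNgt rank_leq_col.
exists (fun i => v 0 (enum_rank i)); split.
  by move/rV0Pn: nzv => [u vu]; exists (enum_val u); rewrite enum_valK.
move=> l; have /sub_kermxP/(congr1 (fun B : 'M_(1, _) => B 0 (enum_rank l))) := vA.
rewrite !mxE => E; rewrite -[RHS]E [RHS](reindex _ (onW_bij _ (enum_rank_bij I))) /=.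
by apply: eq_bigr => u _; rewrite !mxE !enum_rankK.
Qed.

Section FiniteDimension.
Variables (k : finFieldType) (K : fieldType) (kK : {rmorphism k -> K}).
Variables (x : K) (n : nat) (w : 'I_n -> K).
Hypothesis w_span : forall y : K, exists c : 'I_n -> K,
  (forall i, in_simple_ext kK x (c i)) /\ y = \sum_(i < n) c i * w i.

Local Notation ev f z := (map_poly kK f).[z].

(** The k-span of the n m elements x^s w_i with s < m, in which linear dependence is forced by
    counting. *)
Definition bounded_comb (m : nat) (v : K) := exists f : 'I_n -> {poly k},
  (forall i, (size (f i) <= m)%N) /\ v = \sum_i ev (f i) x * w i.

Lemma bounded_combW m m' v : (m <= m')%N -> bounded_comb m v -> bounded_comb m' v.
Proof. by move=> mm' [f [fm ->]]; exists f; split=> // i; apply: leq_trans mm'. Qed.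

Lemma bounded_combM m (h : {poly k}) v : bounded_comb m v ->
  bounded_comb (m + size h) (ev h x * v).
Proof.
move=> [f [fm ->]]; exists (fun i => h * f i); split=> [i|].
  apply: (leq_trans (size_polyMleq _ _)); apply: (leq_trans (leq_pred _)).
  by rewrite addnC leq_add2r.
by rewrite mulr_sumr; apply: eq_bigr => i _; rewrite rmorphM hornerM mulrA.
Qed.

Lemma common_denominator (N : nat) (v : 'I_N -> K) : exists g m, ev g x != 0 /\
  forall i, bounded_comb m (ev g x * v i).
Proof.
have prod_ev (I : finType) (P : pred I) (g : I -> {poly k}) :
    ev (\prod_(i | P i) g i) x = \prod_(i | P i) ev (g i) x.
  rewrite rmorph_prod; elim/big_rec2: _ => [|i y1 y2 _ <-]; first by rewrite hornerC.
  by rewrite hornerM.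
have one y : exists gm : {poly k} * nat, ev gm.1 x != 0 /\ bounded_comb gm.2 (ev gm.1 x * y).
  have [c [cE ->]] := w_span y; pose fg i := cE i.
  have [F FE] := choice fg; have [G GE] := choice FE.
  pose g := \prod_i G i; pose f i := F i * \prod_(l | l != i) G l.
  exists (g, \max_i size (f i)); split => /=.
    by rewrite prod_ev; apply/prodf_neq0 => i _; case: (GE i).
  exists f; split=> [i|]; first exact: (leq_bigmax i).
  rewrite mulr_sumr; apply: eq_bigr => i _; rewrite mulrA; congr (_ * _).
  rewrite /f rmorphM hornerM !prod_ev (bigD1 i) //=.
  by case: (GE i) => nz ->; rewrite mulrAC [ev (G i) x * _]mulrCA divff // mulr1.
have [gm gmE] := choice (fun i => one (v i)).
exists (\prod_i (gm i).1), (\max_i ((gm i).2 + size ((\prod_(l | l != i) (gm l).1)%R : {poly k}))%N).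
split=> [|i]; first by rewrite prod_ev; apply/prodf_neq0 => i _; case: (gmE i).
apply: (bounded_combW (leq_bigmax i)).
rewrite [\prod_i _](bigD1 i) //= rmorphM hornerM [X in X * _]mulrC -mulrA.
by apply: bounded_combM; case: (gmE i).
Qed.

(* Multiplication by [z] raises degrees in [x] by a bounded amount [a], so the
   elements z^i y_l with i < M lie, up to a common denominator, in a k-space of
   dimension n(aM + O(1)), while there are MN of them. *)
Lemma finite_dimension (z : K) : exists N, forall y : 'I_N -> K,
  exists c : 'I_N -> {poly k}, (exists l, c l != 0) /\
    \sum_l ev (c l) z * y l = 0.
Proof.
have [g [a0 [g0 gz]]] := common_denominator (fun i => z * w i).
pose a := (a0 + size g)%N.
have stepz m v : bounded_comb m v -> bounded_comb (m + a) (ev g x * (z * v)).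
  move=> [f [fm ->]]; have [F FE] := choice gz.
  exists (fun i => \sum_l f l * F l i); split.
    move=> i; apply: (leq_trans (size_sum _ _ _)); apply/bigmax_leqP => l _.
    apply: (leq_trans (size_polyMleq _ _)); apply: (leq_trans (leq_pred _)).
    apply: leq_add => //; apply: (leq_trans _ (leq_addr _ _)).
    by case: (FE l).
  rewrite mulr_sumr mulr_sumr.
  under [RHS]eq_bigr => i _ do rewrite rmorph_sum /= horner_sum mulr_suml.
  rewrite exchange_big /=; apply: eq_bigr => l _.
  have sw (a1 a2 a3 a4 : K) : a1 * (a2 * (a3 * a4)) = a3 * (a1 * (a2 * a4)) by ring.
  rewrite sw (proj2 (FE l)) mulr_sumr.
  by apply: eq_bigr => i _; rewrite rmorphM hornerM mulrA.
(* With N = na + 1 and M = nb + 1, the NM products z^i y_l exceed by one the n(b + aM) coordinates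
   available to them. *)
exists (n * a).+1 => y.
have [g' [b [g'0 g'y]]] := common_denominator y.
pose M := (n * b).+1; pose B := (b + a * M)%N.
have big i l : (i <= M)%N -> bounded_comb B (ev (g' * g ^+ M) x * (z ^+ i * y l)).
  move=> iM; rewrite /B.
  suff H : forall m i, (i <= m)%N ->
    bounded_comb (b + a * m) (ev (g' * g ^+ m) x * (z ^+ i * y l)) by exact: H.
  elim=> [|m IHm] {iM}i im.
    move: im; rewrite leqn0 => /eqP ->.
    by rewrite expr0 mulr1 expr0 mul1r muln0 addn0.
  rewrite mulnS addnCA addnC exprSr mulrA rmorphM hornerM [X in X * _]mulrC -mulrA.
  case: i im => [_|i im].
    apply: (@bounded_combW (b + a * m + size g)); first by rewrite leq_add2l /a leq_addl.
    by apply: bounded_combM; apply: IHm.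
  rewrite exprS -mulrA [_ * (z * _)]mulrCA; apply: stepz; exact: IHm.
have bigC (il : 'I_M * 'I_(n * a).+1) := big il.1 il.2 (ltnW (ltn_ord il.1)).
have [F FE] := choice bigC.
have [|c [[[i0 l0] c0] cE]] := @linear_dependence k _ ('I_n * 'I_B)%type (fun il ms => (F il ms.1)`_ms.2).
  rewrite !card_prod !card_ord /B mulnDr mulnS mulnA [(n * a * M)%N]mulnC.
  by rewrite ltn_add2r ltnS.
exists (fun l => \poly_(i < M) (if insub i is Some i' then c (i', l) else 0)); split.
  exists l0; apply/eqP => /(congr1 (fun P : {poly k} => P`_i0)).
  by rewrite coef_poly ltn_ord coef0 valK => /eqP; rewrite (negbTE c0).
have nz : ev (g' * g ^+ M) x != 0.
  by rewrite rmorphM hornerM rmorphXn horner_exp mulf_neq0 // expf_neq0.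
apply: (mulfI nz); rewrite mulr0 mulr_sumr.
transitivity (\sum_il kK (c il) * (ev (g' * g ^+ M) x * (z ^+ il.1 * y il.2))).
  transitivity (\sum_i \sum_l kK (c (i, l)) * (ev (g' * g ^+ M) x * (z ^+ i * y l))); last first.
    by rewrite pair_bigA /=; apply: eq_bigr => -[].
  rewrite exchange_big /=; apply: eq_bigr => l _.
  rewrite poly_def rmorph_sum horner_sum mulr_suml mulr_sumr /=.
  apply: eq_bigr => i _; rewrite valK map_polyZ hornerZ map_polyXn hornerXn.
  by rewrite -mulrA mulrCA.
under eq_bigr => il _ do rewrite (proj2 (FE il)) mulr_sumr.
rewrite exchange_big big1 //= => m _.
transitivity (\sum_il \sum_(s < B) kK (c il * (F il m)`_s) * (x ^+ s * w m)).
  apply: eq_bigr => il _; rewrite (@horner_coef_wide _ B); last first.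
    by apply: (leq_trans (size_poly _ _)); case: (FE il).
  rewrite mulr_suml mulr_sumr; apply: eq_bigr => s _.
  by rewrite coef_map rmorphM !mulrA.
rewrite exchange_big big1 //= => s _.
by rewrite -mulr_suml -rmorph_sum (cE (m, s)) rmorph0 mul0r.
Qed.

End FiniteDimension.

(** * Hyperderivations *)

Section Hyper.
Variables (k : finFieldType) (R : comNzRingType) (kR : {rmorphism k -> R}).
Implicit Types (D : nat -> R -> R).

Section Basic.
Variable D : nat -> R -> R.
Hypothesis hD : is_hyperderivation kR D.

Lemma hyperD n : {morph D n : x y / x + y}. Proof. by case: hD => + _ _ _; apply. Qed.
Lemma hyperZ n c x : D n (kR c * x) = kR c * D n x.
Proof. by case: hD => _ + _ _; apply. Qed.
Lemma hyper_id x : D 0%N x = x. Proof. by case: hD => _ _ + _; apply. Qed.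
Lemma hyperM n x y : D n (x * y) = \sum_(i < n.+1) D i x * D (n - i)%N y.
Proof. by case: hD => _ _ _; apply. Qed.
Lemma hyper0 n : D n 0 = 0.
Proof. by apply: (@addrI _ (D n 0)); rewrite -hyperD !addr0. Qed.
Lemma hyperN n : {morph D n : x / - x}.
Proof. by move=> x; apply/eqP; rewrite -addr_eq0 -hyperD addNr hyper0. Qed.
Lemma hyper_sum n (I : Type) (r : seq I) (P : pred I) (F : I -> R) :
  D n (\sum_(i <- r | P i) F i) = \sum_(i <- r | P i) D n (F i).
Proof. exact: (big_morph _ (hyperD n) (hyper0 n)). Qed.

Lemma hyper1 n : D n.+1 1 = 0.
Proof.
elim/ltn_ind: n => n IHn; have := hyperM n.+1 1 1.
rewrite mulr1 big_ord_recl subn0 big_ord_recr /= !hyper_id mul1r subnn hyper_id mulr1.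
rewrite big1 => [|i _]; last by rewrite /= /bump /= add1n IHn ?mul0r ?ltn_ord.
by rewrite add0r => /eqP; rewrite -subr_eq0 opprD addNKr oppr_eq0 => /eqP.
Qed.

Lemma hyperC n c : D n (kR c) = (n == 0)%:R * kR c.
Proof.
rewrite -[kR c]mulr1 hyperZ; case: n => [|n]; first by rewrite hyper_id eqxx mul1r.
by rewrite hyper1 mulr0 /= mul0r.
Qed.

(** The Leibniz rule spreads n derivatives over the factors, so at least a - n of the factors u stay
    untouched. *)
Lemma hyper_mulX u a m n y : (m + n <= a)%N ->
  exists z, D n (u ^+ a * y) = u ^+ m * z.
Proof.
elim: a m n y => [|a IHa] m n y mna.
  by have -> : m = 0%N by [lia]; exists (D n y); rewrite !expr0 !mul1r.
have H (i : 'I_n.+1) : exists z, D i u * D (n - i)%N (u ^+ a * y) = u ^+ m * z.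
  case: i => -[|i] /= i_n.
    rewrite subn0 hyper_id; case: m mna => [|m] mna.
      by exists (u * D n (u ^+ a * y)); rewrite mul1r.
    by have [|z ->] := IHa m n y; [lia | exists z; rewrite exprS mulrA].
  have [|z ->] := IHa m (n - i.+1)%N y; first by lia.
  by exists (D i.+1 u * z); rewrite mulrCA.
have [F FE] := choice H; exists (\sum_i F i).
by rewrite exprS -mulrA hyperM mulr_sumr; apply: eq_bigr.
Qed.

(** Modulo u only the Leibniz term that applies [D] 1 to each of the n factors u survives. *)
Lemma hyper_mulX_lead u n y :
  exists z, D n (u ^+ n * y) = D 1%N u ^+ n * y + u * z.
Proof.
elim: n => [|n [z IHn]]; first by exists 0; rewrite hyper_id mulr0 addr0.
rewrite exprS -mulrA hyperM big_ord_recl big_ord_recl /= hyper_id subn0 /bump /= !add1n.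
rewrite subSS subn0 IHn.
have H (i : 'I_n) : exists z, D i.+2 u * D (n.+1 - i.+2)%N (u ^+ n * y) = u * z.
  have [|z' ->] := @hyper_mulX u n 1 (n.+1 - i.+2) y; first by case: i => i /=; lia.
  by exists (D i.+2 u * z'); rewrite expr1 mulrCA.
have [F FE] := choice H.
exists (D n.+1 (u ^+ n * y) + D 1%N u * z + \sum_i F i).
rewrite (eq_bigr _ (fun i _ => FE i)) -mulr_sumr exprS; ring.
Qed.

End Basic.

(** A hyperderivation is the ring homomorphism f -> sum_n D_n(f) X^n; to extend the one of k[u]
    means to send u to u + X. *)
Lemma hyper_ext_gen u D : hyper_ext kR u D <->
  [/\ is_hyperderivation kR D, D 1%N u = 1 & forall n, D n.+2 u = 0].
Proof.
split=> [[hD eD]|[hD D1 D2]].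
  have uE : u = (map_poly kR 'X).[u] by rewrite map_polyX hornerX.
  split=> // [|n]; rewrite {1}uE eD ?nderivn1 ?derivX ?rmorph1 ?hornerC //.
  by rewrite nderivn_poly0 ?size_polyX // rmorph0 horner0.
split=> // n f; elim/poly_ind: f n => [|f c IHf] n.
  by rewrite nderivnC if_same rmorph0 horner0 hyper0.
rewrite rmorphD rmorphM /= map_polyX map_polyC hornerMXaddC hyperD // hyperC //.
rewrite mulrC hyperM //; case: n => [|n].
  rewrite big_ord_recl big_ord0 addr0 !hyper_id // mul1r nderivn0.
  by rewrite rmorphD rmorphM /= map_polyX map_polyC hornerMXaddC mulrC.
rewrite mul0r addr0 big_ord_recl big_ord_recl big1 => [|i _]; last by rewrite /= D2 mul0r.
rewrite /= hyper_id // D1 !IHf subn0 subSS subn0 nderivnMXaddC.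
by rewrite rmorphD rmorphM /= map_polyX hornerD hornerMX addr0 mul1r mulrC addrC.
Qed.

Lemma hyper_ext_mul u D n x : hyper_ext kR u D -> D n.+1 (u * x) = u * D n.+1 x + D n x.
Proof.
move=> /hyper_ext_gen[hD D1 D2]; rewrite hyperM // big_ord_recl big_ord_recl big1 => [|i _].
  by rewrite /= hyper_id // D1 mul1r addr0 /bump /= subn0 subSS subn0.
by rewrite /= D2 mul0r.
Qed.

End Hyper.

(* The hyperderivation extending the one of [k[t]] is obtained from [D] by
   the change of variables given by the Taylor expansion T of [t]:
   D_n = \sum_a [X^n](T^a) dt_a, a triangular system with diagonal (D_1 t)^n. *)
Section ChangeOfVariable.
Variables (k : finFieldType) (R : comUnitRingType) (kR : {rmorphism k -> R}).
Variables (D : nat -> R -> R) (t : R).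
Hypothesis hD : is_hyperderivation kR D.
Hypothesis D1t : D 1%N t \is a GRing.unit.

(** Without the constant term t, the a-th power starts at X^a, whence the triangularity. Truncation
    at degree N leaves the coefficients up to N intact, so any large enough [N] may be used. *)
Definition taylor N : {poly R} := \poly_(i < N.+1) (if i == 0%N then 0 else D i t).

Definition tcoef n a : R := (taylor n ^+ a)`_n.

Lemma coef_exp_eq (P Q : {poly R}) n : (forall i, (i <= n)%N -> P`_i = Q`_i) ->
  forall a i, (i <= n)%N -> (P ^+ a)`_i = (Q ^+ a)`_i.
Proof.
move=> PQ; elim=> [|a IHa] i i_n; first by rewrite !expr0.
rewrite !exprS !coefM; apply: eq_bigr => -[l /= li] _.
by rewrite PQ ?IHa //; lia.
Qed.

Lemma tcoefE N n a : (n <= N)%N -> tcoef n a = (taylor N ^+ a)`_n.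
Proof.
move=> nN; apply: (@coef_exp_eq _ _ n) => // i i_n.
by rewrite /taylor !coef_poly !ltnS i_n (leq_trans i_n).
Qed.

Lemma taylor_exp_low N a i : (i < a)%N -> (taylor N ^+ a)`_i = 0.
Proof.
elim: a i => [//|a IHa] i ia; rewrite exprS coefM big1 // => -[[|l] /= li] _.
  by rewrite /taylor coef_poly /= mul0r.
by rewrite IHa ?mulr0 //; lia.
Qed.

Lemma tcoef_low n a : (n < a)%N -> tcoef n a = 0.
Proof. exact: taylor_exp_low. Qed.

Lemma tcoef_diag n : tcoef n n = D 1%N t ^+ n.
Proof.
rewrite (@tcoefE n.+1) //; suff H a : (a <= n.+1)%N -> (taylor n.+1 ^+ a)`_a = D 1%N t ^+ a by exact: H.
elim: a => [|a IHa] an; first by rewrite !expr0 coefC eqxx.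
rewrite exprS coefM big_ord_recl big_ord_recl big1 => [|i _].
  rewrite /= {1 2}/taylor !coef_poly /= mul0r add0r addr0 subSS subn0 IHa ?exprS //.
  exact: ltnW.
by rewrite /= taylor_exp_low ?mulr0 // /bump /=; case: i => i /=; lia.
Qed.

Lemma tcoef0 n : tcoef n 0 = (n == 0%N)%:R.
Proof. by rewrite /tcoef expr0 coefC; case: eqP. Qed.

Lemma tcoef1 n : tcoef n.+1 1 = D n.+1 t.
Proof. by rewrite /tcoef expr1 /taylor coef_poly ltnSn. Qed.

Lemma tcoefD n a b : tcoef n (a + b) = \sum_(i < n.+1) tcoef i a * tcoef (n - i) b.
Proof.
rewrite {1}/tcoef exprD coefM; apply: eq_bigr => -[i /= i_n] _.
by rewrite (@tcoefE n i) // (@tcoefE n (n - i)) ?leq_subr.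
Qed.

(** Forward substitution in the triangular system; the list keeps all earlier values because the
    next one depends on each of them. *)
Fixpoint dt_seq n (f : R) : seq R :=
  if n is m.+1 then
    rcons (dt_seq m f)
      (D 1%N t ^- m * (D m f - \sum_(i < m) tcoef m i * (dt_seq m f)`_i))
  else [::].

Definition dt_of n f := (dt_seq n.+1 f)`_n.

Lemma size_dt_seq n f : size (dt_seq n f) = n.
Proof. by elim: n => //= n IHn; rewrite size_rcons IHn. Qed.

Lemma nth_dt_seq n f i : (i < n)%N -> (dt_seq n f)`_i = dt_of i f.
Proof.
elim: n => // n IHn; rewrite ltnS leq_eqVlt => /orP[/eqP -> //|i_n].
by rewrite /= nth_rcons size_dt_seq i_n IHn.
Qed.

Lemma dt_ofE n f : D n f = \sum_(a < n.+1) tcoef n a * dt_of a f.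
Proof.
rewrite big_ord_recr /= tcoef_diag {2}/dt_of /= nth_rcons size_dt_seq ltnn eqxx.
rewrite mulrA divrr ?unitrX // mul1r addrC.
under [X in _ - X]eq_bigr => i _ do rewrite nth_dt_seq //.
by rewrite subrK.
Qed.

Lemma dt_ofE_wide N n f : (n <= N)%N -> D n f = \sum_(a < N.+1) tcoef n a * dt_of a f.
Proof.
move=> nN; rewrite dt_ofE (big_ord_widen N.+1 (fun a => tcoef n a * dt_of a f)) ?ltnS //.
rewrite big_mkcond /=; apply: eq_bigr => a _.
by case: ifP => // /negbT; rewrite -leqNgt => na; rewrite tcoef_low ?mul0r.
Qed.

Lemma triangular_inj n (x y : nat -> R) : (forall a, (a < n)%N -> x a = y a) ->
  \sum_(a < n.+1) tcoef n a * x a = \sum_(a < n.+1) tcoef n a * y a -> x n = y n.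
Proof.
move=> xy; rewrite !big_ord_recr /= (eq_bigr (fun a : 'I_n => tcoef n a * y a)).
  by move/addrI; rewrite tcoef_diag; apply: mulrI; rewrite unitrX.
by move=> a _; rewrite xy.
Qed.

(** Two sequences with the same image under the triangular system are equal, so each law is
    inherited from [D]. For products the point is T^a T^b = T^(a+b). *)
Lemma dt_of_hyper : is_hyperderivation kR dt_of.
Proof.
split.
- move=> n x y; elim/ltn_ind: n => n IHn.
  apply: (@triangular_inj n (fun a => dt_of a (x + y)) (fun a => dt_of a x + dt_of a y)) => //.
  under [RHS]eq_bigr do rewrite mulrDr.
  by rewrite big_split /= -!dt_ofE (hyperD hD).
- move=> n c x; elim/ltn_ind: n => n IHn.
  apply: (@triangular_inj n (fun a => dt_of a (kR c * x)) (fun a => kR c * dt_of a x)) => //.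
  under [RHS]eq_bigr do rewrite mulrCA.
  by rewrite -mulr_sumr -!dt_ofE (hyperZ hD).
- move=> x; have := dt_ofE 0 x; rewrite big_ord_recl big_ord0 addr0 tcoef0 mul1r.
  by rewrite (hyper_id hD).
move=> n x y; elim/ltn_ind: n => n IHn.
apply: (@triangular_inj n (fun a => dt_of a (x * y))
  (fun a => \sum_(i < a.+1) dt_of i x * dt_of (a - i)%N y)) => //.
rewrite -dt_ofE (hyperM hD).
transitivity (\sum_(a < n.+1) \sum_(b < n.+1) tcoef n (a + b) * (dt_of a x * dt_of b y)).
  transitivity (\sum_(i < n.+1) \sum_(a < n.+1) \sum_(b < n.+1)
      (tcoef i a * tcoef (n - i) b) * (dt_of a x * dt_of b y)).
    apply: eq_bigr => i _; rewrite (@dt_ofE_wide n) ?leq_ord // (@dt_ofE_wide n (n - i)) ?leq_subr //.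
    rewrite mulr_suml; apply: eq_bigr => a _; rewrite mulr_sumr; apply: eq_bigr => b _.
    by rewrite mulrACA.
  rewrite exchange_big; apply: eq_bigr => a _; rewrite exchange_big; apply: eq_bigr => b _.
  by rewrite tcoefD mulr_suml.
pose G c a := tcoef n c * (dt_of a x * dt_of (c - a)%N y).
transitivity (\sum_(a < n.+1) \sum_(c < n.+1 | (a <= c)%N) G c a).
  apply: eq_bigr => -[a /= an] _.
  transitivity (\sum_(b < n.+1 - a) tcoef n (a + b) * (dt_of a x * dt_of b y)).
    rewrite [RHS](big_ord_widen n.+1 (fun b => tcoef n (a + b) * (dt_of a x * dt_of b y))) ?leq_subr //.
    rewrite [RHS]big_mkcond; apply: eq_bigr => b _.
    case: ifP => // /negbT; rewrite -leqNgt => H; rewrite tcoef_low ?mul0r //.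
    by lia.
  transitivity (\sum_(a <= c < n.+1) G c a); last by rewrite big_geq_mkord.
  have -> : \sum_(a <= c < n.+1) G c a = \sum_(0 + a <= c < n.+1) G c a by rewrite add0n.
  rewrite big_addn big_mkord; apply: eq_bigr => b _.
  by rewrite /G addnC addnK.
rewrite (exchange_big_dep xpredT) //=; apply: eq_bigr => c _.
rewrite mulr_sumr (big_ord_widen_cond n.+1 xpredT (fun a => G c a)) /G; last by rewrite ltn_ord.
by apply: eq_bigl => a; rewrite ltnS.
Qed.

Lemma dt_of_ext : hyper_ext kR t dt_of.
Proof.
have d1 : dt_of 1 t = 1.
  apply: (mulrI D1t); have := dt_ofE 1 t.
  rewrite big_ord_recl big_ord_recl big_ord0 tcoef0 mul0r add0r addr0 /= tcoef_diag expr1.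
  by rewrite mulr1 => <-.
apply/hyper_ext_gen; split=> // [|n]; first exact: dt_of_hyper.
elim/ltn_ind: n => n IHn.
(* For n > 0, D_n t is the coefficient of X^n in T^1, so the solution of the system attached to t is
   t, 1, 0, 0, and so on. *)
pose z a : R := if a == 0%N then t else (a == 1%N)%:R.
apply: (@triangular_inj n.+2 (fun a => dt_of a t) z).
  case=> [|[|a]] an //; last by rewrite IHn.
  by rewrite (hyper_id dt_of_hyper).
rewrite -dt_ofE big_ord_recl big_ord_recl tcoef0 mul0r add0r /= mulr1 tcoef1.
by rewrite big1 ?addr0 // => i _; rewrite /z /= mulr0.
Qed.

End ChangeOfVariable.

(** * Null series in an ultrametric space *)

Section Ultrametric.
Variables (R : realType) (C : fieldType) (abs : C -> R).
Hypothesis Habs : is_ultrametric_abs abs.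

Lemma abs_ge0 x : 0 <= abs x. Proof. by case: Habs. Qed.
Lemma abs_eq0 x : abs x = 0 <-> x = 0. Proof. by case: Habs => _ + _ _; apply. Qed.
Lemma absM x y : abs (x * y) = abs x * abs y. Proof. by case: Habs => _ _ + _; apply. Qed.
Lemma absD_le x y : abs (x + y) <= Num.max (abs x) (abs y).
Proof. by case: Habs => _ _ _; apply. Qed.
Lemma abs0 : abs 0 = 0. Proof. exact/abs_eq0. Qed.
Lemma abs1 : abs 1 = 1.
Proof.
have n0 : abs 1 != 0 by apply/eqP => /abs_eq0/eqP; rewrite oner_eq0.
by apply: (mulfI n0); rewrite -absM !mulr1.
Qed.
Lemma absX x n : abs (x ^+ n) = abs x ^+ n.
Proof. by elim: n => [|n IHn]; rewrite ?abs1 // !exprS absM IHn. Qed.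
Lemma absN x : abs (- x) = abs x.
Proof.
rewrite -mulN1r absM; suff -> : abs (-1) = 1 by rewrite mul1r.
have : abs (-1) ^+ 2 == 1 by rewrite -absX sqrrN expr1n abs1.
rewrite sqrf_eq1 => /orP[/eqP //|/eqP E].
by have := abs_ge0 (-1); rewrite E oppr_ge0 ler10.
Qed.
Lemma absV x : x != 0 -> abs x^-1 = (abs x)^-1.
Proof.
move=> x0; have n0 : abs x != 0 by apply/eqP => /abs_eq0/eqP; rewrite (negbTE x0).
by apply: (mulfI n0); rewrite -absM !divff // abs1.
Qed.
Lemma absD_leM x y M : abs x <= M -> abs y <= M -> abs (x + y) <= M.
Proof. by move=> xM yM; apply: (le_trans (absD_le x y)); rewrite ge_max xM yM. Qed.
Lemma absD_lt x y M : abs x < M -> abs y < M -> abs (x + y) < M.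
Proof. by move=> xM yM; apply: (le_lt_trans (absD_le x y)); rewrite gt_max xM yM. Qed.
Lemma abs_sum_le (I : Type) (r : seq I) (P : pred I) (F : I -> C) M : 0 <= M ->
  (forall i, P i -> abs (F i) <= M) -> abs (\sum_(i <- r | P i) F i) <= M.
Proof.
move=> M0 FM; elim/big_ind: _ => //; first by rewrite abs0.
by move=> x y; exact: absD_leM.
Qed.

(** c^q = c, whereas a real number above 1 is strictly smaller than its q-th power. *)
Lemma abs_const (k : finFieldType) (kC : {rmorphism k -> C}) c : abs (kC c) <= 1.
Proof.
rewrite leNgt; apply/negP => c1.
have := absX (kC c) (#|k| ^ 1); rewrite (frob_const kC) expn1 => E.
have : abs (kC c) < abs (kC c) ^+ #|k| by rewrite ltr_eXnr // finNzRing_gt1.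
by rewrite -E ltxx.
Qed.

Variable d : nat.
Local Notation V := 'cV[C]_d.
Local Notation nrm := (maxnorm abs).

Lemma nrm_ge0 (v : V) : 0 <= nrm v.
Proof. by rewrite /maxnorm; elim/big_rec: _ => // i x _ x0; rewrite le_max x0 orbT. Qed.

Lemma nrm_leP (v : V) M : 0 <= M -> (nrm v <= M <-> forall i, abs (v i 0) <= M).
Proof.
move=> M0; split=> [vM i|H]; last by apply: bigmax_le.
by apply: le_trans vM; exact: le_bigmax.
Qed.

Lemma nrm_coord (v : V) i : abs (v i 0) <= nrm v.
Proof. exact: (proj1 (nrm_leP v (nrm_ge0 v))). Qed.

Lemma nrm_ltP (v : V) M : 0 < M -> (nrm v < M <-> forall i, abs (v i 0) < M).
Proof.
move=> M0; split=> [vM i|H]; last by apply: bigmax_lt.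
by apply: le_lt_trans vM; exact: nrm_coord.
Qed.

Lemma nrm0 : nrm (0 : V) = 0.
Proof.
apply/eqP; rewrite eq_le nrm_ge0 andbT; apply/nrm_leP => // i.
by rewrite mxE abs0.
Qed.

Lemma nrmN (v : V) : nrm (- v) = nrm v.
Proof. by rewrite /maxnorm; apply: eq_bigr => i _; rewrite mxE absN. Qed.

Lemma nrmD_le (u v : V) M : nrm u <= M -> nrm v <= M -> nrm (u + v) <= M.
Proof.
move=> uM vM; have M0 := le_trans (nrm_ge0 u) uM.
apply/nrm_leP => // i; rewrite mxE; apply: absD_leM.
- exact: le_trans (nrm_coord u i) uM.
- exact: le_trans (nrm_coord v i) vM.
Qed.

Lemma nrmD_lt (u v : V) M : nrm u < M -> nrm v < M -> nrm (u + v) < M.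
Proof.
move=> uM vM; have M0 := le_lt_trans (nrm_ge0 u) uM.
apply/nrm_ltP => // i; rewrite mxE; apply: absD_lt.
- exact: le_lt_trans (nrm_coord u i) uM.
- exact: le_lt_trans (nrm_coord v i) vM.
Qed.

Lemma nrm_sum_le (I : Type) (r : seq I) (P : pred I) (F : I -> V) M : 0 <= M ->
  (forall i, P i -> nrm (F i) <= M) -> nrm (\sum_(i <- r | P i) F i) <= M.
Proof.
move=> M0 FM; elim/big_ind: _ => //; first by rewrite nrm0.
by move=> x y; exact: nrmD_le.
Qed.

Lemma nrm_eq0 (v : V) : nrm v <= 0 -> v = 0.
Proof.
move=> v0; apply/colP => i; rewrite mxE; apply/abs_eq0/eqP.
by rewrite eq_le abs_ge0 andbT; apply: le_trans (nrm_coord v i) v0.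
Qed.

Lemma nrm_lt_eq0 (v : V) : (forall e, 0 < e -> nrm v < e) -> v = 0.
Proof.
move=> H; apply: nrm_eq0; rewrite leNgt; apply/negP => /H.
by rewrite ltxx.
Qed.

Lemma nrmZ_le c (v : V) M : abs c <= 1 -> nrm v <= M -> nrm (c *: v) <= M.
Proof.
move=> c1 vM; have M0 := le_trans (nrm_ge0 v) vM.
apply/nrm_leP => // i; rewrite mxE absM; apply: le_trans vM.
apply: le_trans (nrm_coord v i); rewrite ler_piMl ?abs_ge0 //.
Qed.

Lemma nrmZ_lt c (v : V) M : abs c <= 1 -> nrm v < M -> nrm (c *: v) < M.
Proof. by move=> c1; apply: le_lt_trans; exact: nrmZ_le. Qed.

Lemma vcvgP (s : nat -> V) (l : V) : vcvg abs s l <->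
  forall e, 0 < e -> exists N, forall n, (N <= n)%N -> nrm (s n - l) < e.
Proof.
rewrite /vcvg; split=> [/cvgrPdist_lt H e e0|H].
  have [N _ NH] := H e e0; exists N => n Nn.
  by have := NH n Nn; rewrite /= sub0r normrN ger0_norm ?nrm_ge0.
apply/cvgrPdist_lt => e e0; have [N NH] := H e e0; exists N => // n Nn.
by rewrite /= sub0r normrN ger0_norm ?nrm_ge0 //; exact: NH.
Qed.

Lemma vcvg_unique (s : nat -> V) l l' : vcvg abs s l -> vcvg abs s l' -> l = l'.
Proof.
move=> /vcvgP sl /vcvgP sl'; apply/eqP; rewrite -subr_eq0; apply/eqP.
apply: nrm_lt_eq0 => e e0; have [N NH] := sl e e0; have [N' NH'] := sl' e e0.
have -> : l - l' = - (s (maxn N N') - l) + (s (maxn N N') - l').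
  by rewrite opprB addrA subrK.
by apply: nrmD_lt; rewrite ?nrmN; [apply: NH | apply: NH']; rewrite leq_max leqnn ?orbT.
Qed.

Definition null (v : nat -> V) : Prop :=
  forall e, 0 < e -> exists N, forall n, (N <= n)%N -> nrm (v n) < e.

Implicit Types (v : nat -> V).

Lemma nullP v : in_ET abs v <-> null v.
Proof.
rewrite /in_ET; have E : (fun i => nrm (v i)) = (fun i => nrm (v i - 0)).
  by apply: functional_extensionality_dep => i; rewrite subr0.
rewrite E -/(vcvg abs v 0) vcvgP.
by split=> H e /H[N NH]; exists N => n /NH; rewrite subr0.
Qed.

Lemma partial_tail (v : nat -> V) N n e : 0 <= e -> (N <= n)%N ->
  (forall i, (N <= i)%N -> nrm (v i) <= e) ->
  nrm (\sum_(i < n) v i - \sum_(i < N) v i) <= e.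
Proof.
move=> e0 Nn H; rewrite (big_ord_widen n v Nn) [X in X - _](bigID (fun i : 'I_n => (i < N)%N)) /=.
rewrite addrAC subrr add0r; apply: nrm_sum_le => // i; rewrite -leqNgt; exact: H.
Qed.

Hypothesis Hcomplete : abs_complete abs.

Lemma null_series_cvg (v : nat -> V) : null v ->
  exists l, vcvg abs (fun n => \sum_(i < n) v i) l.
Proof.
move=> nv.
have H (i : 'I_d) : exists l, (fun n => abs ((\sum_(m < n) v m) i 0 - l)) @ \oo --> (0 : R).
  apply: Hcomplete => e e0; have [N NH] := nv _ (divr_gt0 e0 (ltr0n R 2)).
  have e2 : 0 <= e / 2 by rewrite ltW // divr_gt0.
  have e2e : e / 2 < e by rewrite ltr_pdivrMr // ltr_pMr // ltr1n.
  exists N => m n Nm Nn; apply: le_lt_trans e2e.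
  have -> : (\sum_(m' < m) v m') i 0 - (\sum_(m' < n) v m') i 0 =
    ((\sum_(m' < m) v m') - (\sum_(m' < N) v m')) i 0
    + - ((\sum_(m' < n) v m') - (\sum_(m' < N) v m')) i 0 by rewrite !mxE; ring.
  apply: absD_leM; rewrite ?absN; apply: le_trans (nrm_coord _ _) _;
    apply: partial_tail => // l Nl; apply: ltW; exact: NH.
have [L LE] := choice H; exists (\col_i L i); apply/vcvgP => e e0.
have H' (i : 'I_d) : exists N : nat, forall n, (N <= n)%N -> abs ((\sum_(m < n) v m) i 0 - L i) < e.
  have /cvgrPdist_lt/(_ e e0)[N _ NH] := LE i; exists N => n Nn.
  by have := NH n Nn; rewrite /= sub0r normrN ger0_norm ?abs_ge0.
have [M ME] := choice H'; exists (\max_i M i) => n Mn; apply/nrm_ltP => // i.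
have -> : (\sum_(m < n) v m - \col_i0 L i0) i 0 = (\sum_(m < n) v m) i 0 - L i by rewrite !mxE.
by apply: ME; apply: leq_trans Mn; exact: (leq_bigmax i).
Qed.

(** Null series converge by completeness, so the default value 0 concerns only other series. *)
Definition vsum (v : nat -> V) : V :=
  xget 0 [set l | vcvg abs (fun n => \sum_(i < n) v i) l].

Lemma vsum_cvg v : null v -> vcvg abs (fun n => \sum_(i < n) v i) (vsum v).
Proof. by move=> /null_series_cvg[l vl]; apply: (@xgetPex _ _ [set l | vcvg _ _ l]); exists l. Qed.

Lemma vsum_unique v l : null v -> vcvg abs (fun n => \sum_(i < n) v i) l -> vsum v = l.
Proof. by move=> nv; apply: vcvg_unique; exact: vsum_cvg. Qed.

Lemma vsum_tail v N e : null v -> 0 < e -> (forall i, (N <= i)%N -> nrm (v i) <= e) ->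
  nrm (vsum v - \sum_(i < N) v i) <= e.
Proof.
move=> nv e0 H; have /vcvgP/(_ e e0)[M MH] := vsum_cvg nv.
pose n := maxn M N.
have -> : vsum v - \sum_(i < N) v i = - (\sum_(i < n) v i - vsum v) + (\sum_(i < n) v i - \sum_(i < N) v i).
  by rewrite opprB addrA subrK.
apply: nrmD_le; first by rewrite nrmN ltW // MH // leq_maxl.
by apply: partial_tail => //; [exact: ltW | exact: leq_maxr].
Qed.

Lemma vsum_le v e : null v -> 0 < e -> (forall i, nrm (v i) <= e) -> nrm (vsum v) <= e.
Proof. by move=> nv e0 H; have := @vsum_tail v 0 e nv e0 (fun i _ => H i); rewrite big_ord0 subr0. Qed.

Lemma nullD v v' : null v -> null v' -> null (fun i => v i + v' i).
Proof.
move=> nv nv' e e0; have [N NH] := nv e e0; have [N' NH'] := nv' e e0.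
exists (maxn N N') => n; rewrite geq_max => /andP[Nn N'n].
by apply: nrmD_lt; [exact: NH | exact: NH'].
Qed.

Lemma nullZ (c : nat -> C) v : (forall i, abs (c i) <= 1) -> null v -> null (fun i => c i *: v i).
Proof. by move=> c1 nv e e0; have [N NH] := nv e e0; exists N => n /NH; exact: nrmZ_lt. Qed.

Lemma vsumD v v' : null v -> null v' -> vsum (fun i => v i + v' i) = vsum v + vsum v'.
Proof.
move=> nv nv'; apply: vsum_unique; first exact: nullD.
apply/vcvgP => e e0.
have /vcvgP/(_ e e0)[N NH] := vsum_cvg nv; have /vcvgP/(_ e e0)[N' NH'] := vsum_cvg nv'.
exists (maxn N N') => n; rewrite geq_max => /andP[Nn N'n].
rewrite big_split /= opprD addrACA.
by apply: nrmD_lt; [exact: NH | exact: NH'].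
Qed.

Lemma vsumZ c v : abs c <= 1 -> null v -> vsum (fun i => c *: v i) = c *: vsum v.
Proof.
move=> c1 nv; apply: vsum_unique; first exact: nullZ.
apply/vcvgP => e e0; have /vcvgP/(_ e e0)[N NH] := vsum_cvg nv.
by exists N => n /NH; rewrite -scaler_sumr -scalerBr; exact: nrmZ_lt.
Qed.

Lemma vsum_fin v N : (forall i, (N <= i)%N -> v i = 0) -> vsum v = \sum_(i < N) v i.
Proof.
move=> v0; have nv : null v by move=> e e0; exists N => n /v0 ->; rewrite nrm0.
apply/eqP; rewrite -subr_eq0; apply/eqP; apply: nrm_lt_eq0 => e e0.
have e2e : e / 2 < e by rewrite ltr_pdivrMr // ltr_pMr // ltr1n.
have e2 : 0 < e / 2 by rewrite divr_gt0.
apply: le_lt_trans e2e; apply: vsum_tail => // i /v0 ->.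
by rewrite nrm0 ltW.
Qed.

Lemma eq_vsum v v' : (forall i, v i = v' i) -> vsum v = vsum v'.
Proof. by move=> E; congr vsum; apply: functional_extensionality_dep. Qed.

End Ultrametric.

(** * The action on points of a uniformizable Anderson module *)

Section AndersonAction.
Variables (k : finFieldType) (A : idomainType) (kA : {rmorphism k -> A}).
Variables (R : realType) (C : fieldType) (abs : C -> R).
Variables (ell : {rmorphism A -> C}) (L : {pred C}).
Variables (d : nat) (phi : A -> 'M[{poly C}]_d).
Hypothesis Habs : is_ultrametric_abs abs.
Hypothesis HE : is_Anderson_module #|k| phi ell L.
Hypothesis Hunif : uniformizable #|k| phi abs.
Hypothesis ell_inj : injective ell.
Local Notation q := #|k|.
Local Notation V := 'cV[C]_d.
Local Notation kC := (ell \o kA).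
Local Notation nrm := (maxnorm abs).
Local Notation act := (act q phi).

Lemma Lie1 : Lie (phi 1) = 1%:M.
Proof.
case: HE => _ -> _ _ _; apply/matrixP => i m; rewrite !mxE.
by case: (i == m); rewrite ?mulr1n ?mulr0n ?coefC ?coef0.
Qed.

Lemma LieD a b : Lie (phi (a + b)) = Lie (phi a) + Lie (phi b).
Proof. by case: HE => _ _ -> _ _; apply/matrixP => i m; rewrite !mxE coefD. Qed.

Lemma LieM a b : Lie (phi (a * b)) = Lie (phi a) *m Lie (phi b).
Proof.
case: HE => _ _ _ -> _; apply/matrixP => i m; rewrite !mxE coef_sum.
apply: eq_bigr => n _; rewrite !mxE /tau_mul coef_sum.
set f := phi a i n; set g := phi b n m.
have [->|nz] := eqVneq f 0; first by rewrite size_poly0 big_ord0 coef0 mul0r.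
have sf : (0 < size f)%N by rewrite size_poly_gt0.
rewrite (bigD1 (Ordinal sf)) //= big1 ?addr0 => [|l l0].
  by rewrite coefZ expr0 mulr1 coef_map_id0 ?expn0 ?expr1.
rewrite coefZ coefMXn ifT ?mulr0 //.
by rewrite lt0n; apply: contra l0 => /eqP E; apply/eqP/val_inj.
Qed.

(* In characteristic p a large enough p-power kills the nilpotent part of d(phi_a). *)
Lemma Lie_scalar a : exists s, Lie (phi (a ^+ (q ^ s))) = (ell a ^+ (q ^ s))%:M.
Proof.
have LieX n : Lie (phi (a ^+ n)) = Lie (phi a) ^+ n.
  by elim: n => [|n IHn]; rewrite ?Lie1 // !exprS LieM IHn.
case: HE => _ _ _ _ /(_ a)[n] N.
exists n; rewrite LieX; move: (Lie (phi a)) N; case: (d) => [|d'] M N.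
  by rewrite [LHS]flatmx0 [RHS]flatmx0.
have qn : (n <= q ^ n)%N by rewrite ltnW // ltn_expl // finNzRing_gt1.
have N0 : (M - (ell a)%:M) ^+ (q ^ n) = 0 by rewrite -(subnK qn) exprD N mulr0.
have frobX : ('X - (ell a)%:P) ^+ (q ^ n) = 'X^(q ^ n) - (ell a ^+ (q ^ n))%:P :> {poly C}.
  apply: etrans (frobD (polyC \o kC) n 'X (- (ell a)%:P)) _; congr (_ + _).
  by apply: etrans (frobN (polyC \o kC) n (ell a)%:P) _; rewrite rmorphXn.
have := congr1 (horner_mx M) frobX.
rewrite rmorphXn rmorphB /= horner_mx_X horner_mx_C N0 rmorphB rmorphXn /= horner_mx_X horner_mx_C.
by move/esym/eqP; rewrite subr_eq0 => /eqP.
Qed.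

(** The power that kills the nilpotent part of d(phi_c) leaves c itself unchanged, as c^(q^s) =
    c. *)
Lemma Lie_const c : Lie (phi (kA c)) = (kC c)%:M.
Proof.
have [s] := Lie_scalar (kA c).
by rewrite (frob_const kA) (frob_const kC).
Qed.

Section Exponential.
Variable E : V -> V.
Variable e : nat -> 'M[C]_d.
Hypothesis e0 : e 0%N = 1%:M.
Hypothesis E_cvg : forall x, vcvg abs
       (fun n => \sum_(l < n) e l *m map_mx (fun c => c ^+ (q ^ l)) x) (E x).

Lemma expD x y : E (x + y) = E x + E y.
Proof.
apply: (vcvg_unique Habs (E_cvg (x + y))); apply/vcvgP => eps eps0.
have /vcvgP/(_ _ eps0)[N NH] := E_cvg x.
have /vcvgP/(_ _ eps0)[N' NH'] := E_cvg y.
exists (maxn N N') => n; rewrite geq_max => /andP[Nn N'n].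
have -> : \sum_(l < n) e l *m map_mx (fun c => c ^+ (q ^ l)) (x + y) =
    \sum_(l < n) e l *m map_mx (fun c => c ^+ (q ^ l)) x +
    \sum_(l < n) e l *m map_mx (fun c => c ^+ (q ^ l)) y.
  rewrite -big_split /=; apply: eq_bigr => l _; rewrite -mulmxDr; congr (_ *m _).
  by apply/matrixP => i m; rewrite !mxE (frobD kC).
by rewrite opprD addrACA; apply: nrmD_lt => //; [exact: NH | exact: NH'].
Qed.

Lemma expZ c x : E (kC c *: x) = kC c *: E x.
Proof.
apply: (vcvg_unique Habs (E_cvg (kC c *: x))); apply/vcvgP => eps eps0.
have /vcvgP/(_ _ eps0)[N NH] := E_cvg x.
exists N => n Nn.
have -> : \sum_(l < n) e l *m map_mx (fun c => c ^+ (q ^ l)) (kC c *: x) =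
    kC c *: \sum_(l < n) e l *m map_mx (fun c => c ^+ (q ^ l)) x.
  rewrite scaler_sumr; apply: eq_bigr => l _; rewrite scalemxAr; congr (_ *m _).
  by apply/matrixP => i m; rewrite !mxE exprMn (frob_const kC).
by rewrite -scalerBr; apply: nrmZ_lt; [exact: Habs | exact: (abs_const Habs kC) | exact: NH].
Qed.

Lemma vcvg_bounded (s : nat -> V) l : vcvg abs s l -> exists B, forall n, nrm (s n) <= B.
Proof.
move=> /vcvgP/(_ 1 ltr01)[N NH]; exists (\sum_(i < N) nrm (s i) + (1 + nrm l)) => n.
have S0 (P : pred 'I_N) : 0 <= \sum_(i < N | P i) nrm (s i) by apply: sumr_ge0 => i _; exact: nrm_ge0.
have l0 : 0 <= 1 + nrm l by rewrite addr_ge0 ?nrm_ge0.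
have [Nn|nN] := leqP N n; last first.
  rewrite (bigD1 (Ordinal nN)) //= -addrA lerDl addr_ge0 //.
apply: (@le_trans _ _ (1 + nrm l)); last by rewrite lerDr S0.
rewrite -[s n](subrK l); apply: nrmD_le => //.
  by apply: (le_trans (ltW (NH _ Nn))); rewrite lerDl nrm_ge0.
by rewrite lerDr.
Qed.

(** Column i of e_l is the difference of two consecutive partial sums at the i-th unit vector, where
    the series converges; hence the entries of all e_l are bounded together. For |x| <= 1 one has
    |x^(q^l)| <= |x|. *)
Lemma exp_small : exists B, 0 < B /\ forall x, nrm x <= 1 -> nrm (E x) <= B * nrm x.
Proof.
have H (i : 'I_d) : exists B, forall l r, abs (e l r i) <= B.
  have [B HB] := vcvg_bounded (E_cvg (delta_mx i 0)); exists B => l r.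
  have B0 : 0 <= B by apply: le_trans (HB 0%N); exact: nrm_ge0.
  have -> : e l r i = (e l *m map_mx (fun c => c ^+ (q ^ l)) (delta_mx i 0 : V)) r 0.
    rewrite mxE (bigD1 i) //= !mxE !eqxx expr1n mulr1 big1 ?addr0 // => m mi.
    by rewrite !mxE (negbTE mi) (frob0 k) mulr0.
  apply: (le_trans (nrm_coord abs _ _)).
  have -> : e l *m map_mx (fun c => c ^+ (q ^ l)) (delta_mx i 0 : V) =
      \sum_(l' < l.+1) e l' *m map_mx (fun c => c ^+ (q ^ l')) (delta_mx i 0) -
      \sum_(l' < l) e l' *m map_mx (fun c => c ^+ (q ^ l')) (delta_mx i 0).
    by rewrite big_ord_recr /= addrAC subrr add0r.
  by apply: nrmD_le => //; rewrite ?nrmN.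
have [B HB] := choice H.
pose M := 1 + \sum_i `|B i|; have M0 : 0 < M by rewrite ltr_pwDl // sumr_ge0.
exists M; split=> // x x1.
have BM i : B i <= M.
  apply: (le_trans (ler_norm _)); rewrite /M (bigD1 i) //= addrCA lerDl.
  by rewrite addr_ge0 // sumr_ge0.
have x0 : 0 <= M * nrm x by rewrite mulr_ge0 ?nrm_ge0 // ltW.
have part n : nrm (\sum_(l < n) e l *m map_mx (fun c => c ^+ (q ^ l)) x) <= M * nrm x.
  apply: nrm_sum_le => // l _; apply/nrm_leP => // r; rewrite mxE.
  apply: abs_sum_le => // m _; rewrite mxE (absM Habs) // (absX Habs) //.
  apply: ler_pM; rewrite ?exprn_ge0 ?abs_ge0 //; first exact: le_trans (HB m l r) (BM m).
  apply: (@le_trans _ _ (abs (x m 0))); last exact: nrm_coord.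
  have xm1 : abs (x m 0) <= 1 by apply: le_trans x1; exact: nrm_coord.
  by rewrite ler_iXnr ?expn_gt0 ?abs_ge0 // (ltnW (finNzRing_gt1 k)).
rewrite leNgt; apply/negP => lt.
have /vcvgP/(_ (nrm (E x)))[|N NH] := E_cvg x; first exact: le_lt_trans x0 lt.
suff : nrm (E x) < nrm (E x) by rewrite ltxx.
have EE : E x = - (\sum_(l < N) e l *m map_mx (fun c => c ^+ (q ^ l)) x - E x) +
    \sum_(l < N) e l *m map_mx (fun c => c ^+ (q ^ l)) x by rewrite opprB subrK.
rewrite [X in maxnorm abs X < _]EE.
apply: nrmD_lt => //; last exact: le_lt_trans (part N) lt.
by rewrite nrmN //; exact: NH.
Qed.

End Exponential.

(** As the exponential is onto, the laws of the action on points are transported from the linear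
    action on Lie E. *)
Let exE : exists E : V -> V, [/\ (forall x y, E (x + y) = E x + E y),
   (forall c x, E (kC c *: x) = kC c *: E x),
   exists B, 0 < B /\ forall x, nrm x <= 1 -> nrm (E x) <= B * nrm x,
   forall a x, act a (E x) = E (Lie (phi a) *m x) & forall y, exists x, E x = y].
Proof.
have [E [[[e [_ Ecvg]] Eact] Esurj]] := Hunif.
exists E; split=> //; [exact: expD Ecvg | exact: expZ Ecvg | exact: exp_small Ecvg].
Qed.

Lemma actD a x y : act a (x + y) = act a x + act a y.
Proof.
have [E [ED _ _ Ea Es]] := exE; have [z <-] := Es x; have [z' <-] := Es y.
by rewrite -ED !Ea mulmxDr ED.
Qed.

Lemma act_addl a b x : act (a + b) x = act a x + act b x.
Proof.
by have [E [ED _ _ Ea Es]] := exE; have [z <-] := Es x; rewrite !Ea LieD mulmxDl ED.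
Qed.

Lemma actM a b x : act (a * b) x = act a (act b x).
Proof.
by have [E [ED _ _ Ea Es]] := exE; have [z <-] := Es x; rewrite !Ea LieM mulmxA.
Qed.

Lemma act1 x : act 1 x = x.
Proof. by have [E [_ _ _ Ea Es]] := exE; have [z <-] := Es x; rewrite !Ea Lie1 mul1mx. Qed.

Lemma act_const c x : act (kA c) x = kC c *: x.
Proof.
have [E [_ EZ _ Ea Es]] := exE; have [z <-] := Es x.
by rewrite Ea Lie_const mul_scalar_mx EZ.
Qed.

(** d(phi_a) is invertible: d(phi_(a^(q^s))) is the nonzero scalar ell(a)^(q^s), so the inverse is
    d(phi_(a^(q^s - 1))) divided by that scalar. *)
Lemma act_surj a y : a != 0 -> exists x, act a x = y.
Proof.
move=> a0; have [E [_ _ _ Ea Es]] := exE; have [z <-] := Es y.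
have [s Ls] := Lie_scalar a.
have q0 : (0 < q ^ s)%N by rewrite expn_gt0 (ltnW (finNzRing_gt1 k)).
have c0 : ell a ^+ (q ^ s) != 0.
  by rewrite expf_neq0 //; apply: contraNneq a0 => H; apply/eqP/ell_inj; rewrite rmorph0.
exists (E (Lie (phi (a ^+ (q ^ s).-1)) *m ((ell a ^+ (q ^ s))^-1 *: z))).
rewrite Ea mulmxA -LieM -exprS prednK // Ls mul_scalar_mx scalerA divff //.
by rewrite scale1r.
Qed.

Lemma act_small a : exists B, 0 < B /\ forall x, nrm x <= 1 -> nrm (act a x) <= B * nrm x.
Proof.
pose M := 1 + \sum_i \sum_m \sum_(l < size (phi a i m)) abs ((phi a i m)`_l).
have ge0 := fun x => abs_ge0 Habs x.
have M0 : 0 < M.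
  by rewrite ltr_pwDl // sumr_ge0 // => i _; rewrite sumr_ge0 // => m _; rewrite sumr_ge0.
exists M; split=> // x x1.
have x0 : 0 <= M * nrm x by rewrite mulr_ge0 ?nrm_ge0 // ltW.
apply/nrm_leP => // i; rewrite mxE; apply: abs_sum_le => // m _.
apply: abs_sum_le => // l _; rewrite (absM Habs) // (absX Habs) //.
apply: ler_pM; rewrite ?exprn_ge0 //.
  have le1 (I : finType) (F : I -> R) (i0 : I) : (forall i, 0 <= F i) -> F i0 <= \sum_i F i.
    by move=> F0; rewrite (bigD1 i0) //= lerDl sumr_ge0.
  apply: (@le_trans _ _ (\sum_i \sum_m \sum_(l < size (phi a i m)) abs ((phi a i m)`_l))); last first.
    by rewrite /M lerDr.
  apply: le_trans (le1 _ (fun i => \sum_m \sum_(l < size (phi a i m)) abs ((phi a i m)`_l)) i _); last first.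
    by move=> i'; rewrite !sumr_ge0 // => ? _; rewrite sumr_ge0.
  apply: le_trans (le1 _ (fun m => \sum_(l < size (phi a i m)) abs ((phi a i m)`_l)) m _); last first.
    by move=> m'; rewrite sumr_ge0.
  exact: (le1 _ (fun l : 'I_(size (phi a i m)) => abs ((phi a i m)`_l)) l _).
apply: (@le_trans _ _ (abs (x m 0))); last exact: nrm_coord.
have xm1 : abs (x m 0) <= 1 by apply: le_trans x1; exact: nrm_coord.
by rewrite ler_iXnr ?expn_gt0 // (ltnW (finNzRing_gt1 k)).
Qed.

Lemma geometric_small (r B eps : R) : 0 <= r -> r < 1 -> 0 < eps ->
  exists N, forall n, (N <= n)%N -> r ^+ n * B < eps.
Proof.
move=> r0 r1 eps0; have [B0|B0] := leP B 0.
  by exists 0%N => n _; apply: le_lt_trans eps0; rewrite mulr_ge0_le0 // exprn_ge0.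
have /cvg_expr/cvgrPdist_lt/(_ _ (divr_gt0 eps0 B0))[N _ NH] : `|r| < 1 by rewrite ger0_norm.
exists N => n Nn; rewrite -ltr_pdivlMr //.
by have := NH n Nn; rewrite /= sub0r normrN ger0_norm // exprn_ge0.
Qed.

(** Choose z with exp(z) = y and apply the exponential to the iterates on z of the inverse of
    d(phi_u). That inverse is c^-1 d(phi_(u^(Q-1))) with c = ell(u)^Q, and |c| > 1 drives the
    iterates to 0. *)
Lemma act_division_tower u y : 1 < abs (ell u) -> exists Y : nat -> V,
  [/\ Y 0%N = y, forall i, act u (Y i.+1) = Y i & null abs Y].
Proof.
move=> u1; have [E [_ _ [B [B0 EB]] Ea Es]] := exE; have [z zy] := Es y.
have [s Ls] := Lie_scalar u.
set Q := (q ^ s)%N in Ls; set c := ell u ^+ Q in Ls.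
have Q0 : (0 < Q)%N by rewrite expn_gt0 (ltnW (finNzRing_gt1 k)).
have c1 : 1 < abs c by rewrite (absX Habs) // exprn_egt1 // -lt0n.
have c0 : c != 0 by apply: contraTneq c1 => ->; rewrite (abs0 Habs) ltNge ler01.
pose Z i : V := c ^- i *: (Lie (phi (u ^+ (Q.-1 * i))) *m z).
have LieXQ m : Lie (phi (u ^+ (Q * m))) = (c ^+ m)%:M.
  elim: m => [|m IHm]; first by rewrite muln0 !expr0 Lie1.
  by rewrite mulnS exprD LieM IHm Ls -scalar_mxM exprS.
exists (fun i => E (Z i)); split.
- by rewrite /Z muln0 !expr0 Lie1 mul1mx invr1 scale1r.
- move=> i; rewrite Ea /Z; congr E; rewrite -scalemxAr mulmxA -LieM -exprS.
  have -> : (Q.-1 * i.+1).+1 = (Q * 1 + Q.-1 * i)%N by rewrite muln1 mulnS -addSn prednK.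
  rewrite exprD LieM LieXQ expr1 -mulmxA mul_scalar_mx scalerA exprS invfM.
  by rewrite mulrAC mulVf // mul1r.
pose D := 1 + \sum_(r < Q) nrm (Lie (phi (u ^+ (Q.-1 * r))) *m z).
have D0 : 0 < D by rewrite ltr_pwDl // sumr_ge0 // => i _; exact: nrm_ge0.
(* Each full block of Q steps contributes the scalar 1/c, since d(phi_(u^Q)) = c. What remains
   depends on i mod Q only, and [D] bounds these finitely many vectors. *)
have ZE i : nrm (Z i) <= (abs c)^-1 ^+ (i %/ Q) * D.
  have -> : Z i = (c ^- (i %/ Q) * c ^- (i %% Q)) *: (Lie (phi (u ^+ (Q.-1 * (i %% Q)))) *m z).
    have expE : (Q.-1 * i = Q * (Q.-1 * (i %/ Q)) + Q.-1 * (i %% Q))%N.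
      by rewrite {1}(divn_eq i Q) mulnDr mulnA [(Q.-1 * _ * Q)%N]mulnC.
    rewrite /Z expE exprD LieM LieXQ -mulmxA mul_scalar_mx scalerA; congr (_ *: _).
    have cE : c ^+ i = c ^+ (Q.-1 * (i %/ Q)) * (c ^+ (i %/ Q) * c ^+ (i %% Q)).
      rewrite -!exprD addnA; congr (_ ^+ _).
      by rewrite {1}(divn_eq i Q) -mulSnr prednK // [(Q * _)%N]mulnC.
    by rewrite cE invfM mulrAC (mulVf (expf_neq0 _ c0)) mul1r invfM.
  have r1 : abs (c ^- (i %% Q)) <= 1.
    rewrite (absV Habs (expf_neq0 _ c0)) (absX Habs) invf_le1 ?exprn_gt0 ?(lt_trans ltr01) //.
    by rewrite exprn_ege1 // ltW.
  have D1 : nrm (Lie (phi (u ^+ (Q.-1 * (i %% Q)))) *m z) <= D.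
    have rQ : (i %% Q < Q)%N by rewrite ltn_mod.
    rewrite /D (bigD1 (Ordinal rQ)) //= addrCA lerDl addr_ge0 // sumr_ge0 // => ? _.
    exact: nrm_ge0.
  have rD0 : 0 <= (abs c)^-1 ^+ (i %/ Q) * D.
    by rewrite mulr_ge0 ?exprn_ge0 ?invr_ge0 ?(abs_ge0 Habs) // ltW.
  apply/nrm_leP => // l.
  rewrite mxE (absM Habs) // (absM Habs) // -mulrA; apply: ler_pM; rewrite ?mulr_ge0 ?abs_ge0 //.
    by rewrite (absV Habs (expf_neq0 _ c0)) (absX Habs) exprVn.
  rewrite -[D]mul1r; apply: ler_pM; rewrite ?abs_ge0 //.
  by apply: le_trans D1; exact: nrm_coord.
move=> eps eps0; have r0 : 0 <= (abs c)^-1 by rewrite invr_ge0 abs_ge0.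
have r1 : (abs c)^-1 < 1 by rewrite invf_lt1 // (lt_trans ltr01).
have m0 : 0 < Num.min 1 (eps / B) by rewrite lt_min ltr01 divr_gt0.
have [N NH] := geometric_small D r0 r1 m0.
exists (N * Q)%N => n Nn.
have : nrm (Z n) < Num.min 1 (eps / B).
  by apply: (le_lt_trans (ZE n)); apply: NH; rewrite leq_divRL.
rewrite lt_min => /andP[Z1 Z2]; apply: (le_lt_trans (EB _ (ltW Z1))).
by rewrite mulrC -ltr_pdivlMr.
Qed.

End AndersonAction.

(** * The local ring at p *)

Section LocalRing.
Variables (k : finFieldType) (A : idomainType) (kA : {rmorphism k -> A}).
Variables (p : prime_idealr A) (Ap : idomainType) (j : {rmorphism A -> Ap}).
Hypothesis Hj : is_local_ring p j.
Variables (Fp : fieldExtType k) (res : {rmorphism Ap -> Fp}).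
Hypothesis Hres : is_residue_field p j (j \o kA) res.
Variable unif : A.
Hypothesis Hunif : forall y : Ap, local_pow p j 1 y <-> exists z, y = j unif * z.
Local Notation w := (j unif).

Lemma j_inj : injective j. Proof. by case: Hj. Qed.
Lemma j_unit s : s \notin p -> j s \is a GRing.unit. Proof. by case: Hj => _ + _; apply. Qed.
Lemma j_frac y : exists a s, s \notin p /\ y = j a / j s. Proof. by case: Hj => _ _; apply. Qed.
Lemma res_const c : res (j (kA c)) = c%:A. Proof. by case: Hres => + _ _; apply. Qed.
Lemma res_surj z : exists a, res (j a) = z. Proof. by case: Hres => _ + _; apply. Qed.

Lemma one_notin_p : 1 \notin p. Proof. by rewrite idealr1. Qed.

Lemma prime_powM n b a : prime_pow p n a -> prime_pow p n (b * a).
Proof.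
case: n => [//|n] [s [sP ->]].
exists [seq (b * u.1, u.2) | u <- s]; split.
  by move=> _ /mapP[u /sP[pu pu2] ->]; split=> //=; exact: idealMr.
by rewrite big_map mulr_sumr; apply: eq_bigr => u _; rewrite mulrA.
Qed.

Lemma prime_powD n a b : prime_pow p n a -> prime_pow p n b -> prime_pow p n (a + b).
Proof.
case: n => [//|n] [s [sP ->]] [s' [sP' ->]].
exists (s ++ s'); split; last by rewrite big_cat.
by move=> u; rewrite mem_cat => /orP[/sP|/sP'].
Qed.

Lemma prime_powS n a b : a \in p -> prime_pow p n b -> prime_pow p n.+1 (a * b).
Proof.
move=> pa pb; exists [:: (a, b)]; split; last by rewrite big_seq1.
by move=> u; rewrite inE => /eqP ->.
Qed.

Lemma prime_powX n a : a \in p -> prime_pow p n (a ^+ n).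
Proof. by move=> pa; elim: n => // n IHn; rewrite exprS; apply: prime_powS. Qed.

Lemma prime_pow1 a : prime_pow p 1 a <-> a \in p.
Proof.
split=> [[s [sP ->]]|pa]; last by have := prime_powX 1 pa.
rewrite big_seq; apply: rpred_sum => u /sP[pu _].
by rewrite mulrC; apply: idealMr.
Qed.

Lemma in_p a : a \in p <-> res (j a) = 0.
Proof.
case: Hres => _ _ H; rewrite H; split=> [pa|].
  exists a, 1; split; [exact/prime_pow1 | exact: one_notin_p |].
  by rewrite rmorph1 divr1.
move=> [b [s [/prime_pow1 pb ps E]]].
suff : s * a \in p by rewrite prime_idealrM (negbTE ps).
have -> // : s * a = b.
by apply: j_inj; rewrite rmorphM E mulrC divrK ?j_unit.
Qed.

Lemma notin_p a : a \notin p <-> res (j a) != 0.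
Proof.
split=> [pa|ra]; first by apply: contraNneq pa => H; apply/in_p.
by apply: contraNN ra => /in_p ->.
Qed.

Lemma unit_res y : res y != 0 -> y \is a GRing.unit.
Proof.
have [a [s [ps ->]]] := j_frac y; rewrite rmorphM => ra.
by rewrite unitrMl ?unitrV ?j_unit //; apply/notin_p; apply: contraNneq ra => ->; rewrite mul0r.
Qed.

Lemma res_unit y : y \is a GRing.unit -> res y != 0.
Proof. by move=> yU; rewrite -unitfE rmorph_unit. Qed.

Lemma res_eq0 y : res y = 0 <-> exists z, y = w * z.
Proof. by case: Hres => _ _ H; rewrite H Hunif. Qed.

Lemma res_unif : res w = 0. Proof. by apply/res_eq0; exists 1; rewrite mulr1. Qed.
Lemma unif_in_p : unif \in p. Proof. exact/in_p/res_unif. Qed.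

(** If s u0 is 1 modulo p, then (1 - s u0)^n lies in p^n and is 1 modulo s. *)
Lemma comaximal n s : s \notin p -> exists u v, prime_pow p n v /\ s * u + v = 1.
Proof.
move=> ps; have [u0 ru] := res_surj (res (j s))^-1.
have pv : 1 - s * u0 \in p.
  by apply/in_p; rewrite rmorphB rmorph1 !rmorphM rmorphB rmorph1 rmorphM ru divff ?subrr //; apply/notin_p.
suff [u E] : exists u, s * u + (1 - s * u0) ^+ n = 1.
  by exists u, ((1 - s * u0) ^+ n); split=> //; exact: prime_powX.
elim: n => [|n [u IHn]]; first by exists 0; rewrite mulr0 add0r.
exists (u + u0 * (1 - s * u0) ^+ n); rewrite -[RHS]IHn exprS; ring.
Qed.

Lemma prime_pow_cancel n s a : s \notin p -> prime_pow p n (s * a) -> prime_pow p n a.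
Proof.
move=> /(comaximal n)[u [v [pv E]]] psa.
rewrite -[a]mulr1 -E mulrDr; apply: prime_powD; last exact: prime_powM.
by have -> : a * (s * u) = u * (s * a) by [ring]; apply: prime_powM.
Qed.

(** p^n is the contraction of pi^n A_(p): a denominator outside p is invertible modulo p^n and can
    be cancelled. *)
Lemma prime_powP n a : prime_pow p n a <-> exists z, j a = w ^+ n * z.
Proof.
split=> [|[z E]].
  elim: n a => [|n IHn] a; first by exists (j a); rewrite mul1r.
  move=> [s [sP ->]]; rewrite rmorph_sum /=.
  have H u : exists z, u \in s -> j (u.1 * u.2) = w ^+ n.+1 * z.
    case: (boolP (u \in s)) => [/sP[/in_p/res_eq0[z1 E1] /IHn[z2 E2]]|_]; last by exists 0.
    by exists (z1 * z2) => _; rewrite rmorphM E1 E2 exprS mulrACA.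
  have [F FE] := choice H; exists (\sum_(u <- s) F u).
  by rewrite mulr_sumr big_seq [RHS]big_seq; apply: eq_bigr => u us; apply: FE.
have [b [s [ps zE]]] := j_frac z; apply: (prime_pow_cancel ps).
have -> : s * a = b * unif ^+ n.
  by apply: j_inj; rewrite !rmorphM rmorphXn E zE mulrCA [j s * _]mulrC divrK ?j_unit // mulrC.
by apply: prime_powM; exact/prime_powX/unif_in_p.
Qed.

Lemma local_powP n y : local_pow p j n y <-> exists z, y = w ^+ n * z.
Proof.
split=> [[a [s [/prime_powP[z E] ps ->]]]|[z ->]].
  by exists (z / j s); rewrite E mulrA.
have [a [s [ps ->]]] := j_frac z; exists (unif ^+ n * a), s; split=> //.
  by rewrite mulrC; apply: prime_powM; exact/prime_powX/unif_in_p.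
by rewrite rmorphM rmorphXn mulrA.
Qed.

Lemma approx n y : exists a z, y = j a + w ^+ n * z.
Proof.
have [a [s [ps ->]]] := j_frac y.
have [u [v [/prime_powP[z E] H]]] := comaximal n ps.
exists (a * u), (z * j a / j s).
have /(congr1 j) := H; rewrite rmorphD rmorph1 rmorphM E => H'.
rewrite -[LHS]mulr1 -[X in _ * X]H' mulrDr rmorphM; congr (_ + _).
  by rewrite mulrA divrK ?j_unit.
by rewrite [in LHS]mulrC !mulrA.
Qed.

Hypothesis Hp : exists2 x, x \in p & x != 0.

Lemma w_neq0 : w != 0.
Proof.
have [x px x0] := Hp; apply: contraNneq x0 => w0.
have /in_p/res_eq0[z E] := px; apply/eqP; apply: j_inj.
by rewrite E w0 mul0r rmorph0.
Qed.

Lemma wX_neq0 n : w ^+ n != 0. Proof. exact: expf_neq0 w_neq0. Qed.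

Lemma unif_neq0 : unif != 0.
Proof. by apply: contraNneq w_neq0 => ->; rewrite rmorph0. Qed.

Lemma unif_notin_k c : unif <> kA c.
Proof.
move=> E; have := res_unif; rewrite E res_const => /eqP.
rewrite scaler_eq0 oner_eq0 orbF => /eqP c0.
by have := unif_neq0; rewrite E c0 rmorph0 eqxx.
Qed.

Definition finite_over (z : A) := exists N, forall y : 'I_N -> A,
  exists c : 'I_N -> {poly k}, (exists l, c l != 0) /\
    \sum_l (map_poly kA (c l)).[z] * y l = 0.

Hypothesis Hfd : forall z, finite_over z.

Lemma horner_decomp (c : {poly k}) z :
  exists b, (map_poly kA c).[z] = kA c`_0 + z * b.
Proof.
elim/poly_ind: c => [|c a _]; first by exists 0; rewrite rmorph0 horner0 coef0 rmorph0 mulr0 addr0.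
exists (map_poly kA c).[z].
rewrite rmorphD rmorphM /= map_polyX map_polyC hornerMXaddC.
by rewrite coefD coefMX coefC !eqxx add0r addrC mulrC.
Qed.

(** Take a relation over k[pi] between powers of a nonzero a, with first nonzero coefficient c_l.
    Then a divides c_l(pi), which is pi^m times a unit of A_(p); so pi^(m+1) cannot divide a. *)
Lemma krull y : (forall n, exists z, y = w ^+ n * z) -> y = 0.
Proof.
have [a [s [ps ->]]] := j_frac y => H.
suff -> : a = 0 by rewrite rmorph0 mul0r.
have {}H n : exists z, j a = w ^+ n * z.
  by have [z E] := H n; exists (z * j s); rewrite mulrA -E divrK ?j_unit.
apply: contrapT => /eqP a0.
have [N HN] := Hfd unif; have [c [[l0 cl0] cE]] := HN (fun i => a ^+ i).
have exl : exists n, `[< exists l : 'I_N, l = n :> nat /\ c l != 0 >].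
  by exists l0; apply/asboolP; exists l0.
case: (ex_minnP exl) => n /asboolP[l [ln cl]] minl {l0 cl0 exl}.
have [b bE] : exists b, (map_poly kA (c l)).[unif] = a * b.
  have H' (i : 'I_N) : exists b, i != l -> (map_poly kA (c i)).[unif] * a ^+ i = a ^+ l.+1 * b.
    have [li|il] := ltnP l i.
      exists ((map_poly kA (c i)).[unif] * a ^+ (i - l.+1)) => _.
      by rewrite mulrCA -exprD subnKC.
    exists 0 => nil; have [-> | ci] := eqVneq (c i) 0.
      by rewrite rmorph0 horner0 mul0r mulr0.
    suff : (l < i)%N by rewrite ltnNge il.
    rewrite ltn_neqAle eq_sym (inj_eq val_inj) nil ln minl //.
    by apply/asboolP; exists i.
  have [F FE] := choice H'; exists (- \sum_(i | i != l) F i).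
  move: cE; rewrite (bigD1 l) //= => /eqP; rewrite addr_eq0 => /eqP cE.
  apply: (mulIf (expf_neq0 l a0)); rewrite cE (eq_bigr (fun i => a ^+ l.+1 * F i)).
    by rewrite -mulr_sumr exprS; ring.
  by move=> i; apply: FE.
have [m [c' [c'0 cE']]] : exists (m : nat) (c' : {poly k}), c'`_0 != 0 /\ c l = c' * 'X^m.
  have [m [c' /(implyP)/(_ cl) rc' cE']] := multiplicity_XsubC (c l) 0.
  exists m, c'; rewrite -horner_coef0 -rootE; split=> //.
  by rewrite cE' subr0.
have [b' b'E] := horner_decomp c' unif.
have [z zE] := H m.+1.
have : w ^+ m * (j (map_poly kA c').[unif]) = w ^+ m * (w * (z * j b)).
  move/(congr1 j): bE; rewrite cE' !rmorphM /= map_polyXn hornerM hornerXn rmorphM rmorphXn.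
  by rewrite [j a * _]mulrC zE exprSr => E; rewrite mulrC E; ring.
move/(mulfI (wX_neq0 m))/(congr1 res); rewrite b'E rmorphD rmorphM !rmorphD !rmorphM res_unif !mul0r addr0.
rewrite res_const => /eqP; rewrite scaler_eq0 oner_eq0 orbF.
by rewrite (negbTE c'0).
Qed.

Lemma valuation y : y != 0 -> exists e u, u \is a GRing.unit /\ y = w ^+ e * u.
Proof.
move=> y0; apply: contrapT => H; move/eqP: y0; apply; apply: krull.
elim=> [|n [z E]]; first by exists y; rewrite mul1r.
have [rz|rz] := eqVneq (res z) 0.
  by have /res_eq0[z' E'] := rz; exists z'; rewrite E E' mulrA exprSr.
by case: H; exists n, z; split=> //; exact: unit_res.
Qed.

Lemma card_eq0 (R : comNzRingType) (f : {rmorphism k -> R}) : #|k|%:R = 0 :> R.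
Proof.
have [l l_pr lk] := finPcharP k.
have E := card_pprimeChar lk.
have n0 : (0 < logn l #|k|)%N.
  by rewrite lt0n; apply/eqP => H; move: E (finNzRing_gt1 k); rewrite H => ->.
rewrite -(rmorph_nat f) E natrX.
by rewrite (pcharf0 lk) expr0n (negbTE (lt0n_neq0 n0)) rmorph0.
Qed.

(* Every [f] satisfies f = f^Q + pi g with Q the order of the residue field. *)
Lemma derivation_eq0 (delta : Ap -> Ap) : {morph delta : x y / x + y} ->
  (forall x y, delta (x * y) = delta x * y + x * delta y) ->
  delta w = 0 -> forall y, delta y = 0.
Proof.
move=> dD dM dw y; apply: krull => n; elim: n y => [|n IHn] y.
  by exists (delta y); rewrite mul1r.
have dX x m : delta (x ^+ m.+1) = (x ^+ m * delta x) *+ m.+1.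
  elim: m => [|m IHm]; first by rewrite expr1 expr0 mul1r mulr1n.
  by rewrite exprS dM IHm -mulrnAr mulrA -exprS mulrnAr [delta x * _]mulrC -mulrS.
have /res_eq0[g gE] : res (y - y ^+ (#|k| ^ \dim {:Fp})) = 0.
  by rewrite rmorphB rmorphXn frob_dim subrr.
have := IHn g => -[z zE]; exists z.
rewrite -[y in LHS](subrK (y ^+ (#|k| ^ \dim {:Fp}))) gE dD dM dw mul0r add0r zE.
have q0 : (0 < #|k| ^ \dim {:Fp})%N by rewrite expn_gt0 ltnW // finNzRing_gt1.
rewrite -(prednK q0) dX prednK // -mulr_natr natrX (card_eq0 (j \o kA)) expr0n.
by rewrite eqn0Ngt adim_gt0 mulr0 addr0 mulrA exprS.
Qed.

(** * Uniqueness of the extension and comparison of d_t with d_pi *)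

Section ChangeOfHyper.
Variables (dpi : nat -> Ap -> Ap) (t : A).
Hypothesis Hdpi : hyper_ext (j \o kA) w dpi.
Hypothesis Hdt : dpi 1%N (j t) \is a GRing.unit.
Let hdpi : is_hyperderivation (j \o kA) dpi. Proof. by case: Hdpi. Qed.

(** Inductively D_(n+1) - D'_(n+1) is a derivation, because the lower terms agree; so it equals
    delta(pi) d_pi^(1). It vanishes at t, where d_pi^(1) is a unit, hence delta(pi) = 0. *)
Lemma hyper_ext_unique D D' :
  hyper_ext (j \o kA) (j t) D -> hyper_ext (j \o kA) (j t) D' -> D = D'.
Proof.
move=> /hyper_ext_gen[hD D1 D2] /hyper_ext_gen[hD' D1' D2'].
apply: functional_extensionality_dep => n; apply: functional_extensionality_dep.
elim/ltn_ind: n => n IHn.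
case: n IHn => [|n] IHn; first by move=> y; rewrite (hyper_id hD) (hyper_id hD').
pose delta y := D n.+1 y - D' n.+1 y.
have dD : {morph delta : x y / x + y}.
  by move=> x y; rewrite /delta (hyperD hD) (hyperD hD'); ring.
have dM x y : delta (x * y) = delta x * y + x * delta y.
  rewrite /delta (hyperM hD) (hyperM hD') 2!(big_ord_recl n.+1) 2!(big_ord_recr n) /=.
  rewrite subn0 /bump /= !add1n subnn !(hyper_id hD) !(hyper_id hD').
  rewrite (eq_bigr (fun i : 'I_n => D' (bump 0 i) x * D' (n.+1 - bump 0 i)%N y)); last first.
    by move=> i _; rewrite /bump /= add1n !IHn // ?ltnS ?subSS ?leq_subr.
  ring.
have dE y : delta y = delta w * dpi 1%N y.
  apply/eqP; rewrite -subr_eq0; apply/eqP.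
  apply: (derivation_eq0 (delta := fun y => delta y - delta w * dpi 1%N y)).
  - by move=> a b; rewrite dD (hyperD hdpi); ring.
  - move=> a b; rewrite dM (hyperM hdpi) big_ord_recl big_ord_recl big_ord0 /=.
    by rewrite subnn subn0 !(hyper_id hdpi); ring.
  - by case/hyper_ext_gen: Hdpi => _ -> _; rewrite mulr1 subrr.
have dw : delta w = 0.
  apply: (mulIr Hdt); rewrite mul0r -dE /delta.
  by case: n {IHn delta dD dM dE} => [|n]; rewrite ?D1 ?D1' ?D2 ?D2' subrr.
by move=> y; apply/eqP; rewrite -subr_eq0 -/(delta y) dE dw mul0r.
Qed.

Lemma exists_unique_dt : exists! dt, hyper_ext (j \o kA) (j t) dt.
Proof.
exists (dt_of dpi (j t)); split; first exact: (dt_of_ext hdpi).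
by move=> D; apply: hyper_ext_unique; exact: (dt_of_ext hdpi).
Qed.

Variable dt : nat -> Ap -> Ap.
Hypothesis Hdt_ext : hyper_ext (j \o kA) (j t) dt.

Lemma dpi_expand n y : dpi n y =
  dpi 1%N (j t) ^+ n * dt n y + \sum_(a < n) tcoef dpi (j t) n a * dt a y.
Proof.
have -> : dt = dt_of dpi (j t) by apply: hyper_ext_unique => //; exact: (dt_of_ext hdpi).
rewrite (dt_ofE Hdt) big_ord_recr /= addrC; congr (_ * _ + _).
by rewrite tcoef_diag.
Qed.

Lemma dt1_unif_unit : dt 1%N w \is a GRing.unit.
Proof.
have := dpi_expand 1 w; rewrite big_ord_recl big_ord0 addr0 tcoef0 mul0r addr0 expr1.
case/hyper_ext_gen: Hdpi => _ -> _ /esym H.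
by apply/unitrP; exists (dpi 1%N (j t)); rewrite [in X in _ /\ X]mulrC.
Qed.

End ChangeOfHyper.

(** * Quotients A/gA and division of functionals *)

(** A relation over k[g] can be divided by g until some coefficient has a nonzero constant term;
    reduced modulo g it is then a nontrivial k-linear relation. *)
Lemma independent_mod_bound (g : A) : g != 0 -> exists N, forall y : nat -> A,
  exists z (c : nat -> k), (exists l : 'I_N, c l != 0) /\
    g * z + \sum_(l < N) kA (c l) * y l = 0.
Proof.
move=> g0; have [N HN] := Hfd g; exists N => y.
have [c [cn0 cE]] := HN (fun l => y l).
have [m mE] : exists m, (\sum_l size (c l) <= m)%N by exists (\sum_l size (c l))%N.
elim: m c cn0 cE mE => [|m IHm] c [l0 cl0] cE mE.
  move: mE; rewrite leqn0 sum_nat_eq0 => /forallP/(_ l0)/implyP/(_ isT).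
  by rewrite size_poly_eq0 (negbTE cl0).
have [[l1 cl1]|c0] := pselect (exists l, (c l)`_0 != 0).
  have [B BE] := choice (fun l => horner_decomp (c l) g).
  exists (\sum_l B l * y l), (fun l => if insub l is Some l' then (c l')`_0 else 0).
  split; first by exists l1; rewrite valK.
  rewrite -[RHS]cE mulr_sumr -big_split /=; apply: eq_bigr => l _.
  by rewrite valK BE mulrDl addrC mulrA.
have {}c0 l : (c l)`_0 = 0 by apply: contrapT => /eqP H; apply: c0; exists l.
have H l : exists c' : {poly k}, c l = c' * 'X.
  have /eqP : (c l).[0] = 0 by rewrite horner_coef0.
  by rewrite -/(root _ 0) => /factor_theorem[c' ->]; exists c'; rewrite subr0.
have [C CE] := choice H.
have szC l : size (c l) = (size (C l) + (C l != 0%R))%N.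
  rewrite CE; have [->|nz] := eqVneq (C l) 0; first by rewrite mul0r size_poly0.
  by rewrite size_mulX // addn1.
apply: (IHm C).
- by exists l0; apply: contraNneq cl0 => E; rewrite CE E mul0r.
- apply: (mulfI g0); rewrite mulr0 -[RHS]cE mulr_sumr; apply: eq_bigr => l _.
  by rewrite CE rmorphM /= map_polyX hornerMX; ring.
rewrite (bigD1 l0) //=; move: mE; rewrite (bigD1 l0) //= szC.
have -> : C l0 != 0 by apply: contraNneq cl0 => E; rewrite CE E mul0r.
have : (\sum_(l < N | l != l0) size (C l) <= \sum_(l < N | l != l0) size (c l))%N.
  by apply: leq_sum => l _; rewrite szC leq_addr.
by move=> le_sum; rewrite addn1 addSn ltnS; apply: leq_trans; rewrite leq_add2l.
Qed.

(** A family independent modulo gA and of the largest size allowed by the bound represents a basis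
    of A/gA. *)
Lemma quotient_split (g : A) : g != 0 -> exists M (y : nat -> A),
  (forall x, exists z (c : nat -> k), x = g * z + \sum_(l < M) kA (c l) * y l) /\
  (forall z (c : nat -> k), g * z + \sum_(l < M) kA (c l) * y l = 0 ->
     forall l : 'I_M, c l = 0).
Proof.
move=> g0; have [N HN] := independent_mod_bound g0.
pose indep M (y : nat -> A) := forall z (c : nat -> k),
  g * z + \sum_(l < M) kA (c l) * y l = 0 -> forall l : 'I_M, c l = 0.
have ex0 : exists M, `[< exists y, indep M y >].
  by exists 0%N; apply/asboolP; exists (fun=> 0) => z c _ [].
have bnd M : `[< exists y, indep M y >] -> (M <= N)%N.
  move=> /asboolP[y iy]; rewrite leqNgt; apply/negP => NM.
  have [z [c [[l cl] E]]] := HN y.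
  pose c' l := if (l < N)%N then c l else 0.
  have /iy/(_ (Ordinal (ltn_trans (ltn_ord l) NM))) : g * z + \sum_(l < M) kA (c' l) * y l = 0.
    rewrite -[RHS]E (big_ord_widen M (fun l => kA (c l) * y l)) 1?ltnW //; congr (_ + _).
    rewrite [RHS]big_mkcond /=; apply: eq_bigr => i _; rewrite /c'.
    by case: ifP => //; rewrite rmorph0 mul0r.
  by rewrite /c' /= ltn_ord => /eqP; rewrite (negbTE cl).
case: (ex_maxnP ex0 bnd) => M /asboolP[y iy] maxM.
exists M, y; split=> // x; apply: contrapT => Hx.
suff /maxM : `[< exists y, indep M.+1 y >] by rewrite ltnn.
apply/asboolP; exists (fun l => if (l < M)%N then y l else x) => z c.
rewrite big_ord_recr /= ltnn.
under eq_bigr => l _ do rewrite ltn_ord.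
have [cM|cM] := eqVneq (c M) 0.
  rewrite cM rmorph0 mul0r addr0 => /iy H l.
  have := ltn_ord l; rewrite ltnS leq_eqVlt => /orP[/eqP -> //|lM].
  exact: (H (Ordinal lM)).
move=> E; case: Hx; exists (- kA (c M)^-1 * z), (fun l => - (c M)^-1 * c l).
have cV : kA (c M)^-1 * kA (c M) = 1 by rewrite -rmorphM mulVf ?rmorph1.
have -> : \sum_(l < M) kA (- (c M)^-1 * c l) * y l = - kA (c M)^-1 * \sum_(l < M) kA (c l) * y l.
  by rewrite mulr_sumr; apply: eq_bigr => l _; rewrite rmorphM rmorphN mulrA.
move: E => /eqP; rewrite addrA addr_eq0 => /eqP E.
by rewrite mulrCA -mulrDr E mulrNN mulrA cV mul1r.
Qed.

(** Composition with [rho] divides functionals by g, as mu(rho(g x)) = mu(x). One k-linear map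
    serving all mu at once makes this division linear and continuous in mu. *)
Lemma linear_retraction (g : A) : g != 0 -> exists rho : A -> A,
  [/\ {morph rho : x y / x + y}, forall c x, rho (kA c * x) = kA c * rho x
    & forall x, rho (g * x) = x].
Proof.
move=> g0; have [M [y [span indep]]] := quotient_split g0.
have [rho rhoE] := choice span; have [C CE] := choice rhoE.
have uniq x z (c : nat -> k) : x = g * z + \sum_(l < M) kA (c l) * y l -> rho x = z.
  move=> E; have := CE x; rewrite {1}E => E'.
  have H : g * (z - rho x) + \sum_(l < M) kA (c l - C x l) * y l = 0.
    under eq_bigr do rewrite rmorphB mulrBl.
    rewrite sumrB mulrBr; move/eqP: E'; rewrite -subr_eq0 => /eqP E'.
    by rewrite -[RHS]E'; ring.
  have c0 := indep _ (fun l => c l - C x l) H; move: H.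
  rewrite big1 ?addr0 => [|l _]; last by rewrite c0 rmorph0 mul0r.
  by move/eqP; rewrite mulf_eq0 (negbTE g0) /= subr_eq0 => /eqP.
exists rho; split.
- move=> a b; apply: (uniq _ _ (fun l => C a l + C b l)).
  rewrite {1}(CE a) {1}(CE b); under [in RHS]eq_bigr do rewrite rmorphD mulrDl.
  by rewrite big_split /=; ring.
- move=> c a; apply: (uniq _ _ (fun l => c * C a l)).
  rewrite {1}(CE a); under [in RHS]eq_bigr do rewrite rmorphM -mulrA.
  by rewrite -mulr_sumr; ring.
- move=> x; apply: (uniq _ _ (fun=> 0)).
  by rewrite big1 ?addr0 // => l _; rewrite rmorph0 mul0r.
Qed.

(** pi may have zeros other than p, so p^m need not lie in pi^m A. As A/pi^m A is finite, a product
    of denominators over representatives of its classes serves for all of p^m. *)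
Lemma prime_pow_sub_unif m : exists s, s \notin p /\
  forall x, prime_pow p m x -> exists x', s * x = unif ^+ m * x'.
Proof.
have [M [y [span _]]] := quotient_split (expf_neq0 m unif_neq0).
pose comb (c : {ffun 'I_M -> k}) := \sum_l kA (c l) * y l.
have H (c : {ffun 'I_M -> k}) : exists s, s \notin p /\
    (prime_pow p m (comb c) -> exists x', s * comb c = unif ^+ m * x').
  have [/prime_powP[z zE]|nc] := pselect (prime_pow p m (comb c)); last first.
    by exists 1; rewrite one_notin_p.
  have [a [s [ps zE']]] := j_frac z; exists s; split=> // _; exists a.
  by apply: j_inj; rewrite !rmorphM rmorphXn zE zE' mulrCA [j s * _]mulrC divrK ?j_unit.
have [S SE] := choice H; exists (\prod_c S c); split.
  rewrite (big_morph (fun x => x \notin p) (id1 := true) (op1 := andb)).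
  - by rewrite big_andE; apply/forallP => c; case: (SE c).
  - by move=> a b; rewrite prime_idealrM negb_or.
  - by rewrite one_notin_p.
move=> x px; have [z [c E]] := span x.
pose c' : {ffun 'I_M -> k} := [ffun l : 'I_M => c l].
have E' : x = unif ^+ m * z + comb c'.
  by rewrite E; congr (_ + _); apply: eq_bigr => l _; rewrite ffunE.
have : prime_pow p m (comb c').
  have -> : comb c' = x + (- z) * unif ^+ m by rewrite E'; ring.
  apply: prime_powD => //; apply: prime_powM; exact/prime_powX/unif_in_p.
move=> /(proj2 (SE c'))[x' x'E].
exists (\prod_c S c * z + (\prod_(c | c != c') S c) * x').
rewrite {1}E' !mulrDr; congr (_ + _); first by rewrite mulrCA.
by rewrite (bigD1 c') //= [S c' * _]mulrC -mulrA x'E mulrCA.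
Qed.

(** * The dual of A/p^(n+1) *)

Definition klinear (mu : A -> k) := {morph mu : x y / x + y} /\ forall c x, mu (kA c * x) = c * mu x.

Lemma klinear0 mu : klinear mu -> mu 0 = 0.
Proof. by move=> [_ muZ]; rewrite -(mul0r 0) -(rmorph0 kA) muZ mul0r. Qed.

Lemma klinearN mu : klinear mu -> {morph mu : x / - x}.
Proof.
move=> mul x; apply/eqP; rewrite -addr_eq0 -(proj1 mul) addNr klinear0 //.
Qed.

(* The functionals on A/p^(n+1) form a free module of rank one, generated by
   any functional that is nonzero on the socle. *)
Lemma functional_generator n (tau : A -> k) (v : Fp) : klinear tau -> v != 0 ->
  (forall x, prime_pow p n.+1 x -> tau x = 0) ->
  (forall x, tau (unif ^+ n * x) = field_trace (v * res (j x))) ->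
  forall mu, klinear mu -> (forall x, prime_pow p n.+1 x -> mu x = 0) ->
  exists c, forall x, mu x = tau (c * x).
Proof.
move=> ltau v0 tau0 taun.
suff H i : (i <= n.+1)%N -> forall mu, klinear mu -> (forall x, prime_pow p i x -> mu x = 0) ->
    exists c, forall x, mu x = tau (c * x) by exact: (H n.+1).
elim: i => [|i IHi] i_n mu lmu mu0.
  by exists 0 => x; rewrite mul0r klinear0 // mu0.
have [L LE] := choice res_surj.
(* On pi^i A the functional sees only residues, because it kills p^(i+1). *)
have muLE x : mu (unif ^+ i * x) = mu (unif ^+ i * L (res (j x))).
  apply/eqP; rewrite -subr_eq0 -(klinearN lmu) -(proj1 lmu) -mulrBr mu0 //.
  rewrite mulrC; apply/prime_powS; last exact/prime_powX/unif_in_p.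
  by apply/in_p; rewrite !rmorphB LE subrr.
have [||b bE] := @field_trace_repr _ _ (fun x => mu (unif ^+ i * L x)).
- move=> x y; rewrite -(proj1 lmu) -mulrDr muLE [in RHS]muLE.
  by rewrite !LE !rmorphD !LE.
- move=> c x; rewrite -(proj2 lmu) muLE [in RHS]mulrCA [in RHS]muLE.
  by rewrite !LE !rmorphM LE res_const mulr_algl.
(* mu(pi^i x) = tr(b x) and tau(pi^n x) = tr(v x) on residues, so this [c] makes tau(c pi^(n-i) .)
   agree with mu on p^i; the difference kills p^i and the induction hypothesis applies. *)
pose c := L (b / v).
have /IHi H : (i <= n.+1)%N by exact: ltnW.
have [|x px|d dE] := H (fun x => mu x - tau (c * unif ^+ (n - i) * x)).
- split=> [x y|a x]; first by rewrite (proj1 lmu) mulrDr (proj1 ltau); ring.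
  by rewrite (proj2 lmu) mulrCA (proj2 ltau) mulrBr.
- have [z zE] := proj1 (prime_powP _ _) px; have [a [z' z'E]] := approx 1 z.
  pose e := x - unif ^+ i * a.
  have pe : prime_pow p i.+1 e.
    apply/prime_powP; exists z'.
    by rewrite rmorphB rmorphM rmorphXn zE z'E expr1 exprSr; ring.
  have -> : x = unif ^+ i * a + e by rewrite /e addrC subrK.
  rewrite (proj1 lmu) (mu0 e) // addr0 mulrDr (proj1 ltau).
  have -> : tau (c * unif ^+ (n - i) * e) = 0.
    apply: tau0; rewrite -mulrA; apply: prime_powM.
    apply/prime_powP; have [z1 E1] := proj1 (prime_powP _ _) pe; exists z1.
    by rewrite rmorphM rmorphXn E1 mulrA -exprD; congr (_ ^+ _ * _); lia.
  rewrite addr0; have -> : c * unif ^+ (n - i) * (unif ^+ i * a) = unif ^+ n * (c * a).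
    have -> : unif ^+ n = unif ^+ (n - i) * unif ^+ i by rewrite -exprD subnK.
    by ring.
  by rewrite taun !rmorphM /c LE muLE bE mulrCA mulrA divfK // subrr.
exists (c * unif ^+ (n - i) + d) => x.
by rewrite mulrDl (proj1 ltau) -dE addrC subrK.
Qed.

(** * The diagonal of A over k[pi] *)

(** A zero derivative leaves only exponents divisible by l, and the l-th power map is additive in
    characteristic l. *)
Lemma pth_root (R : idomainType) (l : nat) (P : {poly R}) : l \in [pchar R] ->
  P^`() = 0 -> (forall i, exists b, P`_i = b ^+ l) -> exists Q, P = Q ^+ l.
Proof.
move=> lR dP0 H; have [b bE] := choice H.
have l_gt0 : (0 < l)%N by rewrite prime_gt0 ?(pcharf_prime lR).
have Pl i : ~~ (l %| i)%N -> P`_i = 0.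
  case: i => [|i]; first by rewrite dvdn0.
  rewrite (dvdn_pcharf lR) => nz.
  have := congr1 (fun Q : {poly R} => Q`_i) dP0; rewrite coef_deriv coef0 -mulr_natr.
  by move/eqP; rewrite mulf_eq0 (negbTE nz) orbF => /eqP.
exists (\sum_(i < size P) b (l * i)%N *: 'X^i).
have lRX : l \in [pchar {poly R}] := rmorph_pchar polyC lR.
have frob0' : (0 : {poly R}) ^+ l = 0 by rewrite expr0n eqn0Ngt l_gt0.
rewrite (big_morph (fun Q : {poly R} => Q ^+ l) (id1 := 0) (op1 := +%R)) //; last first.
  by move=> Q Q'; rewrite exprDn_pchar // pnatE ?(pcharf_prime lR).
apply/polyP => m; rewrite coef_sum.
under eq_bigr => i _ do rewrite exprZn -bE -exprM coefZ coefXn [(i * l)%N]mulnC.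
have [lm|lm] := boolP (l %| m)%N; last first.
  rewrite Pl // big1 // => i _; case: eqP => [E|_]; last by rewrite mulr0.
  by rewrite E dvdn_mulr in lm.
have [i mE] : exists i, m = (l * i)%N by exists (m %/ l)%N; rewrite mulnC divnK.
have [iP|Pi] := ltnP i (size P).
  rewrite (bigD1 (Ordinal iP)) //= mE eqxx mulr1 big1 ?addr0 // => i' /eqP ii'.
  by rewrite eqn_pmul2l //; case: eqP => [E|]; [case: ii'; exact: val_inj | rewrite mulr0].
rewrite nth_default ?big1 // => [i' _|]; last by rewrite mE (leq_trans Pi) // leq_pmull.
rewrite mE eqn_pmul2l //; case: eqP => [E|]; last by rewrite mulr0.
by have := ltn_ord i'; rewrite ltnNge -E Pi.
Qed.

Definition ev_unif (c : {poly k}) : A := (map_poly kA c).[unif].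

Fact ev_unif_zmod : zmod_morphism ev_unif.
Proof. by move=> a b; rewrite /ev_unif rmorphB hornerD hornerN. Qed.
Fact ev_unif_monoid : monoid_morphism ev_unif.
Proof.
by split=> [|a b]; rewrite /ev_unif ?rmorph1 ?hornerC // rmorphM hornerM.
Qed.
HB.instance Definition _ := GRing.isZmodMorphism.Build {poly k} A ev_unif ev_unif_zmod.
HB.instance Definition _ := GRing.isMonoidMorphism.Build {poly k} A ev_unif ev_unif_monoid.

Lemma ev_unifE c : ev_unif c = (map_poly kA c).[unif]. Proof. by []. Qed.

Lemma ev_unifX : ev_unif 'X = unif. Proof. by rewrite ev_unifE map_polyX hornerX. Qed.

Lemma ev_unif_inj c : ev_unif c = 0 -> c = 0.
Proof.
move=> c0; apply: contrapT => /eqP nz.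
have [m [c' /(implyP)/(_ nz) rc' cE']] := multiplicity_XsubC c 0.
move: c0; rewrite cE' subr0 rmorphM rmorphXn /= ev_unifX.
move/eqP; rewrite mulf_eq0 (negbTE (expf_neq0 _ unif_neq0)) orbF => /eqP.
have [b bE] := horner_decomp c' unif; rewrite ev_unifE bE.
move/(congr1 (res \o j)); rewrite /= !rmorphD !rmorphM res_unif mul0r addr0 !rmorph0 res_const.
by move/eqP; rewrite scaler_eq0 oner_eq0 orbF -horner_coef0; apply/negP.
Qed.

(** A maximal k[pi]-independent family generates [A] up to denominators g(pi); these are removed
    later by dividing functionals by g(pi). *)
Lemma independent_generators : exists s (x : nat -> A), forall a,
  exists (g : {poly k}) (c : nat -> {poly k}), g != 0 /\
    ev_unif g * a = \sum_(l < s) ev_unif (c l) * x l.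
Proof.
have [N HN] := Hfd unif.
pose indep M (y : nat -> A) := forall c : nat -> {poly k},
  \sum_(l < M) ev_unif (c l) * y l = 0 -> forall l : 'I_M, c l = 0.
have ex0 : exists M, `[< exists y, indep M y >].
  by exists 0%N; apply/asboolP; exists (fun=> 0) => c _ [].
have bnd M : `[< exists y, indep M y >] -> (M <= N)%N.
  move=> /asboolP[y iy]; rewrite leqNgt; apply/negP => NM.
  have [c [[l cl] E]] := HN (fun l => y l).
  pose c' l := if insub l is Some l' then c l' else 0.
  pose F l := ev_unif (c' l) * y l.
  have FN : \sum_(l < N) F l = 0.
    by apply: etrans E; apply: eq_bigr => i _; rewrite /F /c' valK.
  have FM : \sum_(l < M) F l = 0.
    rewrite -[RHS]FN [RHS](big_ord_widen M F) 1?ltnW // [RHS]big_mkcond /=.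
    apply: eq_bigr => i _; rewrite /F /c'.
    by case: insubP => [_ -> //|/negbTE ->]; rewrite rmorph0 mul0r.
  have := iy _ FM (Ordinal (ltn_trans (ltn_ord l) NM)).
  by rewrite /c' /= valK => /eqP; rewrite (negbTE cl).
case: (ex_maxnP ex0 bnd) => M /asboolP[y iy] maxM.
exists M, y => x; apply: contrapT => Hx.
suff /maxM : `[< exists y, indep M.+1 y >] by rewrite ltnn.
apply/asboolP; exists (fun l => if (l < M)%N then y l else x) => c.
rewrite big_ord_recr /= ltnn.
under eq_bigr => l _ do rewrite ltn_ord.
have [cM|cM] := eqVneq (c M) 0.
  rewrite cM rmorph0 mul0r addr0 => /iy H l.
  have := ltn_ord l; rewrite ltnS leq_eqVlt => /orP[/eqP -> //|lM].
  exact: (H (Ordinal lM)).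
move=> /eqP; rewrite addrC addr_eq0 => /eqP E; case: Hx; exists (c M), (fun l => - c l).
by split=> //; rewrite E -sumrN; apply: eq_bigr => l _; rewrite rmorphN mulNr.
Qed.

Variable dpi : nat -> Ap -> Ap.
Hypothesis Hdpi : hyper_ext (j \o kA) w dpi.

Definition ev2 (P : {poly {poly k}}) (x : A) := (map_poly ev_unif P).[x].

(** Chain rule for P(pi, x): [map_poly deriv] is the partial derivative in the first variable, and
    d_pi^(1)(pi) = 1. *)
Lemma ev2_deriv P x :
  dpi 1%N (j (ev2 P x)) = j (ev2 (map_poly deriv P) x) + j (ev2 P^`() x) * dpi 1%N (j x).
Proof.
have hd : is_hyperderivation (j \o kA) dpi by case: Hdpi.
have d_ev c : dpi 1%N (j (ev_unif c)) = j (ev_unif c^`()).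
  case: Hdpi => _ /(_ 1%N c); rewrite nderivn1 !ev_unifE.
  by rewrite !map_poly_comp !horner_map.
have map0 : map_poly deriv 0 = 0 :> {poly {poly k}} by rewrite map_poly0.
elim/poly_ind: P => [|P c IHP].
  by rewrite /ev2 map0 deriv0 !rmorph0 !horner0 rmorph0 mul0r addr0 (hyper0 hd).
have -> : map_poly deriv (P * 'X + c%:P) = map_poly deriv P * 'X + c^`()%:P.
  apply/polyP => i; rewrite coef_map_id0 ?deriv0 // !(coefD, coefMX, coefC) coef_map_id0 ?deriv0 //.
  by case: i => [|i] /=; rewrite ?add0r ?addr0.
rewrite /ev2 derivMXaddC !(rmorphD, rmorphM) /= !map_polyX !map_polyC /=.
rewrite !(hornerD, hornerM, hornerX, hornerC) !(rmorphD, rmorphM) (hyperD hd) (hyperM hd).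
rewrite big_ord_recl big_ord_recl big_ord0 /= subnn subn0 !(hyper_id hd) IHP d_ev /ev2.
ring.
Qed.

(* Of the nonzero relations P(pi, x) = 0 of least degree in the second variable take one
   whose leading coefficient has least degree.  If dP/dX vanishes at x then both partial
   derivatives are zero, so that P is a power of a smaller relation. *)
Lemma separable_relation x : exists P, ev2 P x = 0 /\ ev2 P^`() x != 0.
Proof.
have [N HN] := Hfd unif.
have exP : exists n, `[< exists P, [/\ P != 0, ev2 P x = 0 & size P = n] >].
  have [c [[l cl] E]] := HN (fun l => x ^+ l).
  pose P := \poly_(i < N) (if insub i is Some i' then c i' else 0).
  exists (size P); apply/asboolP; exists P; split=> //.
    apply: contraNneq cl => /(congr1 (fun Q : {poly {poly k}} => Q`_l)).
    by rewrite coef_poly ltn_ord valK coef0 => ->.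
  rewrite /ev2 /P poly_def rmorph_sum horner_sum -[RHS]E; apply: eq_bigr => i _.
  by rewrite /= valK map_polyZ hornerZ map_polyXn hornerXn.
case: (ex_minnP exP) => n /asboolP[P0 [P0n P0x P0s]] minn.
have exQ : exists m, `[< exists P, [/\ P != 0, ev2 P x = 0, size P = n & size (lead_coef P) = m] >].
  by exists (size (lead_coef P0)); apply/asboolP; exists P0.
case: (ex_minnP exQ) => m /asboolP[P [nzP Px szP szl]] minm.
have minP Q : ev2 Q x = 0 -> (size Q < n)%N -> Q = 0.
  move=> Qx Qn; apply: contrapT => /eqP nzQ.
  have : (n <= size Q)%N by apply: minn; apply/asboolP; exists Q.
  by rewrite leqNgt Qn.
have minL Q : ev2 Q x = 0 -> (size Q <= n)%N -> (size (Q`_n.-1)%R < m)%N -> Q = 0.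
  move=> Qx; rewrite leq_eqVlt => /orP[/eqP szQ|szQ] H; last exact: minP.
  apply: contrapT => /eqP nzQ.
  suff : (m <= size (lead_coef Q))%N by rewrite /lead_coef szQ leqNgt H.
  by apply: minm; apply/asboolP; exists Q.
exists P; split=> //; apply/eqP => dPx.
have dP : P^`() = 0 by apply: minP => //; rewrite -szP lt_size_deriv.
have hd : is_hyperderivation (j \o kA) dpi by case: Hdpi.
(* By the chain rule the partial derivative in pi vanishes at x as well, and its top coefficient has
   smaller degree than that of [P]. *)
have dcoefs : map_poly deriv P = 0.
  apply: minL.
  - apply: (j_inj); have := ev2_deriv P x.
    by rewrite Px rmorph0 (hyper0 hd) dPx rmorph0 mul0r addr0.
  - by rewrite -szP size_poly.
  - rewrite coef_map_id0 ?deriv0 // -szP -/(lead_coef P) -szl lt_size_deriv //.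
    by rewrite lead_coef_eq0.
have [l l_pr lk] := finPcharP k.
have lkX : l \in [pchar {poly k}] := rmorph_pchar polyC lk.
have [|Q PQ] := @pth_root _ l P lkX dP.
- move=> i; apply: (pth_root lk).
    by have := congr1 (fun Q : {poly {poly k}} => Q`_i) dcoefs; rewrite coef_map_id0 ?deriv0 // coef0.
  (* Since #k is a power of l, each c in k is the l-th power of c^(#k/l). *)
  move=> i'; exists ((P`_i)`_i' ^+ (#|k| %/ l)); rewrite -exprM divnK ?expf_card //.
  rewrite (card_pprimeChar lk) dvdn_exp // lt0n; apply/eqP => H.
  by have := finNzRing_gt1 k; rewrite (card_pprimeChar lk) H.
have Qx : ev2 Q x = 0.
  have : ev2 Q x ^+ l = 0 by rewrite /ev2 -horner_exp -rmorphXn -PQ.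
  by move/eqP; rewrite expf_eq0 => /andP[_ /eqP].
have [szP1|szP1] := leqP (size P) 1.
  move: Px; rewrite /ev2 (size1_polyC szP1) map_polyC hornerC => /ev_unif_inj P00.
  by move: nzP; rewrite (size1_polyC szP1) P00 eqxx.
have Q0 : Q = 0.
  apply: minP => //; rewrite -szP.
  have szQ := size_exp Q l; rewrite -PQ in szQ.
  have szQ2 : ((size Q).-1 * 2 <= (size Q).-1 * l)%N.
    by rewrite leq_mul2l prime_gt1 ?orbT.
  move: szQ szQ2 szP1; move: (size P) (size Q) ((size Q).-1 * l)%N => a b c; lia.
by move: nzP; rewrite PQ Q0 expr0n (negbTE (lt0n_neq0 (prime_gt0 l_pr))) eqxx.
Qed.

(** These are the maps out of A (x)_{k[pi]} A. A list of pairs stands for an element of this tensor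
    product, and identities there are tested on all balanced maps. *)
Definition unif_balanced (W : zmodType) (f : A -> A -> W) :=
  [/\ forall a a' b, f (a + a') b = f a b + f a' b,
      forall a b b', f a (b + b') = f a b + f a b',
      forall c a b, f (kA c * a) b = f a (kA c * b)
    & forall a b, f (unif * a) b = f a (unif * b)].

Lemma unif_balanced_ev (W : zmodType) (f : A -> A -> W) (g : {poly k}) a b : unif_balanced f ->
  f (ev_unif g * a) b = f a (ev_unif g * b).
Proof.
move=> [fDl fDr fk fu]; elim/poly_ind: g a b => [|g c IHg] a b.
  rewrite rmorph0 !mul0r; apply: (@addrI _ (f 0 b)).
  rewrite -fDl addr0; have f00 a' : f a' 0 = 0 by apply: (@addrI _ (f a' 0)); rewrite -fDr !addr0.
  by rewrite f00 addr0.
have -> : ev_unif (g * 'X + c%:P) = ev_unif g * unif + kA c.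
  by rewrite rmorphD rmorphM /= ev_unifX [ev_unif c%:P]ev_unifE map_polyC hornerC.
by rewrite !mulrDl fDl fDr fk -mulrA IHg fu mulrA [unif * _]mulrC.
Qed.

Definition diagonal_for (x : A) (delta : seq (A * A)) :=
  forall (W : zmodType) (f : A -> A -> W), unif_balanced f ->
    \sum_(u <- delta) f (x * u.1) u.2 = \sum_(u <- delta) f u.1 (x * u.2).

(** The witness is the divided difference of P(x (x) 1) and P(1 (x) x) by x (x) 1 - 1 (x) x, for a
    separable relation P of x. It is annihilated by the divisor because P(x) = 0, by telescoping,
    and multiplication sends it to P'(x). *)
Lemma diagonal_one x : exists delta, diagonal_for x delta /\
  \sum_(u <- delta) u.1 * u.2 != 0.
Proof.
have [P [Px dPx]] := separable_relation x.
exists [seq (x ^+ u, ev_unif P`_i * x ^+ (i - u.+1)) | i <- iota 0 (size P), u <- iota 0 i].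
split=> [W f fb|]; last first.
  rewrite big_allpairs_dep /=; apply: contraNneq dPx => E; apply/eqP; apply: etrans E.
  rewrite /ev2 -deriv_map /deriv horner_poly size_map_inj_poly; last first.
  - by rewrite rmorph0.
  - by move=> a b /eqP; rewrite -subr_eq0 -rmorphB => /eqP/ev_unif_inj/eqP; rewrite subr_eq0 => /eqP.
  have -> : \sum_(i <- iota 0 (size P)) \sum_(u <- iota 0 i)
      x ^+ u * (ev_unif P`_i * x ^+ (i - u.+1))
      = \sum_(0 <= i < size P) (ev_unif P`_i *+ i) * x ^+ i.-1.
    rewrite /index_iota subn0; apply: eq_bigr => i _.
    rewrite (eq_big_seq (fun=> ev_unif P`_i * x ^+ i.-1)).
      by rewrite big_const_seq count_predT size_iota iter_addr_0 mulrnAl.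
    move=> u; rewrite mem_iota add0n => /andP[_ ui].
    by rewrite mulrCA -exprD; congr (_ * _ ^+ _); lia.
  case: (size P) => [|s]; first by rewrite big_nil big_ord0.
  rewrite big_nat_recl // mulr0n mul0r add0r big_mkord.
  by apply: eq_bigr => i _; rewrite coef_map.
have [fDl fDr fk fu] := fb.
have f0l b : f 0 b = 0 by apply: (@addrI _ (f 0 b)); rewrite -fDl !addr0.
have f0r a : f a 0 = 0 by apply: (@addrI _ (f a 0)); rewrite -fDr !addr0.
apply/eqP; rewrite -subr_eq0 !big_allpairs_dep /= -sumrB.
under eq_bigr => i _.
  rewrite -sumrB -{1}[i]subn0.
  rewrite (eq_big_seq (fun u => f (x ^+ u.+1) (ev_unif P`_i * x ^+ (i - u.+1))
     - f (x ^+ u) (ev_unif P`_i * x ^+ (i - u)))); last first.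
    move=> u; rewrite mem_iota => ui; rewrite -exprS mulrCA -exprS.
    by congr (_ - f _ (_ * _ ^+ _)); lia.
  rewrite -/(index_iota 0 i) telescope_sumr // subnn subn0 !expr0 mulr1.
  rewrite -[ev_unif _]mulr1 -unif_balanced_ev // -mulrA mul1r.
  over.
rewrite sumrB -(big_morph (fun a => f a 1) (fun a a' => fDl a a' 1) (f0l 1)).
rewrite -(big_morph (f 1) (fDr 1) (f0r 1)).
have -> : \sum_(i <- iota 0 (size P)) ev_unif P`_i * x ^+ i = 0.
  rewrite -[RHS]Px /ev2 -{1}[size P]subn0 -/(index_iota _ _) big_mkord.
  rewrite (horner_coef_wide _ (size_poly _ _)).
  by apply: eq_bigr => i _; rewrite coef_map.
by rewrite f0l f0r subrr.
Qed.

(** In the ring A (x)_{k[pi]} A multiply the elements obtained for each x separately; the image in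
    the domain [A] is a product of nonzero factors. *)
Lemma diagonal_exists (xs : seq A) : exists delta,
  (forall x, x \in xs -> diagonal_for x delta) /\ \sum_(u <- delta) u.1 * u.2 != 0.
Proof.
elim: xs => [|x xs [d [dxs d0]]].
  by exists [:: (1, 1)]; split=> //; rewrite big_seq1 mulr1 oner_eq0.
have [e [ex e0]] := diagonal_one x.
exists [seq (u.1 * v.1, u.2 * v.2) | u <- d, v <- e]; split.
  move=> y yx W f [fDl fDr fk fu]; rewrite !big_allpairs_dep /=.
  move: yx; rewrite inE => /orP[/eqP -> {y}|yxs].
    apply: eq_bigr => u _.
    have /(ex W) E : unif_balanced (fun a b => f (u.1 * a) (u.2 * b)).
      split=> [a a' b|a b b'|c a b|a b]; rewrite ?mulrDr ?fDl ?fDr //.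
        by rewrite mulrCA fk mulrCA.
      by rewrite mulrCA fu mulrCA.
    by apply: etrans (etrans E _); apply: eq_bigr => v _; rewrite mulrCA.
  rewrite exchange_big [RHS]exchange_big /=; apply: eq_bigr => v _.
  have /(dxs _ yxs W) E : unif_balanced (fun a b => f (a * v.1) (b * v.2)).
    split=> [a a' b|a b b'|c a b|a b]; rewrite ?mulrDl ?fDl ?fDr //.
      by rewrite -!mulrA fk.
    by rewrite -!mulrA fu.
  by apply: etrans (etrans E _); apply: eq_bigr => u _; rewrite mulrA.
rewrite big_allpairs_dep /=.
have -> : \sum_(u <- d) \sum_(v <- e) u.1 * v.1 * (u.2 * v.2)
    = (\sum_(u <- d) u.1 * u.2) * (\sum_(v <- e) v.1 * v.2).
  rewrite mulr_suml; apply: eq_bigr => u _; rewrite mulr_sumr.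
  by apply: eq_bigr => v _; rewrite mulrACA.
by rewrite mulf_neq0.
Qed.

(** * The trace form of the completion *)

Let hdpi : is_hyperderivation (j \o kA) dpi. Proof. by case: Hdpi. Qed.

(* The coefficients of the expansion of [a] in the completion Fp[[pi]]. *)
Definition theta l a : Fp := res (dpi l (j a)).
Local Notation q := #|k|.

Lemma thetaD l a b : theta l (a + b) = theta l a + theta l b.
Proof. by rewrite /theta rmorphD (hyperD hdpi) rmorphD. Qed.
Lemma thetaB l a b : theta l (a - b) = theta l a - theta l b.
Proof. by rewrite /theta rmorphB (hyperD hdpi) (hyperN hdpi) rmorphB. Qed.
Lemma theta_sum l (I : Type) (r : seq I) (P : pred I) (F : I -> A) :
  theta l (\sum_(i <- r | P i) F i) = \sum_(i <- r | P i) theta l (F i).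
Proof. by rewrite /theta rmorph_sum (hyper_sum hdpi) rmorph_sum. Qed.
Lemma thetaZ l c a : theta l (kA c * a) = c *: theta l a.
Proof. by rewrite /theta rmorphM (hyperZ hdpi) rmorphM /= res_const mulr_algl. Qed.
Lemma theta0 a : theta 0 a = res (j a).
Proof. by rewrite /theta (hyper_id hdpi). Qed.
Lemma thetaM l a b : theta l (a * b) = \sum_(i < l.+1) theta i a * theta (l - i) b.
Proof.
by rewrite /theta rmorphM (hyperM hdpi) rmorph_sum; apply: eq_bigr => i _; rewrite rmorphM.
Qed.
Lemma theta_unif0 a : theta 0 (unif * a) = 0.
Proof. by rewrite theta0 !rmorphM res_unif mul0r. Qed.
Lemma theta_unif l a : theta l.+1 (unif * a) = theta l a.
Proof.
by rewrite /theta rmorphM (hyper_ext_mul _ _ Hdpi) rmorphD rmorphM res_unif mul0r add0r.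
Qed.
Lemma theta_unifX l i a : theta l (unif ^+ i * a) = if (i <= l)%N then theta (l - i) a else 0.
Proof.
elim: i l => [|i IHi] l; first by rewrite mul1r subn0.
rewrite exprS -mulrA; case: l => [|l]; first by rewrite theta_unif0.
by rewrite theta_unif IHi ltnS subSS.
Qed.

Lemma theta_eq0 m y : (forall i, (i < m)%N -> res (dpi i y) = 0) -> exists z, y = w ^+ m * z.
Proof.
elim: m y => [|m IHm] y H; first by exists y; rewrite mul1r.
have /res_eq0[z zE] : res y = 0 by rewrite -(H 0%N) // (hyper_id hdpi).
have [|z' z'E] := IHm z; last by exists z'; rewrite zE z'E exprS mulrA.
move=> i im; have := H i.+1 im.
by rewrite zE (hyper_ext_mul _ _ Hdpi) rmorphD rmorphM res_unif mul0r add0r.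
Qed.

(* [galois_pairing s l a b] is the coefficient of pi^l in sigma^s(a) b, where sigma is the
   Frobenius of Fp acting on the coefficients of Fp[[pi]]. *)
Definition galois_pairing s l a b : Fp :=
  \sum_(i < l.+1) theta i a ^+ (q ^ s) * theta (l - i) b.

Lemma galois_pairing_balanced s l : unif_balanced (galois_pairing s l).
Proof.
split.
- move=> a a' b; rewrite -big_split; apply: eq_bigr => i _.
  by rewrite thetaD (frobD (in_alg Fp)) mulrDl.
- move=> a b b'; rewrite -big_split; apply: eq_bigr => i _.
  by rewrite thetaD mulrDr.
- move=> c a b; apply: eq_bigr => i _.
  by rewrite !thetaZ frobZ -scalerAl -scalerAr.
move=> a b; rewrite /galois_pairing big_ord_recl theta_unif0 frob0 mul0r add0r.
rewrite big_ord_recr /= subnn theta_unif0 mulr0 addr0.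
apply: eq_bigr => i _; rewrite /bump /= add1n theta_unif.
have -> : (l - i = (l - i.+1).+1)%N by case: i => i /=; lia.
by rewrite theta_unif.
Qed.

(** The pairing is a coefficient of the product of the truncated expansions of sigma^s(a) and b, and
    the claim is associativity of that product. *)
Lemma galois_pairing_mull s l x a b : galois_pairing s l (x * a) b =
  \sum_(u < l.+1) theta u x ^+ (q ^ s) * galois_pairing s (l - u) a b.
Proof.
pose P (c : A) : {poly Fp} := \poly_(i < l.+1) theta i c ^+ (q ^ s).
pose P0 (c : A) : {poly Fp} := \poly_(i < l.+1) theta i c.
have pairE u c d : (u <= l)%N -> galois_pairing s u c d = (P c * P0 d)`_u.
  move=> ul; rewrite coefM; apply: eq_bigr => -[i /= iu] _.
  by rewrite !coef_poly !ifT //; lia.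
transitivity ((P x * (P a * P0 b))`_l).
  rewrite mulrA coefM; apply: eq_bigr => -[i /= il] _.
  rewrite [(P0 b)`_ _]coef_poly ifT; last by lia.
  congr (_ * _); rewrite thetaM (frob_sum (in_alg Fp)) coefM.
  apply: eq_bigr => -[i' /= i'i] _.
  by rewrite exprMn !coef_poly !ifT //; lia.
rewrite coefM; apply: eq_bigr => -[u /= ul] _.
by rewrite pairE ?leq_subr // coef_poly ul.
Qed.

Lemma galois_pairing_mulr s l x a b : galois_pairing s l a (x * b) =
  \sum_(u < l.+1) theta u x * galois_pairing s (l - u) a b.
Proof.
pose P (c : A) : {poly Fp} := \poly_(i < l.+1) theta i c ^+ (q ^ s).
pose P0 (c : A) : {poly Fp} := \poly_(i < l.+1) theta i c.
have pairE u c d : (u <= l)%N -> galois_pairing s u c d = (P c * P0 d)`_u.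
  move=> ul; rewrite coefM; apply: eq_bigr => -[i /= iu] _.
  by rewrite !coef_poly !ifT //; lia.
transitivity ((P0 x * (P a * P0 b))`_l).
  rewrite mulrCA coefM; apply: eq_bigr => -[i /= il] _.
  rewrite [(P a)`_ _]coef_poly ifT //; congr (_ * _); rewrite thetaM coefM.
  apply: eq_bigr => -[i' /= i'i] _.
  by rewrite !coef_poly !ifT //; lia.
rewrite coefM; apply: eq_bigr => -[u /= ul] _.
by rewrite pairE ?leq_subr // coef_poly ul.
Qed.

(** The series W with these sums as coefficients satisfies (sigma^s(x) - x) W = 0, and sigma^s(x) -
    x has a nonzero constant term. *)
Lemma galois_pairing_diagonal s x delta : diagonal_for x delta ->
  res (j x) ^+ (q ^ s) != res (j x) ->
  forall l, \sum_(u <- delta) galois_pairing s l u.1 u.2 = 0.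
Proof.
move=> dx nx; elim/ltn_ind => l IHl.
have := dx _ _ (galois_pairing_balanced s l).
under eq_bigr do rewrite galois_pairing_mull.
under [in X in _ = X]eq_bigr do rewrite galois_pairing_mulr.
rewrite exchange_big [RHS]exchange_big /=.
under eq_bigr do rewrite -mulr_sumr.
under [in X in _ = X]eq_bigr do rewrite -mulr_sumr.
have IH (i : 'I_l) : \sum_(u <- delta) galois_pairing s (l - bump 0 i) u.1 u.2 = 0.
  by apply: IHl; case: i => i; rewrite /bump /=; lia.
rewrite !big_ord_recl /= subn0 !theta0.
rewrite [X in _ + X = _]big1 => [|i _]; last by rewrite IH mulr0.
rewrite [X in _ = _ + X]big1 => [|i _]; last by rewrite IH mulr0.
rewrite !addr0.
move/eqP; rewrite -subr_eq0 -mulrBl mulf_eq0 => /orP[|/eqP //].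
by rewrite subr_eq0 (negbTE nx).
Qed.

Lemma frobenius_witnesses : exists xs : seq A,
  forall s, (0 < s < \dim {:Fp})%N -> exists2 x, x \in xs & res (j x) ^+ (q ^ s) != res (j x).
Proof.
have H s : exists x, (0 < s < \dim {:Fp})%N -> res (j x) ^+ (q ^ s) != res (j x).
  case: (boolP (0 < s < \dim {:Fp})%N) => [/frob_neq[y ny]|_]; last by exists 0.
  by have [x xE] := res_surj y; exists x; rewrite xE.
have [X XE] := choice H; exists [seq X s | s <- iota 0 (\dim {:Fp})] => s sf.
by exists (X s); [apply: map_f; rewrite mem_iota; case/andP: sf | exact: XE].
Qed.

Definition dpi_trace n a : k := field_trace (theta n a).

(* The functional dpi_trace n is the trace pairing of the extension Fp[[pi]]/k[[pi]] read
   off on coefficients; contracting the diagonal element with it gives back the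
   identity Galois component only. *)
Lemma trace_contraction (xs : seq A) : (forall s, (0 < s < \dim {:Fp})%N ->
    exists2 x, x \in xs & res (j x) ^+ (q ^ s) != res (j x)) ->
  forall delta, (forall x, x \in xs -> diagonal_for x delta) -> forall n,
  prime_pow p n.+1 (\sum_(u <- delta) u.2 *
        (\sum_(i < n.+1) kA (dpi_trace n (unif ^+ i * u.1)) * unif ^+ (n - i))
     - \sum_(u <- delta) u.1 * u.2).
Proof.
move=> Hxs delta Hdelta n; apply/prime_powP; apply: theta_eq0 => l l_n.
rewrite -/(theta l _) thetaB !theta_sum.
have W0 s : (0 < s < \dim {:Fp})%N -> \sum_(u <- delta) galois_pairing s l u.1 u.2 = 0.
  by move=> /Hxs[x xxs nx]; apply: (@galois_pairing_diagonal s x) => //; exact: Hdelta.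
have -> : \sum_(u <- delta) theta l (u.1 * u.2) = \sum_(u <- delta) galois_pairing 0 l u.1 u.2.
  apply: eq_bigr => u _; rewrite thetaM; apply: eq_bigr => i _.
  by rewrite expn0 expr1.
apply/eqP; rewrite subr_eq0; apply/eqP.
(* Modulo pi^(n+1) the inner sum is the trace of [u.1] from Fp[[pi]] to k[[pi]], that is, the sum of
   its conjugates under the powers of sigma; only s = 0 survives the contraction with [delta]. *)
transitivity (\sum_(u <- delta) \sum_(s < \dim {:Fp}) galois_pairing s l u.1 u.2).
  apply: eq_bigr => u _.
  rewrite (reindex_inj rev_ord_inj) /= mulr_sumr theta_sum.
  transitivity (\sum_(i < l.+1) (dpi_trace i u.1)%:A * theta (l - i) u.2).
    rewrite (big_ord_widen n.+1 (fun i => (dpi_trace i u.1)%:A * theta (l - i) u.2)) //.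
    rewrite [RHS]big_mkcond; apply: eq_bigr => -[i /= i_n] _.
    rewrite subSS subKn // mulrCA [u.2 * _]mulrC thetaZ theta_unifX ltnS.
    rewrite /dpi_trace theta_unifX leq_subr subKn //.
    by case: ifP => _; rewrite ?scaler0 // mulr_algl.
  rewrite exchange_big; apply: eq_bigr => i _ /=; rewrite -mulr_suml; congr (_ * _).
  exact: field_trace_frob.
rewrite exchange_big /=.
have f0 : (0 < \dim {:Fp})%N by rewrite adim_gt0.
rewrite (bigD1 (Ordinal f0)) //= [X in _ + X]big1 ?addr0 // => s s0.
by apply: W0; rewrite ltn_ord lt0n andbT -(inj_eq val_inj) in s0 *.
Qed.

(** * Special functions as continuous A-linear maps on the dual of A *)

Variables (R : realType) (C : fieldType) (abs : C -> R) (kC : {rmorphism k -> C}).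
Hypothesis Habs : is_ultrametric_abs abs.
Hypothesis Hcomplete : abs_complete abs.
Variables (d : nat) (phi : A -> 'M[{poly C}]_d).
Local Notation V := 'cV[C]_d.
Local Notation nrm := (maxnorm abs).
Local Notation vsum := (vsum abs).
Local Notation null := (null abs).
Local Notation act := (act #|k| phi).
Hypothesis actD : forall a (x y : V), act a (x + y) = act a x + act a y.
Hypothesis act_addl : forall a b x, act (a + b) x = act a x + act b x.
Hypothesis actM : forall a b x, act (a * b) x = act a (act b x).
Hypothesis act1 : forall x, act 1 x = x.
Hypothesis act_const : forall c x, act (kA c) x = kC c *: x.
Hypothesis act_small : forall a, exists B : R, 0 < B /\
  forall x, nrm x <= 1 -> nrm (act a x) <= B * nrm x.
Hypothesis act_surj : forall a y, a != 0 -> exists x, act a x = y.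
Hypothesis act_tower : forall y, exists Y : nat -> V,
  [/\ Y 0%N = y, forall i, act unif (Y i.+1) = Y i & null Y].
Variables (b : nat -> A) (bc : A -> {poly k}).
Hypothesis Hb : is_kbasis kA b bc.
Implicit Types (v : nat -> V) (mu nu : A -> k).

Let absk c : abs (kC c) <= 1. Proof. exact: abs_const. Qed.

Lemma act0 a : act a 0 = 0.
Proof. by apply: (@addrI _ (act a 0)); rewrite -actD !addr0. Qed.
Lemma act0l x : act 0 x = 0.
Proof. by rewrite -(rmorph0 kA) act_const rmorph0 scale0r. Qed.
Lemma actN a x : act a (- x) = - act a x.
Proof. by apply/eqP; rewrite -addr_eq0 -actD addNr act0. Qed.
Lemma act_sum a (I : Type) (r : seq I) (P : pred I) (F : I -> V) :
  act a (\sum_(i <- r | P i) F i) = \sum_(i <- r | P i) act a (F i).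
Proof. exact: (big_morph _ (actD a) (act0 a)). Qed.
Lemma act_suml (I : Type) (r : seq I) (P : pred I) (F : I -> A) x :
  act (\sum_(i <- r | P i) F i) x = \sum_(i <- r | P i) act (F i) x.
Proof. exact: (big_morph (fun a => act a x) (fun a a' => act_addl a a' x) (act0l x)). Qed.
Lemma actZ a c x : act a (kC c *: x) = kC c *: act a x.
Proof. by rewrite -!act_const -!actM mulrC. Qed.
Lemma actC a a' x : act a (act a' x) = act a' (act a x).
Proof. by rewrite -!actM mulrC. Qed.

Lemma act_cont a e : 0 < e -> exists2 e', 0 < e' & forall x, nrm x < e' -> nrm (act a x) < e.
Proof.
move=> e0; have [B [B0 BH]] := act_small a.
exists (Num.min 1 (e / B)); first by rewrite lt_min ltr01 divr_gt0.
move=> x; rewrite lt_min => /andP[x1 xe]; apply: (le_lt_trans (BH _ (ltW x1))).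
by rewrite mulrC -ltr_pdivlMr.
Qed.

Lemma act_null a v : null v -> null (fun i => act a (v i)).
Proof.
move=> nv e /(act_cont a)[e' e'0 H]; have [N NH] := nv e' e'0.
by exists N => n /NH/H.
Qed.

Lemma act_vsum a v : null v -> act a (vsum v) = vsum (fun i => act a (v i)).
Proof.
move=> nv; apply/esym/vsum_unique => //; first exact: act_null.
apply/vcvgP => e /(act_cont a)[e' e'0 H].
have /vcvgP/(_ e' e'0)[N NH] := vsum_cvg Habs Hcomplete nv.
by exists N => n /NH/H; rewrite actD actN act_sum.
Qed.

Lemma vsum_shift v : null v -> vsum v = v 0%N + vsum (fun i => v i.+1).
Proof.
move=> nv; have nv' : null (fun i => v i.+1).
  by move=> e e0; have [N NH] := nv e e0; exists N => n Nn; apply: NH; exact: leqW.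
apply: vsum_unique => //; apply/vcvgP => e e0.
have /vcvgP/(_ e e0)[N NH] := vsum_cvg Habs Hcomplete nv'.
exists N.+1 => -[//|n] Nn; rewrite big_ord_recl opprD addrACA subrr add0r.
exact: NH.
Qed.

Definition comb (f : {poly k}) := \sum_(i < size f) kA f`_i * b i.

Lemma comb_wide n (f : {poly k}) : (size f <= n)%N -> comb f = \sum_(i < n) kA f`_i * b i.
Proof.
move=> fn; rewrite /comb (big_ord_widen n (fun i => kA f`_i * b i)) //.
rewrite big_mkcond; apply: eq_bigr => i _; case: ltnP => // fi.
by rewrite nth_default // rmorph0 mul0r.
Qed.

Lemma bcK x : comb (bc x) = x. Proof. by case: Hb => H _; rewrite /comb -H. Qed.
Lemma combK f : bc (comb f) = f. Proof. by case: Hb => _; apply. Qed.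

Lemma bcD x y : bc (x + y) = bc x + bc y.
Proof.
rewrite -[RHS]combK; congr bc; rewrite -{1}(bcK x) -{1}(bcK y).
pose n := maxn (size (bc x)) (size (bc y)).
rewrite (@comb_wide n (bc x)) ?leq_maxl // (@comb_wide n (bc y)) ?leq_maxr //.
rewrite (@comb_wide n (bc x + bc y)) ?size_polyD // -big_split; apply: eq_bigr => i _.
by rewrite coefD rmorphD mulrDl.
Qed.

Lemma bcZ c x : bc (kA c * x) = c *: bc x.
Proof.
rewrite -[RHS]combK; congr bc; rewrite -{1}(bcK x).
rewrite (@comb_wide (size (bc x)) (c *: bc x)) ?size_scale_leq // mulr_sumr.
by apply: eq_bigr => i _; rewrite coefZ rmorphM mulrA.
Qed.

Definition coordf m (x : A) : k := (bc x)`_m.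

Lemma coordf_klinear m : klinear (coordf m).
Proof. by split=> [x y|c x]; rewrite /coordf ?bcD ?coefD // bcZ coefZ. Qed.

Lemma coordf_b m i : coordf m (b i) = (i == m)%:R.
Proof.
have E : b i = comb 'X^i.
  rewrite /comb size_polyXn big_ord_recr /= coefXn eqxx rmorph1 mul1r big1 ?add0r // => l _.
  by rewrite coefXn (ltn_eqF (ltn_ord l)) rmorph0 mul0r.
by rewrite /coordf E combK coefXn eq_sym.
Qed.

Lemma klinear_sum mu (I : Type) (r : seq I) (P : pred I) (F : I -> A) : klinear mu ->
  mu (\sum_(i <- r | P i) F i) = \sum_(i <- r | P i) mu (F i).
Proof. by move=> lmu; exact: (big_morph _ (proj1 lmu) (klinear0 lmu)). Qed.

Lemma klinear_eq0 mu x : klinear mu -> (forall i, (i < size (bc x))%N -> mu (b i) = 0) -> mu x = 0.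
Proof.
move=> lmu H; rewrite -(bcK x) /comb klinear_sum // big1 // => i _.
by rewrite (proj2 lmu) H ?mulr0.
Qed.

Lemma klinearZ c mu : klinear mu -> klinear (fun x => c * mu x).
Proof.
move=> [mD mZ]; split=> [x y|c' x]; first by rewrite mD mulrDr.
by rewrite mZ mulrCA.
Qed.
Lemma klinearB mu nu : klinear mu -> klinear nu -> klinear (fun x => mu x - nu x).
Proof.
move=> [mD mZ] [nD nZ]; split=> [x y|c x]; first by rewrite mD nD; ring.
by rewrite mZ nZ mulrBr.
Qed.
Definition additive_const (T : A -> A) :=
  {morph T : x y / x + y} /\ forall c x, T (kA c * x) = kA c * T x.
Lemma klinear_comp (T : A -> A) mu : additive_const T -> klinear mu -> klinear (fun x => mu (T x)).
Proof. by move=> [TD TZ] [mD mZ]; split=> [x y|c x]; rewrite ?TD ?TZ ?mD ?mZ. Qed.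
Lemma mul_additive_const a : additive_const (fun x => a * x).
Proof. by split=> [x y|c x]; [rewrite mulrDr | rewrite mulrCA]. Qed.
Lemma klinearM a mu : klinear mu -> klinear (fun x => mu (a * x)).
Proof. exact/klinear_comp/mul_additive_const. Qed.

(* Smallness of [G] at functionals close to 0 for the topology of pointwise convergence. *)
Definition continuous0 (G : (A -> k) -> V) := forall e, 0 < e -> exists N, forall mu, klinear mu ->
  (forall i, (i < N)%N -> mu (b i) = 0) -> nrm (G mu) < e.

Lemma vanish_on (T : nat -> A) N : exists M, forall mu, klinear mu ->
  (forall i, (i < M)%N -> mu (b i) = 0) -> forall i, (i < N)%N -> mu (T i) = 0.
Proof.
exists (\max_(i < N) size (bc (T i))) => mu lmu H i iN; apply: klinear_eq0 => // l ls.
by apply: H; apply: leq_trans ls _; exact: (leq_bigmax (Ordinal iN)).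
Qed.

Lemma continuous0_comp G (T : A -> A) : additive_const T -> continuous0 G ->
  continuous0 (fun mu => G (fun x => mu (T x))).
Proof.
move=> linT cG e /cG[N NH]; have [M MH] := vanish_on (T \o b) N.
by exists M => mu lmu /(MH _ lmu) H; apply: NH => //; exact: klinear_comp.
Qed.

Lemma continuous0_act G a : continuous0 G -> continuous0 (fun mu => act a (G mu)).
Proof.
move=> cG e /(act_cont a)[e' /cG[N NH] H].
by exists N => mu lmu /NH H'; apply: H; exact: H'.
Qed.

Lemma continuous0_sum (I : Type) (r : seq I) (G : I -> (A -> k) -> V) :
  (forall i, continuous0 (G i)) -> continuous0 (fun mu => \sum_(i <- r) G i mu).
Proof.
move=> cG e e0; elim: r => [|i r [N NH]]; first by exists 0%N => mu _ _; rewrite big_nil nrm0.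
have [N' NH'] := cG i e e0; exists (maxn N N') => mu lmu H; rewrite big_cons.
apply: nrmD_lt => //.
  by apply: NH' => // l lN; apply: H; rewrite leq_max lN orbT.
by apply: NH => // l lN; apply: H; rewrite leq_max lN.
Qed.

Lemma continuous0_vsum (T : nat -> A) v : null v ->
  continuous0 (fun mu => vsum (fun i => kC (mu (T i)) *: v i)).
Proof.
move=> nv e e0; have e20 : 0 < e / 2 by rewrite divr_gt0.
have [N NH] := nv _ e20; have [M MH] := vanish_on T N.
exists M => mu lmu /(MH _ lmu) H.
have e2e : e / 2 < e by rewrite ltr_pdivrMr // ltr_pMr // ltr1n.
apply: le_lt_trans e2e; apply: vsum_le => //; first exact: nullZ.
move=> i; have [iN|Ni] := ltnP i N; first by rewrite H // rmorph0 scale0r nrm0 // ltW.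
by apply: nrmZ_le => //; apply: ltW; exact: NH.
Qed.

(** [G] takes arbitrary functions as arguments; its values off the linear functionals are
    unconstrained, which is why every law carries [klinear]. *)
Definition is_sfn (G : (A -> k) -> V) :=
  [/\ forall mu nu, klinear mu -> klinear nu -> G (fun x => mu x + nu x) = G mu + G nu,
      forall a mu, klinear mu -> G (fun x => mu (a * x)) = act a (G mu)
    & continuous0 G].

Section Sfn.
Variable G : (A -> k) -> V.
Hypothesis sG : is_sfn G.

Lemma sfnD mu nu : klinear mu -> klinear nu -> G (fun x => mu x + nu x) = G mu + G nu.
Proof. by case: sG => + _ _; apply. Qed.
Lemma sfnM a mu : klinear mu -> G (fun x => mu (a * x)) = act a (G mu).
Proof. by case: sG => _ + _; apply. Qed.
Lemma sfnZ c mu : klinear mu -> G (fun x => c * mu x) = kC c *: G mu.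
Proof.
move=> lmu; rewrite -act_const -sfnM //; congr G.
by apply: functional_extensionality_dep => x; rewrite (proj2 lmu).
Qed.
Lemma sfnB mu nu : klinear mu -> klinear nu -> G (fun x => mu x - nu x) = G mu - G nu.
Proof.
move=> lmu lnu; have lN := klinearZ (-1) lnu.
rewrite -[RHS](_ : G mu + kC (-1) *: G nu = _); last by rewrite rmorphN rmorph1 scaleN1r.
rewrite -sfnZ // -sfnD //; congr G.
by apply: functional_extensionality_dep => x; rewrite mulN1r.
Qed.
Lemma klinear_zero : klinear (fun=> 0).
Proof. by split=> [x y|c x]; rewrite ?addr0 ?mulr0. Qed.
Lemma sfn0 : G (fun=> 0) = 0.
Proof.
rewrite -[RHS](subrr (G (fun=> 0))) -sfnB; try exact: klinear_zero.
by congr G; apply: functional_extensionality_dep => x; rewrite subr0.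
Qed.

Definition truncation (mu : A -> k) n : A -> k := fun x => \sum_(i < n) mu (b i) * coordf i x.

Lemma truncation_klinear mu n : klinear (truncation mu n).
Proof.
split=> [x y|c x]; rewrite /truncation.
  by rewrite -big_split; apply: eq_bigr => i _; rewrite (proj1 (coordf_klinear i)) mulrDr.
by rewrite mulr_sumr; apply: eq_bigr => i _; rewrite (proj2 (coordf_klinear i)) mulrCA.
Qed.

Lemma sfn_truncation mu n :
  G (truncation mu n) = \sum_(i < n) kC (mu (b i)) *: G (coordf i).
Proof.
elim: n => [|n IHn].
  rewrite big_ord0 -[RHS]sfn0; congr G.
  by apply: functional_extensionality_dep => x; rewrite /truncation big_ord0.
rewrite big_ord_recr /= -IHn -sfnZ; last exact: coordf_klinear.
rewrite -sfnD; [|exact: truncation_klinear|exact/klinearZ/coordf_klinear].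
by congr G; apply: functional_extensionality_dep => x; rewrite /truncation big_ord_recr.
Qed.

(** mu minus its n-th truncation vanishes on b_0, ..., b_(n-1), so continuity at 0 gives the
    convergence. *)
Lemma sfn_series mu : klinear mu ->
  vcvg abs (fun n => \sum_(i < n) kC (mu (b i)) *: G (coordf i)) (G mu).
Proof.
move=> lmu; apply/vcvgP => e e0; case: sG => _ _ /(_ e e0)[N NH].
exists N => n Nn; rewrite -sfn_truncation -sfnB //; last exact: truncation_klinear.
apply: NH; first by apply: klinearB => //; exact: truncation_klinear.
move=> i iN; rewrite /truncation (bigD1 (Ordinal (leq_trans iN Nn))) //= coordf_b eqxx mulr1.
rewrite big1 ?addr0 ?subrr // => l /eqP li.
rewrite coordf_b; case: eqP => [E|]; last by rewrite mulr0.
by case: li; apply: val_inj.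
Qed.

Lemma sfn_null : null (fun i => G (coordf i)).
Proof.
move=> e e0; case: sG => _ _ /(_ e e0)[N NH]; exists N => n Nn.
apply: NH => [|i iN]; first exact: coordf_klinear.
by rewrite coordf_b ltn_eqF // (leq_trans iN).
Qed.
End Sfn.

Definition sfp (e : nat -> V) := null e /\ forall a m,
  vcvg abs (fun n => \sum_(i < n) kC (coordf m (a * b i)) *: e i) (act a (e m)).

Definition pairing (e : nat -> V) (mu : A -> k) : V := vsum (fun i => kC (mu (b i)) *: e i).

Let nullk (e : nat -> V) mu : null e -> null (fun i => kC (mu (b i)) *: e i).
Proof. by move=> ne; apply: nullZ. Qed.

Lemma pairing_add (e : nat -> V) mu nu : null e ->
  pairing e (fun x => mu x + nu x) = pairing e mu + pairing e nu.
Proof.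
move=> ne; rewrite /pairing -vsumD //; try exact: nullk.
by apply: eq_vsum => i; rewrite rmorphD scalerDl.
Qed.

Lemma pairing_coordf (e : nat -> V) m : null e -> pairing e (coordf m) = e m.
Proof.
move=> ne; rewrite /pairing (@vsum_fin _ _ _ Habs _ Hcomplete _ m.+1).
  rewrite big_ord_recr /= coordf_b eqxx rmorph1 scale1r big1 ?add0r // => i _.
  by rewrite coordf_b (ltn_eqF (ltn_ord i)) rmorph0 scale0r.
by move=> i mi; rewrite coordf_b (gtn_eqF mi) rmorph0 scale0r.
Qed.

Lemma pairing_continuous0 (e : nat -> V) : null e -> continuous0 (pairing e).
Proof. exact: continuous0_vsum. Qed.

(** At a coordinate functional, A-linearity is the defining equation of a special function. It
    passes to truncations by linearity and to all functionals by continuity. *)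
Lemma pairing_sfn e : sfp e -> is_sfn (pairing e).
Proof.
move=> [ne He]; split; last exact: pairing_continuous0.
  by move=> mu nu _ _; exact: pairing_add.
move=> a mu lmu.
have pZ c nu : pairing e (fun x => c * nu x) = kC c *: pairing e nu.
  rewrite /pairing -vsumZ //; last exact: nullk.
  by apply: eq_vsum => i; rewrite rmorphM scalerA.
have pB nu nu' : pairing e (fun x => nu x - nu' x) = pairing e nu - pairing e nu'.
  have -> : (fun x => nu x - nu' x) = (fun x => nu x + (-1) * nu' x).
    by apply: functional_extensionality_dep => x; rewrite mulN1r.
  by rewrite pairing_add // pZ rmorphN rmorph1 scaleN1r.
have pT nu n : pairing e (fun x => truncation nu n (a * x)) = act a (pairing e (truncation nu n)).
  elim: n => [|n IHn].
    have -> : (fun x => truncation nu 0 (a * x)) = (fun=> 0).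
      by apply: functional_extensionality_dep => x; rewrite /truncation big_ord0.
    have -> : truncation nu 0 = (fun=> 0).
      by apply: functional_extensionality_dep => x; rewrite /truncation big_ord0.
    have -> : pairing e (fun=> 0) = 0.
      have -> : (fun=> 0) = (fun x : A => 0 * (0 : k)).
        by apply: functional_extensionality_dep => x; rewrite mul0r.
      by rewrite (pZ 0 (fun=> 0)) rmorph0 scale0r.
    by rewrite act0.
  have -> : truncation nu n.+1 = (fun x => truncation nu n x + nu (b n) * coordf n x).
    by apply: functional_extensionality_dep => x; rewrite /truncation big_ord_recr.
  rewrite (pairing_add (fun x => truncation nu n (a * x)) (fun x => nu (b n) * coordf n (a * x))) //.
  rewrite pairing_add // actD IHn (pZ _ (fun x => coordf n (a * x))) pZ actZ pairing_coordf //.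
  by congr (_ + _ *: _); rewrite /pairing;
    apply: (vsum_unique Habs Hcomplete) => //; exact: (nullk (fun x => coordf n (a * x))).
have small_diff nu : klinear nu -> forall eps, 0 < eps -> exists N, forall n, (N <= n)%N ->
    nrm (pairing e (fun x => nu (a * x) - truncation nu n (a * x))) < eps /\
    nrm (act a (pairing e (fun x => nu x - truncation nu n x))) < eps.
  move=> lnu eps eps0.
  have [N NH] := continuous0_comp (mul_additive_const a) (pairing_continuous0 ne) eps0.
  have [M MH] := continuous0_act a (pairing_continuous0 ne) eps0.
  exists (maxn N M) => n; rewrite geq_max => /andP[Nn Mn].
  have lB := klinearB lnu (truncation_klinear nu n).
  have v0 i : (i < n)%N -> nu (b i) - truncation nu n (b i) = 0.
    move=> i_n; rewrite /truncation (bigD1 (Ordinal i_n)) //= coordf_b eqxx mulr1.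
    rewrite big1 ?addr0 ?subrr // => l /eqP li.
    rewrite coordf_b; case: eqP => [E|]; last by rewrite mulr0.
    by case: li; apply: val_inj.
  split; [apply: (NH _ lB) | apply: (MH _ lB)] => i iN; apply: v0; exact: leq_trans iN _.
apply/eqP; rewrite -subr_eq0; apply/eqP; apply: (nrm_lt_eq0 Habs) => eps eps0.
have [N /(_ N (leqnn N))[]] := small_diff _ lmu _ eps0.
rewrite (pB (fun x => mu (a * x)) (fun x => truncation mu N (a * x))) pB actD actN pT => H1 H2.
have -> : pairing e (fun x => mu (a * x)) - act a (pairing e mu) =
  (pairing e (fun x => mu (a * x)) - act a (pairing e (truncation mu N))) +
  - (act a (pairing e mu) - act a (pairing e (truncation mu N))).
  by rewrite opprB addrA subrK.
by apply: nrmD_lt => //; rewrite nrmN.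
Qed.

(** The converse of [pairing_sfn]: from here on special functions can be constructed as maps on
    functionals. *)
Lemma sfn_sfp G : is_sfn G -> sfp (fun i => G (coordf i)) /\
  forall mu, klinear mu -> pairing (fun i => G (coordf i)) mu = G mu.
Proof.
move=> sG; have nG := sfn_null sG; split.
  split=> // a m; rewrite -(sfnM sG); last exact: coordf_klinear.
  by apply: (sfn_series sG); apply: klinearM; exact: coordf_klinear.
move=> mu lmu; rewrite /pairing; apply: (vsum_unique Habs Hcomplete) => //; first exact: nullk.
exact: sfn_series.
Qed.

Lemma sfnD_sfn G G' : is_sfn G -> is_sfn G' -> is_sfn (fun mu => G mu + G' mu).
Proof.
move=> [GD GM Gc] [GD' GM' Gc']; split.
- by move=> mu nu lmu lnu; rewrite GD // GD' // addrACA.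
- by move=> a mu lmu; rewrite GM // GM' // actD.
move=> e e0; have [N NH] := Gc e e0; have [N' NH'] := Gc' e e0.
exists (maxn N N') => mu lmu H; apply: nrmD_lt => //.
  by apply: NH => // l lN; apply: H; rewrite leq_max lN.
by apply: NH' => // l lN; apply: H; rewrite leq_max lN orbT.
Qed.

Lemma sfn_act a G : is_sfn G -> is_sfn (fun mu => act a (G mu)).
Proof.
move=> [GD GM Gc]; split; last exact: continuous0_act.
- by move=> mu nu lmu lnu; rewrite GD // actD.
- by move=> a' mu lmu; rewrite GM // actC.
Qed.

Lemma sfp_pairing_eq (e : nat -> V) G : null e -> is_sfn G -> (forall i, G (coordf i) = e i) -> sfp e.
Proof.
move=> ne sG E; have -> : e = fun i => G (coordf i).
  by apply: functional_extensionality_dep => i; rewrite E.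
by case: (sfn_sfp sG).
Qed.

Lemma sfp_add e e' : sfp e -> sfp e' -> sfp (fun i => e i + e' i).
Proof.
move=> se se'; apply: (sfp_pairing_eq _ (sfnD_sfn (pairing_sfn se) (pairing_sfn se'))).
  by apply: nullD => //; [case: se | case: se'].
by move=> i; rewrite !pairing_coordf //; [case: se' | case: se].
Qed.

Lemma sfp_act a e : sfp e -> sfp (fun i => act a (e i)).
Proof.
move=> se; apply: (sfp_pairing_eq _ (sfn_act a (pairing_sfn se))).
  by apply: act_null; case: se.
by move=> i; rewrite pairing_coordf //; case: se.
Qed.

Lemma pairing_addl e e' mu : sfp e -> sfp e' ->
  pairing (fun i => e i + e' i) mu = pairing e mu + pairing e' mu.
Proof.
move=> [ne _] [ne' _]; rewrite /pairing -vsumD //; try exact: nullk.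
by apply: eq_vsum => i; rewrite scalerDr.
Qed.

Lemma pairing_actl a e mu : sfp e -> pairing (fun i => act a (e i)) mu = act a (pairing e mu).
Proof.
move=> [ne _]; rewrite /pairing act_vsum; last exact: nullk.
by apply: eq_vsum => i; rewrite actZ.
Qed.

Lemma sfp_zero : sfp (fun=> 0).
Proof.
split=> [e e0|a m]; first by exists 0%N => n _; rewrite nrm0.
rewrite act0; apply/vcvgP => e e0; exists 0%N => n _.
by rewrite big1 ?subr0 ?nrm0 // => i _; rewrite scaler0.
Qed.

(* The functionals nu with nu(g A) = 0 are those on A/gA. *)
Lemma sfp_divide (g s : A) e : sfp e ->
  (exists rho : A -> A, additive_const rho /\ forall x, rho (g * x) = x) ->
  (forall nu, klinear nu -> (forall x, nu (g * x) = 0) -> pairing e (fun x => nu (s * x)) = 0) ->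
  exists e', [/\ sfp e',
    forall mu, klinear mu -> pairing e' (fun x => mu (g * x)) = act s (pairing e mu)
    & forall i, act g (e' i) = act s (e i)].
Proof.
move=> se [rho [lrho rhoK]] Hker.
have sG := pairing_sfn se.
(* Precomposition with [rho] divides functionals by g. [rho] need not be A-linear, but the defect
   kills gA, so [Hker] makes it disappear after multiplication by s. *)
pose G mu := pairing e (fun x => mu (rho (s * x))).
have lcomp mu : klinear mu -> klinear (fun x => mu (rho (s * x))).
  move=> lmu; exact/(klinearM s (mu := fun x => mu (rho x)))/klinear_comp.
have keq mu nu : klinear mu -> klinear nu -> (forall x, mu (g * x) = nu (g * x)) ->
    pairing e (fun x => mu (s * x)) = pairing e (fun x => nu (s * x)).
  move=> lmu lnu E; apply/eqP; rewrite -subr_eq0 -(sfnB sG); try exact: klinearM.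
  apply/eqP; apply: (Hker (fun x => mu x - nu x)); first exact: klinearB.
  by move=> x; rewrite E subrr.
have sG' : is_sfn G.
  split.
  - by move=> mu nu lmu lnu; rewrite /G (sfnD sG) //; exact: lcomp.
  - move=> a mu lmu; rewrite /G -(sfnM sG); last exact: lcomp.
    have -> : (fun x => mu (rho (s * (a * x)))) = (fun x => mu (rho (a * (s * x)))).
      by apply: functional_extensionality_dep => x; rewrite mulrCA.
    apply: (keq (fun x => mu (a * rho x)) (fun x => mu (rho (a * x)))).
    + exact: (klinear_comp lrho (klinearM a lmu)).
    + exact/(klinearM a (mu := fun x => mu (rho x)))/klinear_comp.
    + by move=> x; rewrite mulrCA !rhoK.
  - apply: (@continuous0_comp (pairing e) (fun x => rho (s * x))).
      case: lrho => rD rZ; split=> [x y|c x]; first by rewrite mulrDr rD.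
      by rewrite mulrCA rZ.
    by apply: pairing_continuous0; case: se.
have [se' E'] := sfn_sfp sG'.
have HE mu : klinear mu -> pairing (fun i => G (coordf i)) (fun x => mu (g * x)) = act s (pairing e mu).
  move=> lmu; rewrite E'; last exact: klinearM.
  rewrite -(sfnM sG) // /G; apply: (keq (fun x => mu (g * rho x)) mu) => //.
    exact: (klinear_comp lrho (klinearM g lmu)).
  by move=> x; rewrite rhoK.
exists (fun i => G (coordf i)); split=> // i.
have lc := coordf_klinear i.
have := HE _ lc; rewrite (sfnM (pairing_sfn se')) // pairing_coordf; last by case: se'.
by rewrite pairing_coordf //; case: se.
Qed.

(** * Surjectivity of the evaluation maps *)

Section Construction.
Variable Y : nat -> V.
Hypothesis nY : null Y.
Hypothesis YS : forall i, act unif (Y i.+1) = Y i.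
Hypothesis Y0 : act unif (Y 0%N) = 0.
Variable delta : seq (A * A).
Variables (s : nat) (x : nat -> A).
Hypothesis x_gen : forall a, exists (g : {poly k}) (c : nat -> {poly k}), g != 0 /\
    ev_unif g * a = \sum_(l < s) ev_unif (c l) * x l.
Hypothesis x_delta : forall l, (l < s)%N -> diagonal_for (x l) delta.

(* The k[pi]-linear extension to k[pi]^* of the tower [Y] over its first term. *)
Definition tower_pairing (mu : A -> k) : V := vsum (fun i => kC (mu (unif ^+ i)) *: Y i).

Let nullY (c : nat -> k) : null (fun i => kC (c i) *: Y i).
Proof. by apply: nullZ => // i; exact: absk. Qed.

Lemma tower_pairingD mu nu :
  tower_pairing (fun z => mu z + nu z) = tower_pairing mu + tower_pairing nu.
Proof.
rewrite /tower_pairing -vsumD //.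
by apply: eq_vsum => i; rewrite rmorphD scalerDl.
Qed.

Lemma tower_pairingZ c mu : tower_pairing (fun z => c * mu z) = kC c *: tower_pairing mu.
Proof.
rewrite /tower_pairing -vsumZ ?absk //.
by apply: eq_vsum => i; rewrite rmorphM scalerA.
Qed.

(** Acting by pi shifts the tower, and the term pushed out is pi Y_0 = 0. *)
Lemma tower_pairing_unif mu :
  tower_pairing (fun z => mu (unif * z)) = act unif (tower_pairing mu).
Proof.
have nm := nullY (fun i => mu (unif ^+ i)).
rewrite [in RHS]/tower_pairing act_vsum //.
rewrite [RHS]vsum_shift //; last exact: act_null.
rewrite actZ Y0 scaler0 add0r; apply: eq_vsum => i.
by rewrite actZ YS -exprS.
Qed.

(** The value at [delta] of the balanced map (a, a') -> a' tower(mu(a .)). Annihilation by the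
    diagonal ideal is what turns k[pi]-linearity into A-linearity. *)
Definition diagonal_sfn (mu : A -> k) : V :=
  \sum_(u <- delta) act u.2 (tower_pairing (fun z => mu (u.1 * z))).

Lemma tower_balanced mu : klinear mu ->
  unif_balanced (fun a a' => act a' (tower_pairing (fun z => mu (a * z)))).
Proof.
move=> lmu; split.
- move=> a a' c; rewrite -actD -tower_pairingD; congr (act c (tower_pairing _)).
  by apply: functional_extensionality_dep => z; rewrite mulrDl (proj1 lmu).
- by move=> a c c'; rewrite act_addl.
- move=> c a a'; rewrite [kA c * a']mulrC actM act_const -tower_pairingZ; congr (act a' (tower_pairing _)).
  by apply: functional_extensionality_dep => z; rewrite -mulrA (proj2 lmu).
- move=> a a'; rewrite [unif * a']mulrC actM -tower_pairing_unif; congr (act a' (tower_pairing _)).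
  by apply: functional_extensionality_dep => z; rewrite mulrCA mulrA.
Qed.

(** Linearity is clear over k[pi] and holds for the x_l. For general a, write g a = sum c_l x_l with
    g, c_l in k[pi], and mu = mu'(g .); then mu(a .) = mu'(g a .) reduces to these cases. *)
Lemma diagonal_sfn_sfn : is_sfn diagonal_sfn.
Proof.
have GD mu nu : diagonal_sfn (fun z => mu z + nu z) = diagonal_sfn mu + diagonal_sfn nu.
  by rewrite /diagonal_sfn -big_split; apply: eq_bigr => u _; rewrite /= -actD -tower_pairingD.
have G0 : diagonal_sfn (fun=> 0) = 0.
  have E : (fun _ : A => 0 + 0 : k) = (fun=> 0) by rewrite addr0.
  have := GD (fun=> 0) (fun=> 0); rewrite E => H.
  by apply: (@addrI _ (diagonal_sfn (fun=> 0))); rewrite addr0 -H.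
have GC mu c u : klinear mu -> act u.2 (tower_pairing (fun z => mu (ev_unif c * (u.1 * z))))
   = act (ev_unif c * u.2) (tower_pairing (fun z => mu (u.1 * z))).
  move=> lmu; have := unif_balanced_ev c u.1 u.2 (tower_balanced lmu).
  move=> <-; congr (act _ (tower_pairing _)).
  by apply: functional_extensionality_dep => z; rewrite mulrA.
have Gev c mu : klinear mu -> diagonal_sfn (fun z => mu (ev_unif c * z)) = act (ev_unif c) (diagonal_sfn mu).
  move=> lmu; rewrite /diagonal_sfn act_sum; apply: eq_bigr => u _.
  by rewrite GC // actM.
have Gx l mu : (l < s)%N -> klinear mu -> diagonal_sfn (fun z => mu (x l * z)) = act (x l) (diagonal_sfn mu).
  move=> ls lmu; rewrite /diagonal_sfn act_sum.
  have := x_delta ls (tower_balanced lmu); rewrite /= => E.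
  apply: etrans (etrans E _).
    apply: eq_bigr => u _; congr (act _ (tower_pairing _)).
    by apply: functional_extensionality_dep => z; rewrite mulrA.
  by apply: eq_bigr => u _; rewrite actM.
split.
- by move=> mu nu _ _; exact: GD.
- move=> a mu lmu; have [g [c [g0 gE]]] := x_gen a.
  have evg0 : ev_unif g != 0.
    by apply: contraNneq g0 => /ev_unif_inj/eqP.
  have [rho [rD rZ rK]] := linear_retraction evg0.
  pose mu' z := mu (rho z).
  have lmu' : klinear mu' by apply: (klinear_comp (T := rho)).
  have mu'E z : mu' (ev_unif g * z) = mu z by rewrite /mu' rK.
  have -> : (fun z => mu (a * z)) = (fun z => mu' ((ev_unif g * a) * z)).
    by apply: functional_extensionality_dep => z; rewrite -mulrA mu'E.
  have -> : diagonal_sfn mu = act (ev_unif g) (diagonal_sfn mu').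
    by rewrite -Gev //; congr diagonal_sfn; apply: functional_extensionality_dep => z; rewrite mu'E.
  rewrite -actM [a * _]mulrC gE act_suml.
  elim: (s) (Gx) => [|s' IH] Gx'.
    rewrite !big_ord0 -[RHS]G0; congr diagonal_sfn.
    by apply: functional_extensionality_dep => z; rewrite mul0r (klinear0 lmu').
  rewrite [RHS]big_ord_recr /= -IH; last by move=> l nu ls'; apply: Gx'; exact: leqW.
  have -> : act (ev_unif (c s') * x s') (diagonal_sfn mu') =
      diagonal_sfn (fun z => mu' (ev_unif (c s') * x s' * z)).
    rewrite [in LHS]mulrC actM -Gev // -Gx' //; last exact: klinearM.
    by congr diagonal_sfn; apply: functional_extensionality_dep => z; rewrite mulrA.
  rewrite -GD; congr diagonal_sfn; apply: functional_extensionality_dep => z.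
  by rewrite big_ord_recr /= mulrDl (proj1 lmu').
- apply: continuous0_sum => // u.
  apply: continuous0_act.
  apply: (continuous0_comp (G := tower_pairing) (T := fun z => u.1 * z)).
    exact: mul_additive_const.
  exact: (continuous0_vsum (fun i => unif ^+ i)).
Qed.

End Construction.

Lemma trace_functional_klinear n : klinear (dpi_trace n).
Proof.
by split=> [x y|c x]; rewrite /dpi_trace ?thetaD ?field_traceD // thetaZ field_traceZ.
Qed.

Lemma dpi_trace_vanish n x : prime_pow p n.+1 x -> dpi_trace n x = 0.
Proof.
move=> /prime_powP[z zE].
have [|z' E] := @hyper_mulX _ _ _ _ hdpi w n.+1 1 n z; first by rewrite add1n.
rewrite /dpi_trace /theta zE E expr1 rmorphM res_unif mul0r.
by rewrite -(scale0r 0) field_traceZ mul0r.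
Qed.

(** With e the order of D at p, the construction runs at level n' = n + e on a multiple of y/D and
    is divided by pi^e at the end. The factor s outside p absorbs what happens at the other zeros of
    D and pi. *)
Lemma sfp_surj_up_to_unit n (y : V) (tau : A -> k) (v : Fp) :
  (forall a, prime_pow p n.+1 a -> act a y = 0) ->
  klinear tau -> v != 0 -> (forall x, prime_pow p n.+1 x -> tau x = 0) ->
  (forall x, tau (unif ^+ n * x) = field_trace (v * res (j x))) ->
  exists s e c, [/\ s \notin p, sfp e & act s y = act c (pairing e tau)].
Proof.
move=> Hy ltau v0 tau0 taun.
have [sg [xg xgE]] := independent_generators.
have [xs xsE] := frobenius_witnesses.
have [delta [Hdelta D0]] := diagonal_exists ([seq xg l | l <- iota 0 sg] ++ xs).
set D := \sum_(u <- delta) _ in D0.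
have jD0 : j D != 0 by apply: contraNneq D0 => H; apply/eqP/j_inj; rewrite rmorph0.
have [e [u [uU jD]]] := valuation jD0.
have [a [s0 [ps0 uE]]] := j_frac u.
have pa : a \notin p.
  apply/notin_p; have := res_unit uU.
  by rewrite uE rmorphM; apply: contraNneq => ->; rewrite mul0r.
have DE : D * s0 = unif ^+ e * a.
  by apply: j_inj; rewrite !rmorphM rmorphXn jD uE -mulrA divrK ?j_unit.
pose n' := (n + e)%N.
have [s [ps sE]] := prime_pow_sub_unif n'.+1.
have [y' y'E] := act_surj y D0.
(* D s0 = pi^e a, and s maps p^(n'+1) into pi^(n'+1) A; hence this multiple of y/D lies in
   E[p^(n'+1)]. *)
pose y2 := act (s * a) y'.
have y2_tors x : prime_pow p n'.+1 x -> act x y2 = 0.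
  move=> /sE[x' x'E]; rewrite -actM.
  have -> : x * (s * a) = (x' * s0) * (unif ^+ n.+1 * D).
    transitivity (s * x * a); first by ring.
    rewrite x'E /n' -addSn exprD.
    transitivity (unif ^+ n.+1 * (D * s0) * x'); first by rewrite DE; ring.
    by ring.
  by rewrite actM [X in act _ X]actM y'E Hy ?act0 //; exact/prime_powX/unif_in_p.
have Dy2 : act D y2 = act (s * a) y by rewrite /y2 actC y'E.
have [Z [Z0 ZS nZ]] := act_tower y2.
(* The division tower of y2, placed at index n' and continued down by powers of pi, so that pi Y_0 =
   pi^(n'+1) y2 = 0. *)
pose Y i := if (i <= n')%N then act (unif ^+ (n' - i)) y2 else Z (i - n')%N.
have YS i : act unif (Y i.+1) = Y i.
  rewrite /Y; case: (ltngtP i n') => [i_n|n_i|->].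
  - by rewrite -actM -exprS; congr (act (_ ^+ _) _); lia.
  - by rewrite subSn ?ZS // ltnW.
  - by rewrite subSnn ZS Z0 subnn act1.
have Y0 : act unif (Y 0%N) = 0.
  by rewrite /Y leq0n subn0 -actM -exprS y2_tors //; exact/prime_powX/unif_in_p.
have nY : null Y.
  move=> eps /nZ[N NH]; exists (N + n').+1 => i Ni; rewrite /Y ifF; last by lia.
  by apply: NH; lia.
have x_delta l : (l < sg)%N -> diagonal_for (xg l) delta.
  by move=> ls; apply: Hdelta; rewrite mem_cat map_f // mem_iota.
pose G := diagonal_sfn Y delta.
have sG : is_sfn G by exact: (diagonal_sfn_sfn nY YS Y0 xgE x_delta).
(* [dpi_trace n'] meets only the terms i <= n' of the tower; together they act on y2 by the
   contraction, which is D modulo p^(n'+1). *)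
have Gtau : G (dpi_trace n') = act (s * a) y.
  have Hxs sx : (0 < sx < \dim {:Fp})%N -> exists2 x, x \in xs & res (j x) ^+ (#|k| ^ sx) != res (j x).
    exact: xsE.
  have Hd x : x \in xs -> diagonal_for x delta.
    by move=> xxs; apply: Hdelta; rewrite mem_cat xxs orbT.
  have := trace_contraction Hxs Hd n'; rewrite -/D; set w1 := \sum_(u <- delta) _ => /y2_tors.
  rewrite act_addl -[- D]mulN1r actM Dy2 => w1E.
  have {w1E} w1E : act w1 y2 = act (s * a) y.
    apply/eqP; rewrite -subr_eq0 -w1E; apply/eqP; congr (_ + _).
    by rewrite -(rmorphN1 kA) act_const rmorphN1 scaleN1r.
  rewrite -w1E /w1 act_suml; apply: eq_bigr => u' _; rewrite actM; congr (act _ _).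
  rewrite /tower_pairing (@vsum_fin _ _ _ Habs _ Hcomplete _ n'.+1) => [|i ni]; last first.
    by rewrite /dpi_trace mulrC theta_unifX leqNgt ni /= -(scale0r 0) field_traceZ mul0r rmorph0 scale0r.
  rewrite act_suml; apply: eq_bigr => i _.
  by rewrite actM act_const /Y -ltnS ltn_ord mulrC.
have [se1 E1] := sfn_sfp sG.
have [s2 [ps2 s2E]] := prime_pow_sub_unif e.
have [rho [rD rZ rK]] := linear_retraction (expf_neq0 e unif_neq0).
have lt' := trace_functional_klinear n'.
have [||e2 [se2 pe2 _]] := sfp_divide (g := unif ^+ e) (s := s2) se1.
- by exists rho.
- move=> nu lnu nu0; rewrite E1; last exact: klinearM.
  have nu0' x : prime_pow p e x -> nu (s2 * x) = 0 by move=> /s2E[x' ->].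
  have nu1 x : prime_pow p e x -> nu (s2 * x) = 0 := nu0' x.
  (* A functional on A/p^e is a multiple of pi^(n+1) times the generator at level n'. [G] sends that
     generator to s a y, which pi^(n+1) kills. *)
  have [c cE] : exists c, forall x, nu (s2 * x) = dpi_trace n' (unif ^+ n.+1 * (c * x)).
    case: (posnP e) => [e0|e0].
      by exists 0 => x; rewrite mul0r mulr0 (klinear0 lt') nu1 // e0.
    have eE : e = e.-1.+1 by rewrite prednK.
    have lt1 : klinear (fun x => dpi_trace n' (unif ^+ n.+1 * x)) by exact: klinearM.
    apply: (functional_generator (n := e.-1) lt1 (oner_neq0 Fp)) => [x|x||x].
    - rewrite -eE => px; apply: dpi_trace_vanish; apply/prime_powP.
      have /prime_powP[z zE] := px; exists z.
      by rewrite rmorphM rmorphXn zE mulrA -exprD; congr (_ ^+ _ * _); rewrite /n'; lia.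
    - have -> : unif ^+ n.+1 * (unif ^+ e.-1 * x) = unif ^+ n' * x.
        by rewrite mulrA -exprD; congr (_ ^+ _ * _); rewrite /n'; lia.
      by rewrite /dpi_trace theta_unifX leqnn subnn theta0 mul1r.
    - exact: klinearM.
    - by rewrite -eE; exact: nu1.
  have -> : (fun x => nu (s2 * x)) = (fun x => dpi_trace n' (unif ^+ n.+1 * c * x)).
    by apply: functional_extensionality_dep => x; rewrite cE mulrA.
  rewrite (sfnM sG) // Gtau -actM.
  have -> : unif ^+ n.+1 * c * (s * a) = (c * (s * a)) * unif ^+ n.+1 by ring.
  by rewrite actM Hy ?act0 //; exact/prime_powX/unif_in_p.
(* Return from level n' to level n: pi^e times the generator at level n' kills p^(n+1), hence is a
   multiple of tau. *)
have [c cE] : exists c, forall x, dpi_trace n' (unif ^+ e * x) = tau (c * x).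
  apply: (functional_generator ltau v0 tau0 taun); first exact: klinearM.
  move=> x px; apply: dpi_trace_vanish; apply/prime_powP.
  have /prime_powP[z zE] := px; exists z.
  by rewrite rmorphM rmorphXn zE mulrA -exprD; congr (_ ^+ _ * _); rewrite /n'; lia.
exists (s2 * (s * a)), e2, c; split=> //.
  by rewrite !prime_idealrM !negb_or ps2 ps pa.
rewrite actM -Gtau -(E1 _ lt') -pe2 //.
have -> : (fun x => dpi_trace n' (unif ^+ e * x)) = (fun x => tau (c * x)).
  by apply: functional_extensionality_dep => x; rewrite cE.
by rewrite (sfnM (pairing_sfn se2)).
Qed.

(** * Evaluation at p *)

Lemma sf_sfp (e : nat -> V) : sf #|k| kC b bc phi abs e <-> sfp e.
Proof. by split=> -[/nullP ne He]; split=> //; exact/nullP. Qed.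

Definition functional (Lam : Ap -> k) :=
  {morph Lam : x y / x + y} /\ forall c x, Lam (j (kA c) * x) = c * Lam x.

Definition contract (Lam : Ap -> k) (s : seq (Ap * V)) : V :=
  \sum_(u <- s) kC (Lam u.1) *: u.2.

Lemma contract_level_eq Lam n s s' : functional Lam ->
  (forall x, local_pow p j n x -> Lam x = 0) ->
  level_eq p j (j \o kA) kC n s s' -> contract Lam s = contract Lam s'.
Proof.
move=> [LD LZ] L0 /(_ _ (fun x (v : V) => kC (Lam x) *: v)) H; apply: H; split.
- by move=> x y v _; rewrite LD rmorphD scalerDl.
- by move=> x v v' _ _; rewrite scalerDr.
- by move=> c x v _; rewrite /= LZ rmorphM scalerA mulrC.
- by move=> x v /L0 -> _; rewrite rmorph0 scale0r.
Qed.

(** On [Hhat] the action of phi_a is multiplication by a on the first factor, so phi_a(Lam(h)) =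
    Lam(a h), which is 0 for a in p^m. *)
Lemma contract_torsion Lam m n g : (m <= n.+1)%N -> functional Lam ->
  (forall x, local_pow p j m x -> Lam x = 0) ->
  Hhat #|k| p j (j \o kA) kC phi g ->
  torsion #|k| phi (prime_pow p m) (contract Lam (g n)).
Proof.
move=> mn lL L0 [_ Hg] a /prime_powP[z az].
have L0' x : local_pow p j n.+1 x -> Lam x = 0.
  move=> /local_powP[y ->]; apply: L0; apply/local_powP.
  by exists (w ^+ (n.+1 - m) * y); rewrite mulrA -exprD subnKC.
have := contract_level_eq lL L0' (Hg a n).
rewrite /contract /phi_Ep /scale_Ep /tensor_map !big_map /= => E.
rewrite act_sum; under eq_bigr => u _ do rewrite actZ.
rewrite E big1 // => u _; rewrite L0 ?rmorph0 ?scale0r //.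
by apply/local_powP; exists (z * u.1); rewrite az mulrA.
Qed.

(** Expanding the first factors in a k-basis of Fp reduces membership to one contraction for each
    coordinate. *)
Lemma in_FpX_coord (X : set V) (s : seq (Fp * V)) :
  (forall i, X (\sum_(u <- s) kC (coord (vbasis {:Fp}) i u.1) *: u.2)) -> in_FpX kC X s.
Proof.
move=> HX; pose y i := \sum_(u <- s) kC (coord (vbasis {:Fp}) i u.1) *: u.2.
exists [seq ((vbasis {:Fp})`_(val i), y i) | i <- enum 'I_(\dim {:Fp})]; split.
  by elim: (enum _) => [|i l IHl] /=; [exact: List.Forall_nil | apply: List.Forall_cons => //; exact: HX].
move=> W f [fDl fDr fZ f0]; rewrite big_map big_enum /=.
have f0l (v : V) : f 0 v = 0 by apply: (@addrI _ (f 0 v)); rewrite -fDl // !addr0.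
have f0r x : f x 0 = 0 by apply: (@addrI _ (f x 0)); rewrite -fDr // !addr0.
under [RHS]eq_bigr => i _.
  rewrite /y (big_morph (f _) (fun v v' : V => fDr _ v v' Logic.I Logic.I) (f0r _)).
  over.
rewrite exchange_big /=; apply: eq_bigr => u _.
rewrite {1}(coord_basis (vbasisP _) (memvf u.1)).
rewrite (big_morph (fun x => f x u.2) (fun x x' => fDl x x' _ Logic.I) (f0l _)).
by apply: eq_bigr => i _; rewrite fZ.
Qed.

(** * Hyperderivatives d_t evaluated at p *)

Variable t : A.
Hypothesis Hdt : dpi 1%N (j t) \is a GRing.unit.
Variable dt : nat -> Ap -> Ap.
Hypothesis Hdt_ext : hyper_ext (j \o kA) (j t) dt.
Let hdt : is_hyperderivation (j \o kA) dt. Proof. by case: Hdt_ext. Qed.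

Lemma dt_vanish m n x : (n < m)%N -> local_pow p j m x -> res (dt n x) = 0.
Proof.
move=> nm /local_powP[z ->].
have [|z' ->] := @hyper_mulX _ _ _ _ hdt w m 1 n z; first by rewrite add1n.
by rewrite expr1 rmorphM res_unif mul0r.
Qed.

Section Coordinates.
Variable lam : Fp -> k.
Hypothesis lamD : {morph lam : x y / x + y}.
Hypothesis lamZ : forall c x, lam (c *: x) = c * lam x.

Lemma res_functional (D : Ap -> Ap) : {morph D : x y / x + y} ->
  (forall c x, D (j (kA c) * x) = j (kA c) * D x) -> functional (fun x => lam (res (D x))).
Proof.
move=> DD DZ; split=> [x y|c x]; first by rewrite DD rmorphD lamD.
by rewrite DZ rmorphM res_const mulr_algl lamZ.
Qed.

Lemma dt_functional n : functional (fun x => lam (res (dt n x))).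
Proof. by apply: res_functional; [exact: (hyperD hdt) | exact: (hyperZ hdt)]. Qed.

End Coordinates.

Lemma dt_evaluation_torsion g n : Hhat #|k| p j (j \o kA) kC phi g ->
  in_FpX kC (torsion #|k| phi (prime_pow p n.+1)) (eval_Ep res (hyper_Ep dt n g)) /\
  in_FpX kC (torsion #|k| phi (prime_pow p n))
    (tensor_sub (eval_Ep res (hyper_Ep dt n g))
       (eval_Ep res (scale_Ep ((dpi 1%N (j t))^-1 ^+ n) (hyper_Ep dpi n g)))).
Proof.
move=> Hg; split; apply: in_FpX_coord => i; set lam := coord _ i.
  rewrite /eval_Ep /hyper_Ep /tensor_map !big_map add0n /=.
  apply: (contract_torsion (Lam := fun x => lam (res (dt n x))) (leqnn _)) => //.
    by apply: dt_functional => [x y|c x]; rewrite /lam ?linearD ?linearZ.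
  by move=> x /(dt_vanish (ltnSn n)) ->; rewrite /lam linear0.
rewrite /tensor_sub /eval_Ep /scale_Ep /hyper_Ep /tensor_map big_cat !big_map add0n /=.
rewrite -big_split /=.
pose D x := dt n x - (dpi 1%N (j t))^-1 ^+ n * dpi n x.
rewrite (eq_bigr (fun u => kC (lam (res (D u.1))) *: u.2)); last first.
  by move=> u _; rewrite -scalerDl -rmorphD /lam -linearD -rmorphN -rmorphD.
apply: (contract_torsion (Lam := fun x => lam (res (D x))) (leqnSn _)) => //.
  apply: res_functional => [x y|c x|x y|c x]; rewrite /lam ?linearD ?linearZ //.
    by rewrite /D (hyperD hdt) (hyperD hdpi); ring.
  by rewrite /D (hyperZ hdt) (hyperZ hdpi); ring.
(* The leading term cancels; what is left combines the d_t^(a) with a < n, whose residues vanish on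
   p^n. *)
move=> x px; rewrite /D (dpi_expand Hdpi Hdt Hdt_ext n x) mulrDr mulrA -exprMn mulVr // expr1n mul1r.
rewrite opprD addrA subrr add0r rmorphN rmorphM rmorph_sum big1 ?mulr0 ?oppr0 /lam ?linear0 // => a _.
by rewrite rmorphM (dt_vanish (ltn_ord a) px) mulr0.
Qed.

Definition tau n a : k := field_trace (res (dt n (j a))).

Lemma tr_functional n : functional (fun x => field_trace (res (dt n x))).
Proof. by apply: (dt_functional (lam := @field_trace _ _)); [exact: field_traceD | exact: field_traceZ]. Qed.

Lemma field_trace0 : field_trace (0 : Fp) = 0.
Proof. by rewrite -(scale0r 0) field_traceZ mul0r. Qed.

Lemma tau_klinear n : klinear (tau n).
Proof.
have [TD TZ] := tr_functional n.
by split=> [x y|c x]; rewrite /tau ?rmorphD ?TD // rmorphM TZ.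
Qed.

Lemma tau_vanish n x : prime_pow p n.+1 x -> tau n x = 0.
Proof.
move=> px; rewrite /tau (dt_vanish (ltnSn n)) ?field_trace0 //.
by apply/local_powP; exact/prime_powP.
Qed.

Let v1 := res (dt 1%N w).
Let v1n0 : v1 != 0. Proof. by apply: res_unit; exact: (dt1_unif_unit Hdpi Hdt Hdt_ext). Qed.

(** The restriction to the socle p^n/p^(n+1); since [v1] is nonzero, [tau n] is a generator of the
    functionals. *)
Lemma tau_lead n x : tau n (unif ^+ n * x) = field_trace (v1 ^+ n * res (j x)).
Proof.
rewrite /tau rmorphM rmorphXn; have [z ->] := @hyper_mulX_lead _ _ _ _ hdt w n (j x).
by rewrite rmorphD !rmorphM res_unif mul0r addr0 rmorphXn.
Qed.

Lemma tau_generates n mu : klinear mu -> (forall x, prime_pow p n.+1 x -> mu x = 0) ->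
  exists c, forall x, mu x = tau n (c * x).
Proof.
apply: functional_generator; [exact: tau_klinear | exact: (expf_neq0 n v1n0) | |].
- exact: tau_vanish.
- exact: tau_lead.
Qed.

(** * From a local basis of special functions to a torsion basis *)

Variables (r : nat) (h : 'I_r -> nat -> V).
Hypothesis Hh : is_local_basis #|k| kC b bc phi abs j h.

Let sfh i : sfp (h i). Proof. by apply/sf_sfp; case: Hh. Qed.

(** [tau n] kills p^(n+1), so it may be applied to the approximations of [H n] by partial sums; the
    error stays small because constants have absolute value at most 1. *)
Lemma ET_image_pairing n (e : nat -> V) (H : nat -> seq (Ap * V)) : sfp e ->
  ET_image p j (j \o kA) kC b abs e H ->
  tr_id kC (eval_Ep res (hyper_Ep dt n H)) = pairing e (tau n).
Proof.
move=> se HH; have lT := tr_functional n.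
have -> : tr_id kC (eval_Ep res (hyper_Ep dt n H)) =
    contract (fun x => field_trace (res (dt n x))) (H n).
  by rewrite /tr_id /eval_Ep /hyper_Ep /tensor_map !big_map add0n.
apply/eqP; rewrite -subr_eq0; apply/eqP; apply: (nrm_lt_eq0 Habs) => eps eps0.
have ns : null (fun i => kC (tau n (b i)) *: e i).
  by apply: nullZ => //; case: se.
have /vcvgP/(_ eps eps0)[N NH] := vsum_cvg Habs Hcomplete ns.
have [N' NH'] := HH n eps eps0.
have [s [small]] := NH' _ (leq_maxr N N').
move=> /(contract_level_eq lT) ->; last first.
  by move=> x /(dt_vanish (ltnSn n)) ->; rewrite field_trace0.
have := NH _ (leq_maxl N N'); rewrite /contract big_cat big_map /=.
have -> : \sum_(i <- iota 0 (maxn N N')) kC (field_trace (res (dt n (j (b i))))) *: e i =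
    \sum_(i < maxn N N') kC (tau n (b i)) *: e i.
  by rewrite -(big_mkord xpredT (fun i => kC (tau n (b i)) *: e i)) /index_iota subn0.
rewrite addrAC => Hp1; apply: nrmD_lt => //.
elim: s small => [_|u s IHs /List.Forall_cons_iff[us ss]]; first by rewrite big_nil nrm0.
rewrite big_cons; apply: nrmD_lt => //; last exact: IHs.
exact: nrmZ_lt.
Qed.

Lemma pairing_zero (e : nat -> V) : null e -> pairing e (fun=> 0) = 0.
Proof.
move=> ne; rewrite /pairing (@vsum_fin _ _ _ Habs _ Hcomplete _ 0) ?big_ord0 // => i _.
by rewrite rmorph0 scale0r.
Qed.

(** The functional tau_n(x .) for x in A_(p). It extends e -> e(tau_n) to a balanced map on A_(p)
    (x)_A sf(E), where the basis hypothesis can be applied. *)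
Definition scaled_tau n (x : Ap) (a : A) : k := field_trace (res (dt n (x * j a))).

Lemma scaled_tau_balanced n :
  balanced (fun a x => j a * x) (fun a e i => act a (e i)) [set 0]
    (sf #|k| kC b bc phi abs) (fun x e => pairing e (scaled_tau n x)).
Proof.
have [TD TZ] := tr_functional n.
have lT x : klinear (scaled_tau n x).
  split=> [y z|c y]; rewrite /scaled_tau; first by rewrite rmorphD mulrDr TD.
  by rewrite rmorphM mulrCA TZ.
split.
- move=> x y e /sf_sfp se; rewrite -pairing_add //; last by case: se.
  by congr pairing; apply: functional_extensionality_dep => a; rewrite /scaled_tau mulrDl TD.
- move=> x e e' /sf_sfp se /sf_sfp se'; exact (pairing_addl (scaled_tau n x) se se').
- move=> a x e /sf_sfp se; rewrite (pairing_actl a _ se) -(sfnM (pairing_sfn se)) //.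
  by congr pairing; apply: functional_extensionality_dep => z; rewrite /scaled_tau rmorphM mulrCA mulrA.
- move=> x e -> /sf_sfp[ne _]; rewrite -[RHS](pairing_zero ne); congr pairing.
  apply: functional_extensionality_dep => z.
  by rewrite /scaled_tau mul0r (hyper0 hdt) rmorph0 field_trace0.
Qed.

(** Expand 1 (x) e in the local basis, apply the balanced map, and replace the coefficients by
    elements of [A] congruent modulo p^(n+1), which tau_n does not distinguish. *)
Lemma psi_span n e : sfp e -> exists a : 'I_r -> A,
  pairing e (tau n) = \sum_(i < r) act (a i) (pairing (h i) (tau n)).
Proof.
move=> se; case: Hh => _ /(_ [:: (1, e)])[|y [Hy _]].
  by apply: List.Forall_cons; [exact/sf_sfp | exact: List.Forall_nil].
have := Hy _ _ (scaled_tau_balanced n); rewrite big_seq1 big_map big_enum /=.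
have -> : scaled_tau n 1 = tau n.
  by apply: functional_extensionality_dep => a; rewrite /scaled_tau mul1r.
have [a aE] := choice (fun i => approx n.+1 (y i)).
move=> ->; exists a; apply: eq_bigr => i _.
rewrite -(sfnM (pairing_sfn (sfh i)) _ (tau_klinear n)); congr pairing.
apply: functional_extensionality_dep => x; have [z ->] := aE i.
have [TD _] := tr_functional n.
rewrite /scaled_tau mulrDl TD -[RHS]addr0 -rmorphM; congr (_ + _).
rewrite (dt_vanish (ltnSn n)) ?field_trace0 //.
by apply/local_powP; exists (z * j x); rewrite mulrA.
Qed.

Lemma sfp_comb (a : 'I_r -> A) : sfp (fun m => \sum_(i < r) act (a i) (h i m)).
Proof.
suff H (l : seq 'I_r) : sfp (fun m => \sum_(i <- l) act (a i) (h i m)) by exact: H.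
elim: l => [|i l IHl].
  have -> : (fun m => \sum_(i <- [::]) act (a i) (h i m)) = (fun=> 0).
    by apply: functional_extensionality_dep => m; rewrite big_nil.
  exact: sfp_zero.
have -> : (fun m => \sum_(i0 <- i :: l) act (a i0) (h i0 m)) =
    (fun m => act (a i) (h i m) + \sum_(i <- l) act (a i) (h i m)).
  by apply: functional_extensionality_dep => m; rewrite big_cons.
by apply: sfp_add => //; exact: sfp_act.
Qed.

Lemma psi_comb n (a : 'I_r -> A) :
  pairing (fun m => \sum_(i < r) act (a i) (h i m)) (tau n) =
  \sum_(i < r) act (a i) (pairing (h i) (tau n)).
Proof.
have H (l : seq 'I_r) : sfp (fun m => \sum_(i <- l) act (a i) (h i m)) /\
   pairing (fun m => \sum_(i <- l) act (a i) (h i m)) (tau n) =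
   \sum_(i <- l) act (a i) (pairing (h i) (tau n)).
  elim: l => [|i l [IHs IHl]].
    have -> : (fun m => \sum_(i <- [::]) act (a i) (h i m)) = (fun=> 0).
      by apply: functional_extensionality_dep => m; rewrite big_nil.
    split; first exact: sfp_zero.
    rewrite big_nil /pairing (@vsum_fin _ _ _ Habs _ Hcomplete _ 0) ?big_ord0 // => i _.
    by rewrite scaler0.
  have -> : (fun m => \sum_(i0 <- i :: l) act (a i0) (h i0 m)) =
      (fun m => act (a i) (h i m) + \sum_(i <- l) act (a i) (h i m)).
    by apply: functional_extensionality_dep => m; rewrite big_cons.
  split; first by apply: sfp_add => //; exact: sfp_act.
  by rewrite (pairing_addl _ (sfp_act (a i) (sfh i)) IHs) (pairing_actl _ _ (sfh i)) IHl big_cons.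
by case: (H (index_enum 'I_r)).
Qed.

(** Since tau_n generates the functionals on A/p^(n+1), e = sum a_i h_i vanishes on all of them, so
    s e = pi^(n+1) e' for a special function e'. The two expansions of pi^(n+1) (x) e' in the basis
    give s a_i = pi^(n+1) y_i. *)
Lemma psi_independent n (a : 'I_r -> A) :
  \sum_(i < r) act (a i) (pairing (h i) (tau n)) = 0 -> forall i, prime_pow p n.+1 (a i).
Proof.
rewrite -psi_comb; set e := fun m => _ => e0.
have se : sfp e by exact: sfp_comb.
have [s [ps sE]] := prime_pow_sub_unif n.+1.
have [rho [rD rZ rK]] := linear_retraction (expf_neq0 n.+1 unif_neq0).
have [||e' [se' _ e'E]] := sfp_divide (g := unif ^+ n.+1) (s := s) se.
- by exists rho.
- move=> nu lnu nu0.
  have [|x px|c cE] := @tau_generates n (fun x => nu (s * x)).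
  + exact: klinearM.
  + by have [x' ->] := sE x px.
  have -> : (fun x => nu (s * x)) = (fun x => tau n (c * x)).
    by apply: functional_extensionality_dep => x; rewrite cE.
  by rewrite (sfnM (pairing_sfn se)) ?e0 ?act0 //; exact: tau_klinear.
case: Hh => _ basis.
have [|y [Hy _]] := basis [:: (1, e')].
  by apply: List.Forall_cons; [exact/sf_sfp | exact: List.Forall_nil].
have [|y0 [_ uniq]] := basis [:: (j (unif ^+ n.+1), e')].
  by apply: List.Forall_cons; [exact/sf_sfp | exact: List.Forall_nil].
have Y1 : y0 = [ffun i => j (unif ^+ n.+1) * y i].
  apply: uniq => W f [fDl fDr fM f0]; rewrite big_seq1 big_map big_enum /=.
  have := Hy W (fun x e => f (j (unif ^+ n.+1) * x) e); rewrite big_seq1 big_map big_enum /= mulr1.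
  move=> ->; first by apply: eq_bigr => i _; rewrite ffunE.
  split=> [x x' v Pv|x v v' Pv Pv'|b' x v Pv|x v -> Pv].
  - by rewrite mulrDr fDl.
  - by apply: fDr.
  - by rewrite mulrCA [LHS]fM.
  - by rewrite mulr0; apply: f0.
have Y2 : y0 = [ffun i => j (s * a i)].
  apply: uniq => W f [fDl fDr fM f0]; rewrite big_seq1 big_map big_enum /=.
  have sf_act a' (e1 : nat -> V) : sfp e1 -> sf #|k| kC b bc phi abs (fun m => act a' (e1 m)).
    by move=> se1; apply/sf_sfp; exact: sfp_act.
  have fM1 a' (e1 : nat -> V) : sfp e1 -> f (j a') e1 = f 1 (fun m => act a' (e1 m)).
    by move=> /sf_sfp se1; rewrite -fM // mulr1.
  rewrite fM1 //.
  have -> : (fun m => act (unif ^+ n.+1) (e' m)) = (fun m => \sum_(i < r) act (s * a i) (h i m)).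
    apply: functional_extensionality_dep => m; rewrite e'E /e act_sum.
    by apply: eq_bigr => i _; rewrite actM.
  under eq_bigr => i _ do rewrite ffunE fM1 //.
  have H (l : seq 'I_r) : sfp (fun m => \sum_(i <- l) act (s * a i) (h i m)) /\
     f 1 (fun m => \sum_(i <- l) act (s * a i) (h i m)) =
     \sum_(i <- l) f 1 (fun m => act (s * a i) (h i m)).
    elim: l => [|i l [IHs IHl]].
      have -> : (fun m => \sum_(i <- [::]) act (s * a i) (h i m)) = (fun=> 0).
        by apply: functional_extensionality_dep => m; rewrite big_nil.
      have sf0 : sf #|k| kC b bc phi abs (fun=> 0) by apply/sf_sfp; exact: sfp_zero.
      split; first exact: sfp_zero.
      rewrite big_nil; apply: (@addrI _ (f 1 (fun=> 0))); by rewrite -fDr // !addr0.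
    have E : (fun m => \sum_(i0 <- i :: l) act (s * a i0) (h i0 m)) =
        (fun m => act (s * a i) (h i m) + \sum_(i <- l) act (s * a i) (h i m)).
      by apply: functional_extensionality_dep => m; rewrite big_cons.
    rewrite E; split; first by apply: sfp_add => //; exact: sfp_act.
    rewrite big_cons -IHl -fDr //; first exact: sf_act.
    exact/sf_sfp.
  by case: (H (index_enum 'I_r)).
move=> i; apply: (prime_pow_cancel ps); apply/prime_powP; exists (y i).
have := congr1 (fun g : {ffun 'I_r -> Ap} => g i) Y1; rewrite Y2 !ffunE.
by rewrite rmorphXn.
Qed.

Lemma special_functions_torsion_basis (H : 'I_r -> nat -> seq (Ap * V)) n :
  (forall i, ET_image p j (j \o kA) kC b abs (h i) (H i)) ->
  is_torsion_basis #|k| phi (prime_pow p n.+1)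
    (fun i => tr_id kC (eval_Ep res (hyper_Ep dt n (H i)))).
Proof.
move=> HH; have psiE i := ET_image_pairing n (sfh i) (HH i).
split.
- move=> i a pa; rewrite psiE -(sfnM (pairing_sfn (sfh i)) _ (tau_klinear n)).
  rewrite -[RHS](pairing_zero (e := h i)); last by case: (sfh i).
  congr pairing; apply: functional_extensionality_dep => x.
  by rewrite tau_vanish // mulrC; exact: prime_powM.
- move=> y Hy.
  have [s [e [c [ps se sy]]]] :=
    sfp_surj_up_to_unit Hy (tau_klinear n) (expf_neq0 n v1n0) (@tau_vanish n) (@tau_lead n).
  (* y is killed by p^(n+1), modulo which the factor s can be inverted. *)
  have [u [v [pv uv]]] := comaximal n.+1 ps.
  have [a aE] := psi_span n se.
  exists (fun i => u * c * a i); under eq_bigr => i _ do rewrite psiE !actM.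
  rewrite -!act_sum -aE -sy -!actM.
  by rewrite -[LHS]act1 -uv act_addl (Hy v pv) addr0 mulrC.
- move=> a; under eq_bigr => i _ do rewrite psiE.
  exact: psi_independent.
Qed.

End LocalRing.

Theorem theorem6p4
  (k : finFieldType) (K : fieldType) (A : idomainType)
  (kA : {rmorphism k -> A}) (iA : {rmorphism A -> K}) (Ooo : set K)
  (HK : is_function_field (iA \o kA))
  (Hoo : is_closed_point (iA \o kA) Ooo)
  (HA : is_regular_ring (iA \o kA) Ooo iA)
  (R : realType) (Kbar : closedFieldType) (C : fieldType)
  (iK : {rmorphism K -> Kbar}) (jC : {rmorphism Kbar -> C}) (abs : C -> R)
  (HC : is_Cinfty abs Ooo iK jC)
  (L : divringClosed C) (HL : forall x : K, jC (iK x) \in L) :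
  let q := #|k| in
  let ell : A -> C := jC \o iK \o iA in
  let kC : k -> C := ell \o kA in
  forall
  (d : nat) (phi : A -> 'M[{poly C}]_d)
  (HE : is_Anderson_module q phi ell L)
  (Hunif : uniformizable q phi abs)
  (p : prime_idealr A) (Hp : exists2 x, x \in p & x != 0)
  (Ap : idomainType) (j : {rmorphism A -> Ap}) (Hj : is_local_ring p j)
  (Fp : fieldExtType k) (res : {rmorphism Ap -> Fp})
  (Hres : is_residue_field p j (j \o kA) res)
  (unif : A)
  (Hunif1 : forall y : Ap, local_pow p j 1 y <-> exists z, y = j unif * z)
  (b : nat -> A) (bc : A -> {poly k}) (Hb : is_kbasis kA b bc)
  (r : nat) (h : 'I_r -> nat -> 'cV[C]_d)
  (Hh : is_local_basis q kC b bc phi abs j h)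
  (dpi : nat -> Ap -> Ap) (Hdpi : hyper_ext (j \o kA) (j unif) dpi)
  (t : A) (Ht : forall c : k, t <> kA c)
  (Hdt : dpi 1%N (j t) \is a GRing.unit),
  (exists! dt : nat -> Ap -> Ap, hyper_ext (j \o kA) (j t) dt) /\
  forall dt : nat -> Ap -> Ap, hyper_ext (j \o kA) (j t) dt ->
    (forall g : nat -> seq (Ap * 'cV[C]_d),
       Hhat q p j (j \o kA) kC phi g ->
       forall n : nat,
         in_FpX kC (torsion q phi (prime_pow p n.+1))
           (eval_Ep res (hyper_Ep dt n g)) /\
         in_FpX kC (torsion q phi (prime_pow p n))
           (tensor_sub (eval_Ep res (hyper_Ep dt n g))
              (eval_Ep res
                 (scale_Ep ((dpi 1%N (j t))^-1 ^+ n) (hyper_Ep dpi n g))))) /\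
    (forall H : 'I_r -> nat -> seq (Ap * 'cV[C]_d),
       (forall i, ET_image p j (j \o kA) kC b abs (h i) (H i)) ->
       forall n : nat,
         is_torsion_basis q phi (prime_pow p n.+1)
           (fun i => tr_id kC (eval_Ep res (hyper_Ep dt n (H i))))).
Proof.
move=> q ell kC d phi HE Hunif p Hp Ap j Hj Fp res Hres unif Hunif1 b bc Hb r h Hh dpi Hdpi t Ht Hdt.
have [iA_inj regular] := HA.
have [_ Habs abs_le1 _ Hcomplete] := HC.
pose ellr : {rmorphism A -> C} := jC \o iK \o iA.
pose kCr : {rmorphism k -> C} := ellr \o kA.
have ell_inj : injective ellr by move=> x y H; exact/iA_inj/(fmorph_inj iK)/(fmorph_inj jC).
have Hfd z : finite_over kA z.
  have [[x0 [_ [n [v v_span]]]] _] := HK.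
  have [N HN] := finite_dimension (kK := iA \o kA) v_span (iA z).
  exists N => y; have [c [cn0 cE]] := HN (fun i => iA (y i)); exists c; split=> //.
  apply: iA_inj; rewrite rmorph0 -[RHS]cE rmorph_sum; apply: eq_bigr => l _.
  by rewrite rmorphM /= map_poly_comp horner_map.
have HE' : is_Anderson_module #|k| phi ellr L by [].
(* pi is not in k, hence transcendental over k, so some closed point is a pole of it; an element of
   [A] can have a pole only at infinity. *)
have unif_pole : 1 < abs (ellr unif).
  rewrite ltNge; apply/negP => /(proj1 (abs_le1 _)) Ou.
  have tr : ~ algebraicOver (iA \o kA) (iA unif).
    move=> /(proj2 HK)[c /iA_inj/esym].
    exact: (unif_notin_k Hj Hres Hunif1 Hp).
  have [O [HO nO]] := @exists_place_pole _ _ (iA \o kA) _ tr.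
  have OE : O = Ooo.
    apply: contrapT => On; apply: nO; apply: (proj1 (regular (iA unif))) => //.
    by exists unif.
  by apply: nO; rewrite OE.
have aD := actD kA ellr Habs Hunif.
have aDl := act_addl kA Habs HE' Hunif.
have aM := actM kA Habs HE' Hunif.
have a1 := act1 kA Habs HE' Hunif.
have ac : forall c x, act #|k| phi (kA c) x = kCr c *: x := act_const kA Habs HE' Hunif.
have as_ := act_small k phi Habs.
have aj a y := act_surj kA Habs HE' Hunif ell_inj (a := a) y.
have at_ y := act_division_tower kA Habs HE' Hunif y unif_pole.
split; first exact: (exists_unique_dt Hj Hres Hunif1 Hp Hfd Hdpi Hdt).
move=> dt Hdt_ext; split=> [g Hg n|H HH n].
  exact: (dt_evaluation_torsion Hj Hres Hunif1 Hp Hfd Hdpi (kC := kCr) aD aM ac Hdt Hdt_ext n Hg).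
exact: (special_functions_torsion_basis Hj Hres Hunif1 Hp Hfd Hdpi (kC := kCr) Habs Hcomplete
  aD aDl aM a1 ac as_ aj at_ Hb Hdt Hdt_ext Hh n HH).
Qed.
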